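(* Let $\mathbb{G}$ be a stratified Lie group of homogeneous dimension $Q$, let $0<\beta<1$, $0<\alpha<\alpha+\beta<Q$, and let $b\in L^1_{\mathrm{loc}}(\mathbb{G})$. Then the following assertions are equivalent: (T.1) $b\in\Lambda_\beta(\mathbb{G})$ and $b\ge 0$. (T.2) The commutator $[b,\mathcal{M}_\alpha]$ is bounded from $L^{p(\cdot)}(\mathbb{G})$ to $L^{q(\cdot)}(\mathbb{G})$ for all $(p(\cdot),q(\cdot))\in\mathscr{B}^{\alpha+\beta}(\mathbb{G})$. (T.3) The commutator $[b,\mathcal{M}_\alpha]$ is bounded from $L^{p(\cdot)}(\mathbb{G})$ to $L^{q(\cdot)}(\mathbb{G})$ for some $(p(\cdot),q(\cdot))\in\mathscr{B}^{\alpha+\beta}(\mathbb{G})$. (T.4) There exists an $s(\cdot)\in\mathscr{B}(\mathbb{G})$ such that $$\sup_{B\subset\mathbb{G}}\frac{1}{|B|^{\beta/Q}}\,\frac{\big\|\big(b-|B|^{-\alpha/Q}\mathcal{M}_{\alpha,B}(b)\big)\chi_B\big\|_{L^{s(\cdot)}(\mathbb{G})}}{\|\chi_B\|_{L^{s(\cdot)}(\mathbb{G})}}<\infty ,$$ where the supremum is over all balls $B\subset\mathbb{G}$. (T.5) For every $s(\cdot)\in\mathscr{B}(\mathbb{G})$, $$\sup_{B\subset\mathbb{G}}\frac{1}{|B|^{\beta/Q}}\,\frac{\big\|\big(b-|B|^{-\alpha/Q}\mathcal{M}_{\alpha,B}(b)\big)\chi_B\big\|_{L^{s(\cdot)}(\mathbb{G})}}{\|\chi_B\|_{L^{s(\cdot)}(\mathbb{G})}}<\infty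 .$$
   Context: Stratified group. $\mathbb{G}$ is a finite-dimensional, connected, simply connected Lie group whose Lie algebra has a vector space decomposition $\mathcal{G}=V_1\oplus\cdots\oplus V_m$ with $[V_1,V_j]=V_{j+1}$ for $1\le j\le m-1$ and $[V_1,V_j]=0$ for $j\ge m$. Its dilations are $\delta_r(\sum_k X_k)=\sum_k r^kX_k$ ($X_k\in V_k$, $r>0$), transported to $\mathbb{G}$ by the exponential map (a diffeomorphism). The homogeneous dimension is $Q=\sum_{j=1}^m j\dim V_j$. The bi-invariant Haar measure $dx$ is the image of Lebesgue measure on $\mathcal{G}$ under $\exp$; $|E|$ is the Haar measure of a measurable set $E$, and $\chi_E$ its characteristic function. The identity is $\theta$. Balls. Fix a homogeneous norm $\rho:\mathbb{G}\to[0,\infty)$: continuous, $C^\infty$ on $\mathbb{G}\setminus\{\theta\}$, with $\rho(x^{-1})=\rho(x)$, $\rho(\delta_tx)=t\rho(x)$ for $t>0$, and $\rho(x)=0$ iff $x=\theta$. A ball is $B(x,r)=\{y\in\mathbb{G}:\rho(y^{-1}x)<r\}$ with $x\in\mathbb{G}$, $r>0$; one has $|B(x,r)|=c_1r^Q$ with $c_1$ depending only on $\mathbb{G}$ (and $\rho$). Lipschitz space. For $0<\beta<1$, $b\in\Lambda_\beta(\mathbb{G})$ means that there is $C>0$ with $|b(x)-b(y)|\le C\rho(y^{-1}x)^\beta$ for all $x,y\in\mathbb{G}$. Locally integrable functions are, as usual, identified when they agree almost everywhere. Maximal operators. For $0\le\alpha<Q$ and locally integrable $f:\mathbb{G}\to\mathbb{R}$,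 $$\mathcal{M}_\alpha(f)(x)=\sup_{B\ni x}\frac{1}{|B|^{1-\alpha/Q}}\int_B|f(y)|\,dy,$$ the supremum over all balls $B\subset\mathbb{G}$ containing $x$; $\mathcal{M}=\mathcal{M}_0$ is the Hardy–Littlewood maximal operator. For a fixed ball $B^*$, $$\mathcal{M}_{\alpha,B^*}(f)(x)=\sup_{x\in B\subset B^*}\frac{1}{|B|^{1-\alpha/Q}}\int_B|f(y)|\,dy,$$ the supremum over all balls $B$ with $x\in B\subset B^*$. The nonlinear commutator is $[b,\mathcal{M}_\alpha](f)(x)=b(x)\mathcal{M}_\alpha(f)(x)-\mathcal{M}_\alpha(bf)(x)$. Variable exponents. $\mathscr{P}(\mathbb{G})$ is the set of measurable $p(\cdot):\mathbb{G}\to(1,\infty)$ with $1<p_-\le p(x)\le p_+<\infty$, where $p_-=\operatorname{ess\,inf}_{\mathbb{G}}p$ and $p_+=\operatorname{ess\,sup}_{\mathbb{G}}p$. $L^{p(\cdot)}(\mathbb{G})$ is the set of measurable $f$ with $\int_{\mathbb{G}}(|f(x)|/\eta)^{p(x)}dx<\infty$ for some $\eta>0$, normed by $\|f\|_{L^{p(\cdot)}(\mathbb{G})}=\inf\{\eta>0:\int_{\mathbb{G}}(|f(x)|/\eta)^{p(x)}dx\le1\}$. $\mathscr{B}(\mathbb{G})$ is the set of $p(\cdot)\in\mathscr{P}(\mathbb{G})$ for which $\mathcal{M}$ is bounded on $L^{p(\cdot)}(\mathbb{G})$. For $0<\gamma<Q$, $(p(\cdot),q(\cdot))\in\mathscr{B}^\gamma(\mathbb{G})$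 means: $p(\cdot)\in\mathscr{P}(\mathbb{G})$, $p_+<Q/\gamma$, $1/q(\cdot)=1/p(\cdot)-\gamma/Q$, and $q(\cdot)(Q-\gamma)/Q\in\mathscr{B}(\mathbb{G})$. An operator $T$ (possibly nonlinear) is bounded from $L^{p(\cdot)}(\mathbb{G})$ to $L^{q(\cdot)}(\mathbb{G})$ if there is $C>0$ with $\|Tf\|_{L^{q(\cdot)}(\mathbb{G})}\le C\|f\|_{L^{p(\cdot)}(\mathbb{G})}$ for all $f\in L^{p(\cdot)}(\mathbb{G})$. *)

(* Defs.v *)
From HB Require Import structures.
From mathcomp Require Import all_boot all_order all_algebra.
From mathcomp Require Import all_classical all_reals all_analysis ess_sup_inf.

Set Implicit Arguments.
Unset Strict Implicit.
Unset Printing Implicit Defensive.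

Import Order.TTheory GRing.Theory Num.Theory.
Import numFieldNormedType.Exports.

Local Open Scope classical_set_scope.
Local Open Scope ring_scope.

Section lebesgue_rV.
Context {R : realType} {n : nat}.
Local Notation V := 'rV[R]_n.+1.
Local Open Scope ereal_scope.

Definition box (ab : V * V) : set V :=
  [set x | forall i, (ab.1 ord0 i < x ord0 i <= ab.2 ord0 i)%R].

(* With [Num.max 0], boxes with some [ab.2 i < ab.1 i], which are empty, have
   volume 0. *)
Definition box_volume (ab : V * V) : \bar R :=
  (\prod_i Num.max 0 (ab.2 ord0 i - ab.1 ord0 i))%R%:E.

Definition lebesgue_outer (A : set V) : \bar R :=
  ereal_inf [set \sum_(k <oo) box_volume (F k) |
             F in [set F : (V * V)^nat | A `<=` \bigcup_k box (F k)]].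

Lemma box_volume_ge0 ab : 0 <= box_volume ab.
Proof. by rewrite lee_fin prodr_ge0// => i _; rewrite le_max lexx. Qed.

Lemma lebesgue_outer_ge0 A : 0 <= lebesgue_outer A.
Proof.
apply: le_ereal_inf_tmp => _ [F _ <-].
by apply: nneseries_ge0 => k _ _; exact: box_volume_ge0.
Qed.

Lemma le_lebesgue_outer : {homo lebesgue_outer : A B / A `<=` B >-> A <= B}.
Proof.
move=> A B AB; apply/ereal_inf_le_tmp => _ [F BF <-].
by exists F => //; exact: subset_trans AB BF.
Qed.

Lemma lebesgue_outer0 : lebesgue_outer set0 = 0.
Proof.
apply/eqP; rewrite eq_le lebesgue_outer_ge0 andbT.
apply: ereal_inf_lbound; exists (fun=> (0, 0)%R) => //.
apply: eseries0 => k _ _; rewrite /box_volume (bigD1 ord0)//=.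
by rewrite !mxE subrr maxxx mul0r.
Qed.

Lemma lebesgue_outer_sigma_subadditive : sigma_subadditive lebesgue_outer.
Proof.
move=> A; have [[i ioo]|] := pselect (exists i, lebesgue_outer (A i) = +oo).
  rewrite (eseries_pinfty _ _ ioo) ?leey// => k _.
  by rewrite -ltNye (lt_le_trans _ (lebesgue_outer_ge0 _)).
rewrite -forallNE => Aoo.
suff add2e (e : {posnum R}) : lebesgue_outer (\bigcup_k A k) <=
    \sum_(i <oo) lebesgue_outer (A i) + e%:num%:E.
  by apply/lee_addgt0Pr => _/posnumP[].
rewrite (le_trans _ (epsilon_trick _ _ _))//; last first.
  by move=> k; exact: lebesgue_outer_ge0.
pose P k (F : (V * V)^nat) := A k `<=` \bigcup_j box (F j) /\
  \sum_(j <oo) box_volume (F j) <=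
    lebesgue_outer (A k) + (e%:num / (2 ^ k.+1)%:R)%:E.
have [G PG] : {G : ((V * V)^nat)^nat & forall k, P k (G k)}.
  apply: (@choice _ _ P) => k; rewrite /P /lebesgue_outer.
  set S := (X in ereal_inf X); move infS : (ereal_inf S) => iS.
  case: iS infS => [r Sr|Soo|Soo].
  - have en1 : (0 < e%:num / (2 ^ k.+1)%:R)%R by [].
    have /(lb_ereal_inf_adherent en1) : ereal_inf S \is a fin_num by rewrite Sr.
    move=> [_ [F AF <-] xS]; exists F; split => //.
    by rewrite -Sr; exact/ltW.
  - by have := Aoo k; rewrite /lebesgue_outer -/S Soo.
  - by have := lebesgue_outer_ge0 (A k); rewrite /lebesgue_outer -/S Soo.
pose vG := box_volume \o uncurry G.
have vG_ge0 x : 0 <= vG x by exact: box_volume_ge0.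
apply: (@le_trans _ _ (\esum_(i in setT) vG i)).
  apply: ereal_inf_lbound => /=.
  have /card_esym/ppcard_eqP[f] := card_nat2.
  exists (uncurry G \o f).
    move=> t [i _ /(PG i).1[j _ Gij]]; exists (f^-1%FUN (i, j)) => //=.
    by rewrite invK ?inE.
  rewrite -(esum_pred_image vG _ xpredT) ?[fun=> _]set_true//.
  by rewrite image_eq.
rewrite (_ : esum _ _ = \sum_(i <oo) \sum_(j <oo) box_volume (G i j));
  last first.
  pose J : nat -> set (nat * nat) := fun i => [set (i, j) | j in setT].
  rewrite (_ : setT = \bigcup_k J k); last first.
    by rewrite predeqE => -[a b]; split => // _; exists a => //; exists b.
  rewrite esum_bigcupT /=; last 2 first.
    - apply/trivIsetP => i j _ _ ij.
      rewrite predeqE => -[k m] /=; split => //= -[] [_] _ [<-{k} _].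
      by move=> [m' _] [] /esym/eqP; rewrite (negbTE ij).
    - by move=> i; exact: vG_ge0.
  rewrite -(image_id [set: nat]) -fun_true esum_pred_image//; last first.
    by move=> k _; exact: esum_ge0.
  apply: eq_eseriesr => /= j _.
  rewrite -(esum_pred_image vG (pair j) predT)//=; last first.
    by move=> ? ? _ _; exact: (@can_inj _ _ _ snd).
  by congr esum; rewrite predeqE => -[a b]; split; move=> [i _ <-]; exists i.
apply: lee_lim.
- apply: is_cvg_nneseries => k *.
  by apply: nneseries_ge0 => m *; exact: (vG_ge0 (k, m)).
- apply: is_cvg_nneseries => k *; apply: adde_ge0 => //.
  exact: lebesgue_outer_ge0.
- by near=> k; apply: lee_sum => i _; exact: (PG i).2.
Unshelve. all: by end_near. Qed.

HB.instance Definition _ := isOuterMeasure.Build R V lebesgue_outer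
  lebesgue_outer0 lebesgue_outer_ge0 le_lebesgue_outer
  lebesgue_outer_sigma_subadditive.

End lebesgue_rV.
Arguments lebesgue_outer : clear implicits.

(* ['rV[R]_n.+1] with its sigma-algebra of Lebesgue measurable sets. *)
Notation lebesgue_rV_type R n := (caratheodory_type (lebesgue_outer R n)).

Definition lebesgue_rV (R : realType) (n : nat) :
    set (lebesgue_rV_type R n) -> \bar R := lebesgue_outer R n.
Arguments lebesgue_rV : clear implicits.
HB.instance Definition _ (R : realType) (n : nat) :=
  isMeasure.Build _ _ _ (lebesgue_rV R n)
    (@caratheodory_measure0 _ _ (lebesgue_outer R n))
    (@caratheodory_measure_ge0 _ _ (lebesgue_outer R n))
    (@caratheodory_measure_sigma_additive _ _ (lebesgue_outer R n)).

Section Lie_algebra.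
Context {R : fieldType} {V : lmodType R} (bracket : V -> V -> V).

(* [iterated_bracket [:: x1; ...; xk]] is [x1, [x2, [..., [x(k-1), xk]]]]. *)
Fixpoint iterated_bracket (w : seq V) : V :=
  match w with
  | [::] => 0
  | [:: x] => x
  | x :: w' => bracket x (iterated_bracket w')
  end.

(* Dynkin's form of the Baker-Campbell-Hausdorff series log(exp x exp y), for a
   Lie algebra of nilpotency step at most m: the sum, over k >= 1 and pairs
   (r_i, s_i), i < k, with r_i + s_i > 0, of
     (-1)^(k-1) / k * [x^r_0 y^s_0 ... x^r_(k-1) y^s_(k-1)]
       / ((r_0 + s_0 + ... + r_(k-1) + s_(k-1)) * \prod_i r_i! s_i!).
   The omitted terms, with k > m or some r_i, s_i > m, are iterated brackets of
   more than m elements, hence 0. *)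
Definition BCH (m : nat) (x y : V) : V :=
  \sum_(1 <= k < m.+1) ((-1) ^+ k.-1 / k%:R) *:
    \sum_(e : {ffun 'I_k -> 'I_m.+1 * 'I_m.+1}
          | [forall i, 0 < (e i).1 + (e i).2]%N)
      ((\sum_i ((e i).1 + (e i).2))%N%:R *
       \prod_i ((e i).1`! * (e i).2`!)%N%:R)^-1 *:
      iterated_bracket
        (flatten [seq nseq (e i).1 x ++ nseq (e i).2 y | i <- enum 'I_k]).

End Lie_algebra.

(* The span of the brackets of elements of U with elements of W; by bilinearity,
   those of basis elements suffice. *)
Definition bracketv {R : fieldType} {V : vectType R} (bracket : V -> V -> V)
    (U W : {vspace V}) : {vspace V} :=
  <<[seq bracket u w | u <- vbasis U, w <- vbasis W]>>%VS.

(* A stratified group of dimension n.+1 in exponential coordinates: G is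
   identified with its Lie algebra, and the latter with R^(n.+1), so that exp is
   the identity, the unit is 0 and the inverse of x is - x. [sg_layer k] is V_k
   for 1 <= k <= [sg_step]; its other values are irrelevant. The group axioms
   are consequences of the others (Baker-Campbell-Hausdorff theorem). *)
Record stratified_group (R : realType) (n : nat) := StratifiedGroup {
  sg_bracket : 'rV[R]_n.+1 -> 'rV[R]_n.+1 -> 'rV[R]_n.+1;
  sg_bracket_linearl : forall y, linear (sg_bracket ^~ y);
  sg_bracket_linearr : forall x, linear (sg_bracket x);
  sg_bracketxx : forall x, sg_bracket x x = 0;
  sg_jacobi : forall x y z,
    sg_bracket x (sg_bracket y z) + sg_bracket y (sg_bracket z x) +
    sg_bracket z (sg_bracket x y) = 0;
  sg_step : nat;
  sg_layer : nat -> {vspace 'rV[R]_n.+1};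
  sg_layer_full : (\sum_(i < sg_step) sg_layer i.+1)%VS = fullv;
  sg_layer_direct : directv (\sum_(i < sg_step) sg_layer i.+1)%VS;
  sg_layerS : forall j, (1 <= j < sg_step)%N ->
    bracketv sg_bracket (sg_layer 1) (sg_layer j) = sg_layer j.+1;
  sg_layer_step : bracketv sg_bracket (sg_layer 1) (sg_layer sg_step) = 0%VS;
  sg_mul : 'rV[R]_n.+1 -> 'rV[R]_n.+1 -> 'rV[R]_n.+1;
  sg_mulE : forall x y, sg_mul x y = BCH sg_bracket sg_step x y;
  sg_mulA : associative sg_mul;
  sg_mul0x : left_id 0 sg_mul;
  sg_mulNx : left_inverse 0 -%R sg_mul
}.

Section stratified_group_geometry.
Context {R : realType} {n : nat} (G : stratified_group R n).
Local Notation V := 'rV[R]_n.+1.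

Definition dilation (r : R) (x : V) : V :=
  \sum_(i < sg_step G)
    r ^+ i.+1 *: sumv_pi (\sum_(j < sg_step G) sg_layer G j.+1)%VS i x.

Definition homogeneous_dim : nat :=
  (\sum_(i < sg_step G) i.+1 * \dim (sg_layer G i.+1))%N.

(* C^k on an open set U, through iterated directional derivatives. *)
Fixpoint Ck_on (k : nat) (U : set V) (f : V -> R) : Prop :=
  match k with
  | 0 => forall x, U x -> {for x, continuous f}
  | k'.+1 => forall v, (forall x, U x -> derivable f x v) /\
                       Ck_on k' U (fun x => 'D_v f x)
  end.

Record homogeneous_norm (rho : V -> R) : Prop := HomogeneousNorm {
  hnorm_ge0 : forall x, 0 <= rho x;
  hnorm_continuous : continuous rho;
  hnorm_smooth : forall k, Ck_on k [set x | x != 0] rho;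
  hnorm_inv : forall x, rho (- x) = rho x;
  hnorm_dilation : forall t x, 0 < t -> rho (dilation t x) = t * rho x;
  hnorm_eq0 : forall x, rho x = 0 <-> x = 0
}.

Variable rho : V -> R.

Definition hball (x : V) (r : R) : set V := [set y | rho (sg_mul G (- y) x) < r].

Definition is_hball (B : set V) : Prop := exists x r, 0 < r /\ B = hball x r.

End stratified_group_geometry.

Section function_spaces_and_operators.
Context {R : realType} {n : nat} (G : stratified_group R n).
Local Notation V := 'rV[R]_n.+1.
Local Notation T := (lebesgue_rV_type R n).
Local Notation haar := (lebesgue_rV R n).
Local Notation Q := ((homogeneous_dim G)%:R : R).
Variable rho : V -> R.
Local Open Scope ereal_scope.

Definition locally_integrable_rV (f : V -> R) : Prop :=
  measurable_fun setT (f : T -> R) /\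
  forall K : set V, compact K -> \int[haar]_(x in K) `|f x|%:E < +oo.

(* b is only given up to equality almost everywhere. *)
Definition Lipschitz_space (beta : R) (b : V -> R) : Prop :=
  exists2 b' : V -> R, {ae haar, forall x, b x = b' x} &
    exists2 C : R, (0 < C)%R &
      forall x y, (`|b' x - b' y| <= C * rho (sg_mul G (- y) x) `^ beta)%R.

Definition frac_average (alpha : R) (f : V -> R) (B : set V) : \bar R :=
  (haar B `^ (1 - alpha / Q))^-1 * \int[haar]_(y in B) `|f y|%:E.

Definition fractional_maximal (alpha : R) (f : V -> R) (x : V) : \bar R :=
  ereal_sup [set frac_average alpha f B | B in
    [set B | is_hball G rho B /\ B x]].

Definition local_fractional_maximal (alpha : R) (Bstar : set V) (f : V -> R)
    (x : V) : \bar R :=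
  ereal_sup [set frac_average alpha f B | B in
    [set B | [/\ is_hball G rho B, B x & B `<=` Bstar]]].

Definition maximal_commutator (b : V -> R) (alpha : R) (f : V -> R) (x : V) :
    \bar R :=
  (b x)%:E * fractional_maximal alpha f x -
  fractional_maximal alpha (fun y => b y * f y)%R x.

Definition modular (p : V -> R) (f : V -> \bar R) (eta : R) : \bar R :=
  \int[haar]_x (`|f x| * eta^-1%:E) `^ p x.

Definition variable_Lebesgue (p : V -> R) (f : V -> R) : Prop :=
  measurable_fun setT (f : T -> R) /\
  exists2 eta : R, (0 < eta)%R & modular p (EFin \o f) eta < +oo.

(* The norm is +oo for functions that are not in L^p(.). *)
Definition variable_norm (p : V -> R) (f : V -> \bar R) : \bar R :=
  ereal_inf [set eta%:E | eta in
    [set eta | (0 < eta)%R /\ modular p f eta <= 1]].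

Definition bounded_operator (p q : V -> R)
    (A : (V -> R) -> V -> \bar R) : Prop :=
  exists2 C : R, (0 < C)%R & forall f, variable_Lebesgue p f ->
    variable_norm q (A f) <= C%:E * variable_norm p (EFin \o f).

Definition exponent_minus (p : V -> R) : \bar R := ess_inf haar (EFin \o p).
Definition exponent_plus (p : V -> R) : \bar R := ess_sup haar (EFin \o p).

Definition exponent (p : V -> R) : Prop :=
  [/\ measurable_fun setT (p : T -> R), forall x, (1 < p x)%R,
      1 < exponent_minus p & exponent_plus p < +oo].

Definition maximal_exponent (p : V -> R) : Prop :=
  exponent p /\ bounded_operator p p (fractional_maximal 0).

Definition fractional_exponents (gamma : R) (p q : V -> R) : Prop :=
  [/\ exponent p, exponent_plus p < (Q / gamma)%:E,
      forall x, ((q x)^-1 = (p x)^-1 - gamma / Q)%R &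
      maximal_exponent (fun x => q x * (Q - gamma) / Q)%R].

Definition oscillation (alpha beta : R) (s b : V -> R) (B : set V) : \bar R :=
  (haar B `^ (beta / Q))^-1 *
  (variable_norm s (fun x =>
     ((b x)%:E - (haar B `^ (alpha / Q))^-1 *
                 local_fractional_maximal alpha B b x) * (\1_B x)%:E)
   / variable_norm s (EFin \o \1_B)).

Definition bounded_oscillation (alpha beta : R) (s b : V -> R) : Prop :=
  ereal_sup [set oscillation alpha beta s b B | B in is_hball G rho] < +oo.

End function_spaces_and_operators.

(* Main.v *)
From HB Require Import structures.
Require Import Defs.
From mathcomp Require Import all_boot all_order all_algebra.
From mathcomp Require Import all_classical all_reals all_analysis.
From mathcomp Require Import measurable_realfun ess_sup_inf ring lra.

Set Implicit Arguments.
Unset Strict Implicit.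
Unset Printing Implicit Defensive.

Import Order.TTheory GRing.Theory Num.Theory.
Import numFieldNormedType.Exports.

Local Open Scope classical_set_scope.
Local Open Scope ring_scope.

(* (T.1) makes the average of b f over a ball containing x differ from b(x) times
   the average of f by at most C |B|^(beta/Q) times the average of |f|. Hence
   |[b, M_alpha] f| <= C M_(alpha+beta) f almost everywhere, and the oscillation
   quantity of (T.4)-(T.5) is bounded pointwise. With theta = (alpha+beta)/Q and
   s = q (1 - theta), Young's inequality gives the Hedberg-type estimate
   M_(alpha+beta) f / eta <= (M g)^(1 - theta) for g = (|f| / eta)^(p/s) when the
   modular of f / eta is at most 1; boundedness of M on L^s(.) then yields (T.2).

   Conversely, let h = (|b|_B - b)^+ on B and 0 elsewhere. Testing the commutator
   on the indicator of B, or using the oscillation quantity, bounds the L^s(.)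
   norm of h by C |B|^(beta/Q) times that of the indicator of B, and boundedness
   of M on L^s(.) turns this into a bound on the average of h. Since
   |b - |b|_B| <= |b| - |b|_B + 2 h on B, b satisfies the Campanato condition for
   beta with respect to the averages of |b|, hence agrees almost everywhere with
   a Lipschitz function; and b^- <= h gives b >= 0.

   Nothing requires invariance of the measure, only that a ball of radius r has
   volume comparable to r^Q. This holds because, in coordinates adapted to the
   layers, left translations have the form x |-> x + phi(x), where the i-th
   coordinate of phi depends only on coordinates of smaller weight: such maps do
   not increase the outer measure. The exponent s = 2 lies in B(G) by the weak
   type (1,1) of M; it serves to pass from all exponents to one. *)

(** * Boxes and images of outer measure under maps *)

(** The measure is given by coverings with boxes, so a map is controlled only from above, through
    the outer measure of images; a lower bound for the volume of a ball comes from the upper bound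
    for the inverse map. Maximal functions may be infinite and a commutator may be a difference of
    infinities: finiteness almost everywhere comes from the weak type estimate, and domination is
    expressed by a comparison of integrals that holds for arbitrary nonnegative functions. The norm
    of a variable exponent space enters only through modulars at most 1, and constants are enlarged
    where a strict inequality stands in for an attained infimum.

    Testing the commutator on the indicator of B relates L^p to L^q, while the maximal operator is
    bounded on L^s. The exponents satisfy 1/p = (1 - theta)/s + theta and 1/s = 1/q + theta/s,
    whence |1_B|_p <= 2 |1_B|_s^(1 - theta) |B|^theta and |h|_s <= |h|_q |1_B|_s^theta for h
    supported in B. In the product the powers of |1_B|_s add up to 1 and the surplus power of |B| is
    beta/Q. *)

Section boxes.
Context {R : realType} {n : nat}.
Local Notation V := 'rV[R]_n.+1.
Local Notation mu := (lebesgue_outer R n).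
Implicit Types (a b x : V) (i : 'I_n.+1) (c : R).

Definition update a i c : V := \row_j (if j == i then c else a ord0 j).

Definition bvol a b : R := \prod_i Num.max 0 (b ord0 i - a ord0 i).

Lemma bvol_ge0 a b : 0 <= bvol a b.
Proof. by apply: prodr_ge0 => i _; rewrite le_max lexx. Qed.

Lemma bvolD1 i a b : bvol a b =
  Num.max 0 (b ord0 i - a ord0 i) *
  \prod_(j | j != i) Num.max 0 (b ord0 j - a ord0 j).
Proof. by rewrite /bvol (bigD1 i). Qed.

(** Clipping with [Num.min] and [Num.max] makes the cut valid for every [c], even outside the edge,
    and for empty boxes: the positive part of an edge length is additive under it. *)
Lemma bvol_split a b i c :
  bvol a b = bvol a (update b i (Num.min (b ord0 i) c)) +
             bvol (update a i (Num.max (a ord0 i) c)) b.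
Proof.
rewrite !(bvolD1 i) !mxE !eqxx.
set P := \prod_(j | _) _; set P1 := \prod_(j | _) _; set P2 := \prod_(j | _) _.
have -> : P1 = P by apply: eq_bigr => j ji; rewrite !mxE (negbTE ji).
have -> : P2 = P by apply: eq_bigr => j ji; rewrite !mxE (negbTE ji).
rewrite -mulrDl; congr (_ * _).
move: (a ord0 i) (b ord0 i) => u v.
by case: (leP v c); case: (leP u c); case: (leP 0 (v - u)); case: (leP 0 (c - u));
  case: (leP 0 (v - c)); lra.
Qed.

Lemma box_splitI a b i c : box (a, update b i (Num.min (b ord0 i) c)) =
  box (a, b) `&` [set x | x ord0 i <= c].
Proof.
apply/seteqP; split => x /=.
  move=> abx; split; last first.
    by have := abx i; rewrite !mxE eqxx le_min => /andP[_ /andP[_ ->]].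
  move=> j; have := abx j; rewrite !mxE; case: eqP => [->|_//].
  by rewrite le_min => /andP[-> /andP[-> _]].
move=> [abx xc] j; have := abx j; rewrite !mxE; case: eqP => [->|_//].
by rewrite le_min => /andP[-> ->].
Qed.

Lemma box_splitC a b i c : box (update a i (Num.max (a ord0 i) c), b) =
  box (a, b) `&` ~` [set x | x ord0 i <= c].
Proof.
apply/seteqP; split => x /=.
  move=> abx; split; last first.
    have := abx i; rewrite !mxE eqxx gt_max => /andP[/andP[_ xc] _].
    by apply/negP; rewrite -ltNge.
  move=> j; have := abx j; rewrite !mxE; case: eqP => [->|_//].
  by rewrite gt_max => /andP[/andP[-> _] ->].
move=> [abx /negP]; rewrite -ltNge => xc j.
have := abx j; rewrite !mxE; case: eqP => [->|_//].
by rewrite gt_max xc => /andP[-> ->].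
Qed.

Lemma box_split a b i c : box (a, b) =
  box (a, update b i (Num.min (b ord0 i) c)) `|`
  box (update a i (Num.max (a ord0 i) c), b).
Proof. by rewrite box_splitI box_splitC -setIUr setUv setIT. Qed.

Lemma outer_box_le a b : (mu (box (a, b)) <= (bvol a b)%:E)%E.
Proof.
apply: ereal_inf_lbound => /=.
exists (fun k => if k is 0%N then (a, b) else (0 : V, 0 : V)).
  by move=> x abx; exists 0%N.
rewrite (nneseries_split 0 1)// ?big_nat1; last first.
  by move=> k _; exact: box_volume_ge0.
rewrite add0n eseries0 ?adde0// => -[//|k] _ _.
by rewrite /box_volume (bigD1 ord0)//= !mxE subrr maxxx mul0r.
Qed.

(** Cutting every box of a cover of X at height [c] gives covers of the two parts of X with the same
    total volume, which is Caratheodory's criterion. *)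
Lemma halfspace_measurable i c : mu.-caratheodory [set x | x ord0 i <= c].
Proof.
apply: le_caratheodory_measurable => X.
apply: le_ereal_inf_tmp => _ [F XF <-].
pose F1 k := ((F k).1, update (F k).2 i (Num.min ((F k).2 ord0 i) c)).
pose F2 k := (update (F k).1 i (Num.max ((F k).1 ord0 i) c), (F k).2).
have -> : (\sum_(k <oo) box_volume (F k) =
    \sum_(k <oo) box_volume (F1 k) + \sum_(k <oo) box_volume (F2 k))%E.
  rewrite -nneseriesD; [|by move=> *; exact: box_volume_ge0..].
  apply: eq_eseriesr => k _; rewrite /box_volume -EFinD; congr EFin.
  exact: bvol_split.
apply: leeD; apply: ereal_inf_lbound => /=.
  exists F1 => // x [/XF[k _ xk] xc]; exists k => //.
  by rewrite /F1 box_splitI; split => //; case: (F k) xk.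
exists F2 => // x [/XF[k _ xk] xc]; exists k => //.
by rewrite /F2 box_splitC; split => //; case: (F k) xk.
Qed.

Local Notation T := (lebesgue_rV_type R n).

Lemma box_measurable a b : measurable (box (a, b) : set T).
Proof.
have -> : box (a, b) = \bigcap_(i in [set: 'I_n.+1])
    ([set x | x ord0 i <= b ord0 i] `&` ~` [set x | x ord0 i <= a ord0 i]).
  apply/seteqP; split => x /=.
    move=> abx i _; have /andP[ax xb] := abx i; split => //.
    by apply/negP; rewrite -ltNge.
  by move=> abx i; have [/= -> /negP] := abx i I; rewrite -ltNge => ->.
apply: (@fin_bigcap_measurable _ T); first exact: finite_finset.
by move=> i _; apply: (@measurableI _ T);
  [|apply: (@measurableC _ T)]; exact: halfspace_measurable.
Qed.

(** Enumerates the boxes with rational corners, which make open sets countable unions of boxes. A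
    number that codes nothing yields the empty box. *)
Definition rat_box (k : nat) : V * V :=
  match unpickle k with
  | Some (p, q) => (map_mx ratr (p : 'rV[rat]_n.+1), map_mx ratr (q : 'rV[rat]_n.+1))
  | None => (0, 0)
  end.

Lemma rat_box_nbhs x (U : set V) : nbhs x U ->
  exists k, box (rat_box k) x /\ box (rat_box k) `<=` U.
Proof.
rewrite nbhs_ballP => -[e /= e0 xU].
have [p hp] : {p : 'rV[rat]_n.+1 & forall i, x ord0 i - e < ratr (p ord0 i) < x ord0 i}.
  suff /choice[f fP] : forall i, exists q : rat, x ord0 i - e < ratr q < x ord0 i.
    by exists (\row_i f i) => i; rewrite mxE.
  move=> i; have [|q] := @rat_in_itvoo R (x ord0 i - e) (x ord0 i); first lra.
  by rewrite in_itv/=; exists q.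
have [q hq] : {p : 'rV[rat]_n.+1 & forall i, x ord0 i < ratr (p ord0 i) < x ord0 i + e}.
  suff /choice[f fP] : forall i, exists q : rat, x ord0 i < ratr q < x ord0 i + e.
    by exists (\row_i f i) => i; rewrite mxE.
  move=> i; have [|q] := @rat_in_itvoo R (x ord0 i) (x ord0 i + e); first lra.
  by rewrite in_itv/=; exists q.
exists (pickle (p, q)); rewrite /rat_box pickleK; split.
  by move=> i /=; rewrite !mxE; have /andP[_ ->] := hp i; have /andP[/ltW -> _] := hq i.
move=> y /= hy; apply: xU; split => // i j; rewrite !ord1.
rewrite /ball/= ltr_distlC.
have := hy j; rewrite !mxE; have := hp j; have := hq j.
by move=> /andP[? ?] /andP[? ?] /andP[? ?]; apply/andP; split; lra.
Qed.

Lemma open_measurable_rV (U : set V) : open U -> measurable (U : set T).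
Proof.
move=> oU; have -> : U = \bigcup_(k in [set k | box (rat_box k) `<=` U]) box (rat_box k).
  apply/seteqP; split => x.
    move=> Ux; have [k [kx kU]] := @rat_box_nbhs x U (open_nbhs_nbhs (conj oU Ux)).
    by exists k.
  by move=> [k /= kU kx]; exact: kU.
rewrite bigcup_mkcond; apply: (@bigcup_measurable _ T) => k _.
case: ifPn => _; last exact: (@measurable0 _ T).
by case: (rat_box k) => a b; exact: box_measurable.
Qed.

End boxes.

(** * Covers of a box have at least its volume *)

Lemma integral_itv_indic (R : realType) (c a b : R) : 0 <= c ->
  (\int[lebesgue_measure]_t (c * \1_(`]a, b]%classic) t)%:E =
   (c * Num.max 0 (b - a))%:E)%E.
Proof.
move=> c0; under eq_integral do rewrite EFinM.
rewrite ge0_integralZl//=; last by apply/measurable_EFinP; exact: measurable_indic.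
rewrite integral_indic//= setIT lebesgue_measure_itv/= lte_fin.
rewrite EFinM; congr (_ * _)%E; case: ltP => ab.
  by rewrite -EFinB; congr EFin; rewrite max_r// subr_ge0 ltW.
by rewrite max_l// subr_le0.
Qed.

(** Induction on the dimension, by slicing: the length of the last edge is the integral of an
    indicator in [t], the sum and the integral are exchanged, and the slices at height [t] are
    compared. The predicate [P] lets a slice retain only the boxes that it meets; corners are
    functions on [nat] so that the dimension can vary. *)
Lemma cover_volume (R : realType) (N : nat) (a b : nat -> R)
    (A B : nat -> nat -> R) (P : nat -> bool) :
  (forall x : nat -> R, (forall i, (i < N)%N -> a i < x i <= b i) ->
     exists2 k, P k & forall i, (i < N)%N -> A k i < x i <= B k i) ->
  ((\prod_(i < N) Num.max 0 (b i - a i))%:E <=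
   \sum_(k <oo) ((P k)%:R * \prod_(i < N) Num.max 0 (B k i - A k i))%:E)%E.
Proof.
elim: N P => [|N IH] P cov.
  rewrite big_ord0; have [//|k Pk _] := cov (fun=> 0).
  apply: (@le_trans _ _ (\sum_(k <= j < k.+1) ((P j)%:R * \prod_(i < 0) Num.max 0 (B j i - A j i))%:E)%E).
    by rewrite big_nat1 Pk big_ord0 mul1r.
  rewrite (nneseries_split 0 k.+1)//; last by move=> j _; rewrite lee_fin big_ord0 mulr_ge0.
  rewrite add0n (@big_cat_nat _ _ _ k 0 k.+1)//=.
  rewrite (@le_trans _ _ (\sum_(k <= i < k.+1) ((P i)%:R * \prod_(i0 < 0) Num.max 0 (B i i0 - A i i0))%:E)%E)//.
  rewrite -addeA addeCA leeDl// adde_ge0//.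
    by apply: sume_ge0 => j _; rewrite lee_fin big_ord0 mulr_ge0.
  by apply: nneseries_ge0 => j _ _; rewrite lee_fin big_ord0 mulr_ge0.
have prod_ge0 (u v : nat -> R) : 0 <= \prod_(i < N) Num.max 0 (v i - u i).
  by apply: prodr_ge0 => i _; rewrite le_max lexx.
rewrite big_ord_recr/= -integral_itv_indic//.
under eq_eseriesr => k _.
  rewrite big_ord_recr/= mulrA -integral_itv_indic ?mulr_ge0//.
  over.
rewrite -integral_nneseries//; last 2 first.
- by move=> k; apply/measurable_EFinP; apply: measurable_funM => //; exact: measurable_indic.
- by move=> k t _; rewrite lee_fin !mulr_ge0.
apply: ge0_le_integral => //.
- by move=> t _; rewrite lee_fin mulr_ge0.
- by apply/measurable_EFinP; apply: measurable_funM => //; exact: measurable_indic.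
- apply: ge0_emeasurable_sum => //.
  + by move=> k t _ _; rewrite lee_fin !mulr_ge0.
  + by move=> k _; apply/measurable_EFinP; apply: measurable_funM => //; exact: measurable_indic.
move=> t _; rewrite indicE; case: (boolP (t \in _)); last first.
  move=> _; rewrite mulr0; apply: nneseries_ge0 => k _ _.
  by rewrite lee_fin !mulr_ge0.
rewrite inE/= in_itv/= => abt; rewrite mulr1.
(* The slice at height [t] is covered by those selected boxes whose last edge contains [t]; the
   induction hypothesis is used for this narrower predicate. *)
have {}/IH IH : forall x : nat -> R, (forall i, (i < N)%N -> a i < x i <= b i) ->
     exists2 k, P k && (A k N < t <= B k N) & forall i, (i < N)%N -> A k i < x i <= B k i.
  move=> x hx; have [i|k Pk hk] := cov (fun i => if i == N then t else x i).
    rewrite ltnS leq_eqVlt => /orP[/eqP ->|iN]; first by rewrite eqxx.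
    by rewrite (ltn_eqF iN); exact: hx.
  exists k; first by rewrite Pk; have := hk N (ltnSn N); rewrite eqxx.
  by move=> i iN; have := hk i (ltnW iN); rewrite (ltn_eqF iN).
apply: (le_trans IH); apply: lee_nneseries => k _.
  by rewrite lee_fin mulr_ge0.
rewrite lee_fin indicE; have -> : (t \in `]A k N, B k N]%classic) = (A k N < t <= B k N).
  by apply/idP/idP; rewrite inE/= in_itv.
by case: (P k); case: (_ < t <= _); rewrite ?mul0r ?mul1r ?mulr1 ?mulr0.
Qed.
Section outer_maps.
Context {R : realType} {n : nat}.
Local Notation V := 'rV[R]_n.+1.
Local Notation mu := (lebesgue_outer R n).
Implicit Types (a b x y : V) (i j : 'I_n.+1).

Lemma outer_box_ge a b : ((bvol a b)%:E <= mu (box (a, b)))%E.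
Proof.
apply: le_ereal_inf_tmp => _ [F abF <-].
pose f (v : V) (i : nat) := v ord0 (inord i).
have volE (u v : V) : bvol u v = \prod_(i < n.+1) Num.max 0 (f v i - f u i).
  by apply: eq_bigr => i _; rewrite /f !inord_val.
rewrite volE.
apply: (le_trans (@cover_volume _ _ _ _ (fun k => f (F k).1) (fun k => f (F k).2) xpredT _)).
  move=> x hx; have [|k _ hk] := abF (\row_i x i).
    move=> i /=; rewrite mxE.
    by have := hx i (ltn_ord i); rewrite /f !inord_val.
  exists k => // i iN; have := hk (Ordinal iN); rewrite mxE /=.
  by rewrite /f (_ : inord i = Ordinal iN)//; apply/val_inj; rewrite /= inordK.
apply: lee_nneseries => k _; first by rewrite mul1r -volE lee_fin bvol_ge0.
by rewrite mul1r -volE.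
Qed.

Lemma outer_box a b : mu (box (a, b)) = (bvol a b)%:E.
Proof. by apply/eqP; rewrite eq_le outer_box_le outer_box_ge. Qed.

Lemma box_empty a b i : b ord0 i <= a ord0 i -> box (a, b) = set0.
Proof.
move=> ba; rewrite -subset0 => x /= /(_ i) /andP[ax xb].
by have := lt_le_trans ax (le_trans xb ba); rewrite ltxx.
Qed.

Lemma bvolE a b : (forall i, a ord0 i < b ord0 i) ->
  bvol a b = \prod_i (b ord0 i - a ord0 i).
Proof. by move=> ab; apply: eq_bigr => i _; rewrite max_r// subr_ge0 ltW. Qed.

(** The images of the boxes of a cover of E cover the image of E, so countable subadditivity reduces
    the bound to single boxes; a box with a degenerate edge is empty. *)
Lemma outer_image_le (f : V -> V) (C : R) : 0 < C ->
  (forall a b, (forall i, a ord0 i < b ord0 i) ->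
     (mu (f @` box (a, b)) <= (C * bvol a b)%:E)%E) ->
  forall E, (mu (f @` E) <= C%:E * mu E)%E.
Proof.
move=> C0 fbox E; rewrite -lee_pdivrMl//.
apply: le_ereal_inf_tmp => _ [F EF <-]; rewrite lee_pdivrMl//.
apply: (@le_trans _ _ (\sum_(k <oo) mu (f @` box (F k)))%E).
  apply: (le_trans _ (outer_measure_sigma_subadditive _ _)).
  apply: le_outer_measure => _ [x Ex <-].
  by have [k _ kx] := EF x Ex; exists k => //; exists x.
rewrite -nneseriesZl//; last by move=> k _; exact: box_volume_ge0.
apply: lee_nneseries => k _; first by move=> _; exact: lebesgue_outer_ge0.
case: (F k) => a b; have [ab|] := pselect (forall i, a ord0 i < b ord0 i).
  by rewrite -EFinM; exact: fbox.
move/existsNP => [i /negP]; rewrite -leNgt => ba.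
rewrite (box_empty ba) image_set0 outer_measure0.
by apply: mule_ge0; [rewrite lee_fin ltW|exact: box_volume_ge0].
Qed.

Lemma updateE a i c j : (update a i c) ord0 j = if j == i then c else a ord0 j.
Proof. by rewrite mxE. Qed.

(* Only the edges in [J] are halved, until their length is at most [d]; unless
   short from the start, they stay longer than [d / 2]. *)
Lemma bisect_ind (J : pred 'I_n.+1) (d : R) (P : V -> V -> Prop) (a0 b0 : V) :
  0 < d ->
  (forall a b i, a ord0 i < b ord0 i ->
    P a (update b i ((a ord0 i + b ord0 i) / 2)) ->
    P (update a i ((a ord0 i + b ord0 i) / 2)) b -> P a b) ->
  (forall i, a0 ord0 i < b0 ord0 i) ->
  (forall a b,
    (forall i, [/\ a0 ord0 i <= a ord0 i, a ord0 i < b ord0 i & b ord0 i <= b0 ord0 i]) ->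
    (forall i, ~~ J i -> a ord0 i = a0 ord0 i /\ b ord0 i = b0 ord0 i) ->
    (forall i, J i -> b ord0 i - a ord0 i <= d /\
      (d < 2 * (b0 ord0 i - a0 ord0 i) -> d < 2 * (b ord0 i - a ord0 i))) ->
    P a b) ->
  P a0 b0.
Proof.
move=> d0 Pbis ab0 Psmall.
(* [K i] bounds the number of halvings that edge [i] may still need; the induction is on the sum of
   these numbers. *)
suff H m (K : 'I_n.+1 -> nat) a b : (\sum_i K i)%N = m ->
    (forall i, [/\ a0 ord0 i <= a ord0 i, a ord0 i < b ord0 i & b ord0 i <= b0 ord0 i]) ->
    (forall i, ~~ J i -> a ord0 i = a0 ord0 i /\ b ord0 i = b0 ord0 i) ->
    (forall i, J i ->
      d < 2 * (b0 ord0 i - a0 ord0 i) -> d < 2 * (b ord0 i - a ord0 i)) ->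
    (forall i, J i -> b ord0 i - a ord0 i <= 2 ^+ K i * d) ->
    P a b.
  have /choice[K hK] : forall i, exists k : nat, b0 ord0 i - a0 ord0 i <= 2 ^+ k * d.
    move=> i; exists (Num.bound ((b0 ord0 i - a0 ord0 i) / d)).
    rewrite -ler_pdivrMr//; apply: ltW; apply: (@lt_trans _ _ (Num.bound ((b0 ord0 i - a0 ord0 i) / d))%:R).
      by apply: archi_boundP; rewrite divr_ge0 ?ltW// subr_gt0.
    by rewrite -natrX ltr_nat ltn_expl.
  by apply: (H _ K a0 b0 erefl) => // i; rewrite lexx ab0.
elim: m K a b => [|m IH] K a b sK h1 h2 h3 h4.
  apply: Psmall => // i Ji; split; last exact: h3.
  have := h4 i Ji; have /eqP : (\sum_i K i)%N = 0%N by [].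
  by rewrite sum_nat_eq0 => /forallP/(_ i)/implyP/(_ isT)/eqP ->; rewrite mul1r.
have [/existsP[i /andP[Ji di]]|] := boolP [exists i, J i && (d < b ord0 i - a ord0 i)]; last first.
  rewrite negb_exists => /forallP small; apply: Psmall => // i Ji; split; last exact: h3.
  by have := small i; rewrite Ji/= -leNgt.
have [a0i abi b0i] := h1 i.
have Ki : (0 < K i)%N.
  by rewrite lt0n; apply/negP => /eqP Ki; have := h4 i Ji; rewrite Ki mul1r leNgt di.
pose K' j := if j == i then (K j).-1 else K j.
have sK' : (\sum_j K' j)%N = m.
  have E1 : (\sum_j K j = K i + \sum_(j | j != i) K j)%N by rewrite (bigD1 i).
  have -> : (\sum_j K' j = (K i).-1 + \sum_(j | j != i) K j)%N.
    rewrite (bigD1 i)//= /K' eqxx; congr addn.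
    by apply: eq_bigr => j /negbTE ->.
  by move: sK; rewrite E1; case: (K i) Ki => // k _ [].
have half : b ord0 i - a ord0 i <= 2 * (2 ^+ K' i * d).
  rewrite /K' eqxx mulrA -exprS prednK//; exact: h4.
apply: (Pbis _ _ i) => //; apply: (IH K') => //.
- move=> j; rewrite updateE; case: eqP => [->|_]; last exact: h1.
  by split; lra.
- move=> j Jj; rewrite updateE; case: eqP => [ji|_]; last exact: h2.
  by move: Jj; rewrite ji Ji.
- move=> j Jj; rewrite updateE; case: eqP => [->|_]; last exact: h3.
  lra.
- move=> j Jj; rewrite updateE /K'; case: eqP => [ji|/eqP ji]; last exact: h4.
  by move: half; rewrite ji /K' eqxx; lra.
- move=> j; rewrite updateE; case: eqP => [->|_]; last exact: h1.
  by split; lra.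
- move=> j Jj; rewrite updateE; case: eqP => [ji|_]; last exact: h2.
  by move: Jj; rewrite ji Ji.
- move=> j Jj; rewrite updateE; case: eqP => [->|_]; last exact: h3.
  lra.
- move=> j Jj; rewrite updateE /K'; case: eqP => [ji|/eqP ji]; last exact: h4.
  by move: half; rewrite ji /K' eqxx; lra.
Qed.

(** Volume is additive and outer measure subadditive under bisection, so a bound with the same
    constant on the small pieces passes to the whole box. *)
Lemma outer_image_bisect (f : V -> V) (C : R) (J : pred 'I_n.+1) (d : R) a0 b0 :
  0 < d -> (forall i, a0 ord0 i < b0 ord0 i) ->
  (forall a b,
    (forall i, [/\ a0 ord0 i <= a ord0 i, a ord0 i < b ord0 i & b ord0 i <= b0 ord0 i]) ->
    (forall i, ~~ J i -> a ord0 i = a0 ord0 i /\ b ord0 i = b0 ord0 i) ->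
    (forall i, J i -> b ord0 i - a ord0 i <= d /\
      (d < 2 * (b0 ord0 i - a0 ord0 i) -> d < 2 * (b ord0 i - a ord0 i))) ->
    (mu (f @` box (a, b)) <= (C * bvol a b)%:E)%E) ->
  (mu (f @` box (a0, b0)) <= (C * bvol a0 b0)%:E)%E.
Proof.
move=> d0 ab0 small.
apply: (@bisect_ind J d (fun a b => mu (f @` box (a, b)) <= (C * bvol a b)%:E)%E) => //.
move=> a b i ab; set m := _ / 2.
have [am mb] : a ord0 i < m /\ m < b ord0 i by rewrite /m; split; lra.
rewrite [in X in _ -> _ -> X](box_split a b i m) [in X in _ -> _ -> X](bvol_split a b i m).
rewrite (min_r (ltW mb)) (max_r (ltW am)) image_setU => h1 h2.
apply: (le_trans (outer_measureU2 _ _ _)).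
by rewrite mulrDr EFinD; exact: leeD.
Qed.

End outer_maps.

(** * Lipschitz and diagonal maps *)

Section lipschitz_and_shears.
Context {R : realType} {n : nat}.
Local Notation V := 'rV[R]_n.+1.
Local Notation mu := (lebesgue_outer R n).
Implicit Types (a b x y : V) (i j : 'I_n.+1).

Lemma rV_norm_le x (e : R) : 0 <= e ->
  (`|x| <= e) <-> (forall i, `|x ord0 i| <= e).
Proof.
move=> e0; rewrite [leLHS]/Num.norm/= mx_normrE; split.
  by move=> /bigmax_leP[_ h] i; exact: (h (ord0, i)).
move=> h; apply/bigmax_leP; split => // -[k i] _ /=.
by rewrite ord1.
Qed.

Lemma rV_coord_le x i : `|x ord0 i| <= `|x|.
Proof. exact: (rV_norm_le x (normr_ge0 x)).1. Qed.

Lemma mem_box_center x y (e : R) : 0 < e -> `|y - x| < e ->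
  box (x - const_mx e, x + const_mx e) y.
Proof.
move=> e0 yx i /=; rewrite !mxE.
have := le_lt_trans (rV_coord_le (y - x) i) yx; rewrite !mxE ltr_norml => /andP[? ?].
by apply/andP; split; lra.
Qed.

Lemma bvol_center x (e : R) : 0 < e ->
  bvol (x - const_mx e) (x + const_mx e) = (2 * e) ^+ n.+1.
Proof.
move=> e0; rewrite bvolE; last by move=> i; rewrite !mxE; lra.
rewrite -[in RHS](card_ord n.+1) -prodr_const; apply: eq_bigr => i _.
by rewrite !mxE; lra.
Qed.

Lemma outer_image_lipschitz (f : V -> V) (M : R) : 0 < M ->
  (forall x y, `|f x - f y| <= M * `|x - y|) ->
  exists2 C : R, 0 < C & forall E, (mu (f @` E) <= C%:E * mu E)%E.
Proof.
(* With [d] the shortest edge, pieces have all edges in (d/2, d]. The image of a piece lies in a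
   cube of half-side 2 M d, twice the Lipschitz bound so as to be strict, and its side 4 M d is less
   than 8 M times each edge. *)
move=> M0 fM; exists ((8 * M) ^+ n.+1); first by rewrite exprn_gt0 ?mulr_gt0.
apply: outer_image_le; first by rewrite exprn_gt0 ?mulr_gt0.
move=> a0 b0 ab0.
have [i0 _ i0min] := @Order.TotalTheory.arg_minP _ R _ ord0 xpredT (fun i => b0 ord0 i - a0 ord0 i) isT.
set d := b0 ord0 i0 - a0 ord0 i0.
have d0 : 0 < d by rewrite subr_gt0.
apply: (@outer_image_bisect _ _ _ _ xpredT d) => // a b h1 _ h2.
have dba i : b ord0 i - a ord0 i <= d by have [] := h2 i isT.
have dba2 i : d < 2 * (b ord0 i - a ord0 i).
  have [_ +] := h2 i isT; apply.
  by have := i0min i isT; rewrite -/d => h; lra.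
have Md0 : 0 < 2 * M * d by rewrite !mulr_gt0.
apply: (@le_trans _ _ (mu (box (f b - const_mx (2 * M * d), f b + const_mx (2 * M * d))))).
  apply: le_outer_measure => _ [x abx <-]; apply: mem_box_center => //.
  apply: (le_lt_trans (fM _ _)).
  rewrite (_ : 2 * M * d = M * (2 * d)) ?ltr_pM2l//; last by ring.
  suff : `|x - b| <= d by lra.
  apply/rV_norm_le; first exact: ltW.
  move=> i; rewrite !mxE ler_norml; have /andP[/= h3 h4] := abx i.
  by have := dba i; move=> h5; apply/andP; split; lra.
rewrite outer_box lee_fin bvol_center// bvolE; last by move=> i; have [] := h1 i.
rewrite -[X in (2 * _) ^+ X](card_ord n.+1) -[X in (8 * M) ^+ X](card_ord n.+1) -!prodr_const -big_split/=.
apply: ler_prod => i _; apply/andP; split; first by rewrite mulr_ge0 ?ltW.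
have -> : 2 * (2 * M * d) = 4 * M * d by lra.
have -> : 8 * M * (b ord0 i - a ord0 i) = 4 * M * (2 * (b ord0 i - a ord0 i)) by lra.
by rewrite ler_pM2l ?mulr_gt0// ltW.
Qed.

Definition scale_coord (c : 'I_n.+1 -> R) x : V := \row_i (c i * x ord0 i).

Lemma outer_image_scale (c : 'I_n.+1 -> R) : (forall i, 0 < c i) ->
  forall E, (mu (scale_coord c @` E) <= (\prod_i c i)%R%:E * mu E)%E.
Proof.
move=> c0; apply: outer_image_le; first exact: prodr_gt0.
move=> a b ab.
apply: (@le_trans _ _ (mu (box (scale_coord c a, scale_coord c b)))).
  apply: le_outer_measure => _ [x abx <-] i /=; rewrite !mxE.
  by rewrite ltr_pM2l// ler_pM2l//; exact: abx.
rewrite outer_box lee_fin !bvolE//; last by move=> i; rewrite !mxE ltr_pM2l.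
rewrite -big_split/=; apply: ler_prod => i _; rewrite !mxE -mulrBr lexx andbT.
by rewrite mulr_ge0 ?subr_ge0 ?ltW.
Qed.

Lemma compact_unif_continuous (K : set V) (f : V -> V) (e : R) :
  compact K -> continuous f -> 0 < e ->
  exists2 d, 0 < d & forall x y, K x -> `|y - x| <= d -> `|f y - f x| <= e.
Proof.
move=> /compact_near_coveringP cK cf e0.
have H : \forall d \near 0^'+, K `<=` (fun x => forall y, `|y - x| <= d -> `|f y - f x| <= e).
  apply: cK => x Kx.
  have e2 : 0 < e / 2 by rewrite divr_gt0.
  have /cvgr_dist_le/(_ _ e2)/nbhs_normP[r /= r0 hr] := cf x.
  have r2 : 0 < r / 2 by rewrite divr_gt0.
  exists ([set y : V | `|(x : V) - y| < r / 2], [set d | 0 < d < r / 2]).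
    split => /=; first by apply/(@nbhs_normP _ V); exists (r / 2).
    near=> d; apply/andP; split; near: d; [exact: nbhs_right_gt|exact: nbhs_right_lt].
  move=> [x' d] [/= xx' /andP[d0 dr]] y yx'.
  have h1 : `|f x - f x'| <= e / 2 by apply: hr => /=; lra.
  have h2 : `|f x - f y| <= e / 2.
    apply: hr => /=; rewrite (_ : x - y = (x - x') - (y - x')); last by rewrite opprB addrA subrK.
    by apply: (le_lt_trans (ler_normB _ _)); lra.
  rewrite -(subrKA (f x)); apply: (le_trans (ler_normD _ _)).
  by rewrite distrC; lra.
have [d [d0 Kd]] : exists d, 0 < d /\ K `<=` (fun x => forall y, `|y - x| <= d -> `|f y - f x| <= e).
  near (0 : R)^'+ => d; exists d; split; first by near: d; exact: nbhs_right_gt.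
  by near: d.
by exists d => // x y Kx; exact: Kd.
Unshelve. all: by end_near. Qed.

(** Used to choose a relative error per edge from one for the volume. In the induction, with A = 3^N
    >= 1 and t <= 1, one has t + A t + A t^2 <= 3 A t. *)
Lemma expr1D_le (N : nat) (t : R) : 0 <= t -> t <= 1 -> (1 + t) ^+ N <= 1 + 3 ^+ N * t.
Proof.
move=> t0 t1; elim: N => [|N IH]; first by rewrite !expr0; lra.
rewrite !exprS; apply: (@le_trans _ _ ((1 + t) * (1 + 3 ^+ N * t))).
  by rewrite ler_pM2l//; lra.
have : 1 <= 3 ^+ N :> R by rewrite exprn_ege1//; lra.
move: (3 ^+ N) => A A1; have : 0 <= A * t * (1 - t) by rewrite !mulr_ge0//; lra.
have : t <= A * t by rewrite ler_peMl.
lra.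
Qed.

End lipschitz_and_shears.

(** * Triangular maps do not increase outer measure *)

Section triangular_maps.
Context {R : realType} {n : nat}.
Local Notation V := 'rV[R]_n.+1.
Local Notation mu := (lebesgue_outer R n).
Variables (w : 'I_n.+1 -> nat) (phi : V -> V).
Hypothesis phi_cts : continuous phi.
Hypothesis phi_dep : forall i (x y : V),
  (forall j, (w j < w i)%N -> x ord0 j = y ord0 j) -> phi x ord0 i = phi y ord0 i.

Definition shear (k : nat) (x : V) : V :=
  \row_i (x ord0 i + (if w i == k then phi x ord0 i else 0)).

Lemma compact_closed_box (a b : V) :
  compact [set x : V | forall i, a ord0 i <= x ord0 i <= b ord0 i].
Proof.
rewrite (_ : [set _ | _] = [set x : V | forall i, `[a ord0 i, b ord0 i]%classic (x ord0 i)]).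
  by apply: (@rV_compact _ _ (fun i => `[a ord0 i, b ord0 i]%classic)) => i; exact: segment_compact.
by apply/seteqP; split => x /= h i; have := h i; rewrite in_itv.
Qed.

(* The shift of the coordinates of weight k depends on those of smaller weight
   only: halving the edges of these makes it nearly constant on each piece, while
   the edges of weight k, hence the admissible errors, keep their length. *)
Lemma outer_shear_box (k : nat) (a0 b0 : V) (e : R) : 0 < e ->
  (forall i, a0 ord0 i < b0 ord0 i) ->
  (mu (shear k @` box (a0, b0)) <= ((1 + e) * bvol a0 b0)%:E)%E.
Proof.
move=> e0 ab0.
have [t [t0 te]] : exists t : R, 0 < t /\ (1 + t) ^+ n.+1 <= 1 + e.
  have p3 : 0 < 3 ^+ n.+1 :> R by rewrite exprn_gt0.
  exists (Num.min 1 (e / 3 ^+ n.+1)); split.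
    by rewrite lt_min ltr01 divr_gt0.
  apply: le_trans (expr1D_le _ _ _) _.
  - by rewrite le_min ler01 divr_ge0// ltW.
  - by rewrite ge_min lexx.
  rewrite lerD2l mulrC -ler_pdivlMr//.
  by rewrite ge_min lexx orbT.
(* The edges of weight [k] are not halved, so each is at least as long as the shortest original edge
   [l]; moving both of its ends by t l / 2 lengthens it by a factor at most 1 + t. *)
have [i0 _ i0min] := @Order.TotalTheory.arg_minP _ R _ ord0 xpredT (fun i => b0 ord0 i - a0 ord0 i) isT.
set l := b0 ord0 i0 - a0 ord0 i0.
have l0 : 0 < l by rewrite subr_gt0.
have tl : 0 < t * l / 2 by rewrite divr_gt0// mulr_gt0.
have [d d0 dP] := compact_unif_continuous (@compact_closed_box a0 b0) phi_cts tl.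
apply: (@outer_image_bisect _ _ _ _ (fun i => (w i < k)%N) d) => // a b h1 h2 h3.
have Kb : forall i, a0 ord0 i <= b ord0 i <= b0 ord0 i.
  by move=> i; have [? ? ->] := h1 i; rewrite andbT; lra.
pose s i (u : R) : R := if w i == k then u else 0.
apply: (@le_trans _ _ (mu (box
    (\row_i (a ord0 i + s i (phi b ord0 i - t * l / 2)),
     \row_i (b ord0 i + s i (phi b ord0 i + t * l / 2)))%R))).
  apply: le_outer_measure => _ [x abx <-] i /=.
  have /andP[/= ax xb] := abx i; rewrite /shear !mxE /s.
  case: eqP => wi; last by rewrite !addr0 ax xb.
  (* [y] keeps the coordinates of [x] of weight below [k], so [phi] has the same coordinate [i] at
     both; and it differs from [b] only along halved edges, hence by at most [d]. *)
  pose y : V := \row_j (if (w j < k)%N then x ord0 j else b ord0 j).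
  have -> : phi x ord0 i = phi y ord0 i.
    by apply: phi_dep => j; rewrite wi mxE => ->.
  have : `|phi y - phi b| <= t * l / 2.
    apply: dP => //; apply/rV_norm_le; first exact: ltW.
    move=> j; rewrite !mxE; case: ifPn => wj; last by rewrite subrr normr0 ltW.
    have [h4 _] := h3 j wj; have /andP[/= ? ?] := abx j.
    by rewrite ler_norml; apply/andP; split; lra.
  move=> /(le_trans (rV_coord_le _ i)); rewrite !mxE ler_norml => /andP[? ?].
  by apply/andP; split; lra.
rewrite outer_box lee_fin; have ab i : a ord0 i < b ord0 i by have [] := h1 i.
apply: (@le_trans _ _ ((1 + t) ^+ n.+1 * bvol a b)); last first.
  by rewrite ler_wpM2r ?bvol_ge0.
rewrite !bvolE//; last first.
  by move=> i; have := ab i; rewrite !mxE /s; case: eqP => _; lra.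
rewrite -[X in (_ + _) ^+ X](card_ord n.+1) -prodr_const -big_split/=.
apply: ler_prod => i _; have := ab i; rewrite !mxE /s; case: eqP => wi abi; last first.
  have : 0 <= t * (b ord0 i - a ord0 i) by rewrite mulr_ge0; lra.
  by move=> ?; apply/andP; split; lra.
have [|ai bi] := h2 i; first by rewrite wi ltnn.
have : t * l <= t * (b ord0 i - a ord0 i).
  by rewrite ler_pM2l// ai bi; exact: i0min.
by have := mulr_gt0 t0 l0; move=> ? ?; apply/andP; split; lra.
Qed.

Lemma outer_image_shear (k : nat) (E : set V) : (mu (shear k @` E) <= mu E)%E.
Proof.
rewrite -[leRHS]mul1e; apply: outer_image_le => // a b ab; rewrite mul1r.
apply/lee_addgt0Pr => e e0.
have B0 := bvol_ge0 a b; have B1 : 0 < bvol a b + 1 by lra.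
apply: (le_trans (@outer_shear_box k a b (e / (bvol a b + 1)) (divr_gt0 e0 B1) ab)).
rewrite -EFinD lee_fin mulrDl mul1r lerD2l -mulrA ler_piMr ?(ltW e0)//.
by rewrite mulrC ler_pdivrMr// mul1r; lra.
Qed.

(** Factor the map into shears, one weight at a time: if T_k shifts the coordinates of weight at
    least [k], then T_k is [shear k] after T_(k+1), because the shift in weight [k] reads only
    coordinates that T_(k+1) leaves alone. Beyond the sum of all weights T_k is the identity. *)
Lemma outer_image_triangular (E : set V) : (mu ((fun x => x + phi x)%R @` E) <= mu E)%E.
Proof.
pose T k (x : V) : V := \row_i (x ord0 i + (if (k <= w i)%N then phi x ord0 i else 0)).
have TS k x : T k x = shear k (T k.+1 x).
  apply/rowP => i; rewrite !mxE; case: (ltngtP k (w i)) => kw //=.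
  - by rewrite ?addr0.
  - by rewrite !addr0.
  rewrite addr0; congr (_ + _); apply: phi_dep => j wj.
  by rewrite mxE kw ltnNge (ltnW wj)/= addr0.
have H k j : (mu (T k @` E) <= mu (T (k + j)%N @` E))%E.
  elim: j k => [|j IH] k; first by rewrite addn0.
  rewrite addnS -addSn; apply: le_trans (IH k.+1).
  apply: (le_trans _ (outer_image_shear k _)); apply: le_outer_measure.
  by move=> _ [x Ex <-]; exists (T k.+1 x); [exists x|exact/esym/TS].
apply: (@le_trans _ _ (mu (T 0%N @` E))).
  apply: le_outer_measure => _ [x Ex <-]; exists x => //.
  by apply/rowP => i; rewrite !mxE.
apply: (le_trans (H 0%N (\sum_i w i).+1)); apply: le_outer_measure => _ [x Ex <-].
suff -> : T (0 + (\sum_i w i).+1)%N x = x by [].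
apply/rowP => i; rewrite !mxE leqNgt add0n ltnS (bigD1 i)//= leq_addr /=.
by rewrite addr0.
Qed.

End triangular_maps.

(** * The group law in coordinates adapted to the layers *)

Section graded_algebra.
Context {R : realType} {n : nat} (G : stratified_group R n).
Local Notation V := 'rV[R]_n.+1.
Local Notation br := (sg_bracket G).
Local Notation m := (sg_step G).
Implicit Types (x y z u v : V).

Lemma bracketDl x y z : br (x + y) z = br x z + br y z.
Proof. by have := sg_bracket_linearl G z 1 x y; rewrite !scale1r. Qed.

Lemma bracketDr x y z : br x (y + z) = br x y + br x z.
Proof. by have := sg_bracket_linearr G x 1 y z; rewrite !scale1r. Qed.

Lemma bracket0l x : br 0 x = 0.
Proof. by apply: (addrI (br 0 x)); rewrite -bracketDl !addr0. Qed.

Lemma bracket0r x : br x 0 = 0.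
Proof. by apply: (addrI (br x 0)); rewrite -bracketDr !addr0. Qed.

Lemma bracketZl c x y : br (c *: x) y = c *: br x y.
Proof. by have := sg_bracket_linearl G y c x 0; rewrite !addr0 bracket0l addr0. Qed.

Lemma bracketZr c x y : br x (c *: y) = c *: br x y.
Proof. by have := sg_bracket_linearr G x c y 0; rewrite !addr0 bracket0r addr0. Qed.

Lemma bracket_suml I (r : seq I) (P : pred I) (F : I -> V) y :
  br (\sum_(i <- r | P i) F i) y = \sum_(i <- r | P i) br (F i) y.
Proof. exact: (big_morph (br^~ y) (fun a b => bracketDl a b y) (bracket0l y)). Qed.

Lemma bracket_sumr I (r : seq I) (P : pred I) (F : I -> V) x :
  br x (\sum_(i <- r | P i) F i) = \sum_(i <- r | P i) br x (F i).
Proof. exact: (big_morph (br x) (bracketDr x) (bracket0r x)). Qed.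

Lemma bracketNl x y : br (- x) y = - br x y.
Proof. by rewrite -scaleN1r bracketZl scaleN1r. Qed.

Lemma bracketNr x y : br x (- y) = - br x y.
Proof. by rewrite -scaleN1r bracketZr scaleN1r. Qed.

Lemma bracketC x y : br x y = - br y x.
Proof.
apply/eqP; rewrite -addr_eq0; apply/eqP.
have := sg_bracketxx G (x + y).
by rewrite bracketDl !bracketDr !sg_bracketxx add0r addr0.
Qed.

Lemma bracket_bracketl u v y : br (br u v) y = br u (br v y) - br v (br u y).
Proof.
have := sg_jacobi G u v y; rewrite (bracketC y (br u v)) (bracketC y u) bracketNr.
by move/eqP; rewrite subr_eq0 => /eqP <-.
Qed.

Lemma memv_bracketv (U W : {vspace V}) u w : u \in U -> w \in W ->
  br u w \in bracketv br U W.
Proof.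
move=> uU wW; rewrite (coord_vbasis uU) (coord_vbasis wW) bracket_suml.
apply: rpred_sum => i _; rewrite bracketZl bracket_sumr; apply: rpredZ.
apply: rpred_sum => j _; rewrite bracketZr; apply: rpredZ; apply: memv_span.
by apply/allpairsP; exists ((vbasis U)`_i, (vbasis W)`_j); split => //=;
  rewrite mem_nth// size_tuple.
Qed.

(** [sg_layer] is arbitrary outside 1, ..., m; replacing those values by 0 makes [V_i, V_j] lie in
    V_(i+j) for all positive i and j. *)
Definition layer (k : nat) : {vspace V} :=
  if (1 <= k <= m)%N then sg_layer G k else 0%VS.

Lemma layer_bracket1 j x y : (0 < j)%N ->
  x \in layer 1 -> y \in layer j -> br x y \in layer j.+1.
Proof.
rewrite /layer => j0; rewrite j0/=.
case: ifPn => [m1|_]; last by rewrite memv0 => /eqP -> _; rewrite bracket0l mem0v.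
case: ifPn => [jm|_]; last by rewrite memv0 => _ /eqP ->; rewrite bracket0r mem0v.
move=> /memv_bracketv/[apply]; case: (ltngtP j m) jm => // jm _ h.
  by rewrite -sg_layerS// j0.
by move: h; rewrite jm sg_layer_step.
Qed.

(** Induction on [i]: V_(i+1) is spanned by brackets [u, w] with u in V_1 and w in V_i, and the
    Jacobi identity gives [[u, w], y] = [u, [w, y]] - [w, [u, y]]. *)
Lemma layer_bracket i j x y : (0 < i)%N -> (0 < j)%N ->
  x \in layer i -> y \in layer j -> br x y \in layer (i + j).
Proof.
elim: i j x y => // -[_ j x y _ j0|i IH j x y _ j0]; first exact: layer_bracket1.
rewrite [in X in X -> _]/layer /=; case: ifPn => im; last first.
  by rewrite memv0 => /eqP -> _; rewrite bracket0l mem0v.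
rewrite -sg_layerS// => xL yL.
have : x \in <<in_tuple [seq br u w | u <- vbasis (sg_layer G 1), w <- vbasis (sg_layer G i.+1)]>>%VS by [].
move=> /coord_span ->; rewrite bracket_suml; apply: rpred_sum => k _.
rewrite bracketZl; apply: rpredZ.
have /allpairsP[[u w] [/= /vbasis_mem uL /vbasis_mem wL ->]] := mem_nth 0 (ltn_ord k).
have m1 : (1 <= m)%N by exact: leq_trans im.
have u1 : u \in layer 1 by rewrite /layer m1.
have wi : w \in layer i.+1 by rewrite /layer /= ltnW.
rewrite bracket_bracketl; apply: rpredB.
  by rewrite addSn; apply: layer_bracket1 => //; exact: IH.
rewrite addSnnS; apply: IH => //; exact: layer_bracket1.
Qed.

Local Notation U := (\sum_(j < m) sg_layer G j.+1)%VS.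
Definition lproj (i : 'I_m) x : V := sumv_pi U i x.

Lemma lproj_mem i x : lproj i x \in layer i.+1.
Proof. by rewrite /layer /= ltn_ord; exact: memv_sum_pi. Qed.

Lemma lproj_sum x : \sum_i lproj i x = x.
Proof. by apply: sumv_pi_sum => //; rewrite sg_layer_full memvf. Qed.

Lemma lproj_layer (j i : 'I_m) x : x \in layer j.+1 ->
  lproj i x = if i == j then x else 0.
Proof.
move=> xj; have /directv_sum_unique := sg_layer_direct G.
move=> /(_ (fun i => lproj i x) (fun i => if i == j then x else 0)).
have hl k (_ : true) : lproj k x \in sg_layer G k.+1.
  by have := lproj_mem k x; rewrite /layer ltn_ord.
have hr k (_ : true) : (if k == j then x else 0) \in sg_layer G k.+1.
  case: eqP => [->|_]; last exact: mem0v.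
  by move: xj; rewrite /layer ltn_ord.
move=> /(_ hl hr); rewrite lproj_sum -big_mkcond big_pred1_eq eqxx.
by move=> /esym/forallP/(_ i)/implyP/(_ isT)/eqP.
Qed.

Lemma dilationE t x : dilation G t x = \sum_(i < m) t ^+ i.+1 *: lproj i x.
Proof. by []. Qed.

Arguments dilation : simpl never.
Lemma dilation_is_linear t : linear (dilation G t).
Proof.
move=> c x y; rewrite /dilation scaler_sumr -big_split/=; apply: eq_bigr => i _.
by rewrite linearD linearZ/= scalerDr !scalerA mulrC.
Qed.
HB.instance Definition _ t := GRing.isLinear.Build R V V *:%R (dilation G t)
  (dilation_is_linear t).

Lemma dilation_layer k t x : (0 < k)%N -> x \in layer k -> dilation G t x = t ^+ k *: x.
Proof.
case: k => // k _; case: (ltnP k m) => km; last first.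
  by rewrite /layer /= leqNgt ltnS km memv0 => /eqP ->; rewrite linear0 scaler0.
move=> xk; rewrite dilationE (bigD1 (Ordinal km))//= (lproj_layer _ (j := Ordinal km) xk) eqxx.
by rewrite big1 ?addr0// => i /negbTE ik; rewrite (lproj_layer _ (j := Ordinal km) xk) ik scaler0.
Qed.

Lemma dilation1 x : dilation G 1 x = x.
Proof. by rewrite dilationE; under eq_bigr do rewrite expr1n scale1r; exact: lproj_sum. Qed.

Lemma dilation0 x : dilation G 0 x = 0.
Proof. by rewrite dilationE big1// => i _; rewrite exprS mul0r scale0r. Qed.

Lemma dilationM s t x : dilation G s (dilation G t x) = dilation G (s * t) x.
Proof.
rewrite (dilationE t) linear_sum dilationE; apply: eq_bigr => i _.
by rewrite linearZ/= (dilation_layer _ _ (lproj_mem i x))// scalerA mulrC -exprMn.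
Qed.

Lemma dilation_bracket t x y : dilation G t (br x y) = br (dilation G t x) (dilation G t y).
Proof.
rewrite -{1}(lproj_sum x) -{1}(lproj_sum y) bracket_suml linear_sum (dilationE t x) bracket_suml.
apply: eq_bigr => i _; rewrite bracket_sumr linear_sum (dilationE t y) bracket_sumr.
apply: eq_bigr => j _; rewrite bracketZl bracketZr scalerA -exprD.
by apply: dilation_layer => //; exact: layer_bracket (lproj_mem _ _) (lproj_mem _ _).
Qed.

Lemma iterated_bracket_dilation t (s : seq V) :
  iterated_bracket br (map (dilation G t) s) = dilation G t (iterated_bracket br s).
Proof.
elim: s => [|x s IH] /=; first by rewrite linear0.
by case: s IH => // y s; rewrite /= => ->; rewrite dilation_bracket.
Qed.

(** The grading makes dilations automorphisms of the Lie algebra, and the product is a combination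
    of iterated brackets. *)
Lemma dilation_mul t x y :
  dilation G t (sg_mul G x y) = sg_mul G (dilation G t x) (dilation G t y).
Proof.
rewrite !sg_mulE /BCH linear_sum; apply: eq_bigr => k _; rewrite linearZ linear_sum/=.
congr (_ *: _); apply: eq_bigr => e _; rewrite linearZ/= -iterated_bracket_dilation.
congr (_ *: iterated_bracket br _); rewrite map_flatten -map_comp; congr flatten.
by apply: eq_map => i /=; rewrite map_cat !map_nseq.
Qed.

Lemma mulx0 x : sg_mul G x 0 = x.
Proof.
have hl y : sg_mul G (- y) y = 0 by exact: sg_mulNx.
have hr : sg_mul G x (- x) = 0 by have := hl (- x); rewrite opprK.
by rewrite -(hl x) sg_mulA hr sg_mul0x.
Qed.

Lemma mulxN x : sg_mul G x (- x) = 0.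
Proof. by have := sg_mulNx G (- x); rewrite opprK. Qed.

Lemma mulNK x y : sg_mul G (- x) (sg_mul G x y) = y.
Proof. by rewrite sg_mulA sg_mulNx sg_mul0x. Qed.

Lemma mulKN x y : sg_mul G x (sg_mul G (- x) y) = y.
Proof. by rewrite sg_mulA mulxN sg_mul0x. Qed.

Lemma mul_inv x y : - sg_mul G x y = sg_mul G (- y) (- x).
Proof.
rewrite -[LHS](mulx0) -(mulxN x) -(mulKN y (- x)) [X in sg_mul G _ X]sg_mulA sg_mulA.
by rewrite sg_mulNx sg_mul0x mulNK.
Qed.

End graded_algebra.

Section continuity_of_multilinear_maps.
Context {R : realType} {n : nat}.
Local Notation V := 'rV[R]_n.+1.

Lemma continuous_bigsum (T : topologicalType) (W : normedModType R) I (r : seq I)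
    (P : pred I) (F : I -> T -> W) : (forall i, continuous (F i)) ->
  continuous (fun t => \sum_(i <- r | P i) F i t).
Proof.
move=> cF; elim: r => [|i r IH].
  rewrite (_ : (fun t => _) = (fun=> 0)); last by apply/funext => t; rewrite big_nil.
  exact: cst_continuous.
rewrite (_ : (fun t => _) = (fun t => if P i then F i t + \sum_(j <- r | P j) F j t
    else \sum_(j <- r | P j) F j t)); last by apply/funext => t; rewrite big_cons.
case: (P i) => // t.
by apply: cvgD; [exact: cF|exact: IH].
Qed.

Lemma continuous_scale (T : topologicalType) (W : normedModType R) (s : T -> R)
  (f : T -> W) : continuous s -> continuous f -> continuous (fun t => s t *: f t).
Proof. by move=> cs cf t; apply: (cvgZ (cs t) (cf t)). Qed.

Lemma continuous_coord i : continuous (fun x : V => x ord0 i).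
Proof. exact: (@coord_continuous R 1 n.+1 ord0 i). Qed.

Lemma continuous_linear (W : normedModType R) (f : {linear V -> W}) : continuous f.
Proof.
rewrite (_ : (f : V -> W) = (fun x : V => \sum_i x ord0 i *: f (delta_mx 0 i))).
  apply: continuous_bigsum => i; apply: continuous_scale; first exact: continuous_coord.
  exact: cst_continuous.
apply/funext => x; rewrite {1}(row_sum_delta x) linear_sum; apply: eq_bigr => i _.
by rewrite linearZ.
Qed.

Lemma linear_lipschitz (f : {linear V -> V}) :
  exists2 M : R, 0 < M & forall x y, `|f x - f y| <= M * `|x - y|.
Proof.
exists (1 + \sum_i `|f (delta_mx 0 i)|); first by rewrite ltr_pwDl// sumr_ge0.
move=> x y; rewrite -linearB; move: (x - y) => {x y}z.
rewrite {1}(row_sum_delta z) linear_sum mulrDl mul1r mulr_suml.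
apply: ler_wpDl => //; apply: (le_trans (ler_norm_sum _ _ _)); apply: ler_sum => i _.
by rewrite linearZ/= normrZ mulrC ler_wpM2l// rV_coord_le.
Qed.

End continuity_of_multilinear_maps.

Section group_topology.
Context {R : realType} {n : nat} (G : stratified_group R n).
Local Notation V := 'rV[R]_n.+1.
Local Notation br := (sg_bracket G).

Lemma continuous_bracket (T : topologicalType) (f g : T -> V) :
  continuous f -> continuous g -> continuous (fun t => br (f t) (g t)).
Proof.
move=> cf cg.
rewrite (_ : (fun t => _) = (fun t => \sum_i \sum_j
    (f t ord0 i * g t ord0 j) *: br (delta_mx 0 i) (delta_mx 0 j))); last first.
  apply/funext => t; rewrite {1}(row_sum_delta (f t)) {1}(row_sum_delta (g t)).
  rewrite bracket_suml; apply: eq_bigr => i _; rewrite bracketZl bracket_sumr scaler_sumr.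
  by apply: eq_bigr => j _; rewrite bracketZr scalerA.
apply: continuous_bigsum => i; apply: continuous_bigsum => j.
apply: continuous_scale ; last exact: cst_continuous.
move=> t; apply: (@cvgM _ _ (nbhs t)).
  exact: (continuous_comp (cf t) (@continuous_coord R n i _)).
exact: (continuous_comp (cg t) (@continuous_coord R n j _)).
Qed.

(** The word of a term of the series with its letters abstracted, [true] for the left factor and
    [false] for the right one: induction on a fixed word can then vary the factors. *)
Definition BCH_word k m (e : {ffun 'I_k -> 'I_m.+1 * 'I_m.+1}) : seq bool :=
  flatten [seq nseq (e i).1 true ++ nseq (e i).2 false | i <- enum 'I_k].

Lemma BCH_wordE k m (e : {ffun 'I_k -> 'I_m.+1 * 'I_m.+1}) (x y : V) :
  flatten [seq nseq (e i).1 x ++ nseq (e i).2 y | i <- enum 'I_k] =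
  [seq if c then x else y | c <- BCH_word e].
Proof.
rewrite /BCH_word map_flatten -map_comp; congr flatten; apply: eq_map => i /=.
by rewrite map_cat !map_nseq.
Qed.

Lemma continuous_iterated_bracket (T : topologicalType) (f g : T -> V) (s : seq bool) :
  continuous f -> continuous g ->
  continuous (fun t => iterated_bracket br [seq if c then f t else g t | c <- s]).
Proof.
move=> cf cg; elim: s => [|c s IH] /=; first exact: cst_continuous.
have cc : continuous (fun t => if c then f t else g t) by case: c.
case: s IH => [//|d s IH].
by apply: continuous_bracket.
Qed.

Lemma continuous_mul (T : topologicalType) (f g : T -> V) :
  continuous f -> continuous g -> continuous (fun t => sg_mul G (f t) (g t)).
Proof.
move=> cf cg; rewrite (_ : (fun t => _) = (fun t => BCH br (sg_step G) (f t) (g t))); last first.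
  by apply/funext => t; rewrite sg_mulE.
apply: continuous_bigsum => k; apply: continuous_scale; first exact: cst_continuous.
apply: continuous_bigsum => e; apply: continuous_scale; first exact: cst_continuous.
under eq_fun do rewrite BCH_wordE.
exact: continuous_iterated_bracket.
Qed.

Lemma continuous_mull a : continuous (sg_mul G a).
Proof. by apply: continuous_mul; [exact: cst_continuous|move=> t; exact: cvg_id]. Qed.

Lemma continuous_dilation t : continuous (dilation G t).
Proof. exact: continuous_linear. Qed.

Lemma continuous_dilationl x : continuous (dilation G ^~ x).
Proof.
apply: continuous_bigsum => i; apply: continuous_scale ; last exact: cst_continuous.
move=> t; exact: exprn_continuous.
Qed.

End group_topology.

(** * Coordinates adapted to the layers *)

Section adapted_coordinates.
Context {R : realType} {n : nat} (G : stratified_group R n).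
Local Notation V := 'rV[R]_n.+1.
Local Notation br := (sg_bracket G).
Local Notation m := (sg_step G).
Implicit Types (x y a : V).

Lemma adapted_basis : exists (X : n.+1.-tuple V) (w : 'I_n.+1 -> nat),
  [/\ basis_of fullv X, forall i, (0 < w i)%N,
      forall i : 'I_n.+1, X`_i \in layer G (w i) & (\sum_i w i)%N = homogeneous_dim G].
Proof.
(* Each basis vector carries its weight, so that weights and vectors stay aligned when the bases of
   the layers are concatenated. *)
pose Zi (i : 'I_m) : seq (nat * V) := [seq (i.+1, x) | x <- vbasis (sg_layer G i.+1)].
pose Z := \big[cat/[::]]_(i < m) Zi i.
have XE : map snd Z = \big[cat/[::]]_(i < m) vbasis (sg_layer G i.+1).
  rewrite /Z (big_morph (map snd) (map_cat _) (erefl _)); apply: eq_bigr => i _.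
  by rewrite /Zi -map_comp map_id_in.
have Xb : basis_of fullv (map snd Z).
  rewrite XE -(sg_layer_full G); apply: bigcat_basis; first exact: sg_layer_direct.
  by move=> i _; exact: vbasisP.
have sZ : size (map snd Z) == n.+1.
  have /size_basis : basis_of fullv (in_tuple (map snd Z)) by [].
  by rewrite dimvf => <-; rewrite /dim/= mul1n.
have memZ z : z \in Z -> (0 < z.1)%N && (z.2 \in layer G z.1).
  have : all (fun z => (0 < z.1)%N && (z.2 \in layer G z.1)) Z.
    rewrite /Z; apply: (big_ind (fun s => all _ s)) => //.
      by move=> s t hs ht; rewrite all_cat hs.
    move=> i _; apply/allP => _ /mapP[x xi ->] /=.
    by rewrite /layer /= ltn_ord vbasis_mem.
  by move=> /allP; apply.
have sZ' : size Z = n.+1 by move: sZ; rewrite size_map => /eqP.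
exists (Tuple sZ), (fun i => (nth (0%N, 0) Z i).1); split => //.
- move=> i; have /memZ/andP[//] : nth (0%N, 0) Z i \in Z by rewrite mem_nth// sZ'.
- move=> i; rewrite (nth_map (0%N, 0)) ?sZ'//.
  by have /memZ/andP[] : nth (0%N, 0) Z i \in Z by rewrite mem_nth// sZ'.
transitivity (\sum_(z <- Z) z.1)%N.
  by rewrite (big_nth (0%N, 0)) sZ' big_mkord.
rewrite /Z (big_morph (fun s => \sum_(z <- s) z.1)%N (id1 := 0%N) (op1 := addn)).
- rewrite /homogeneous_dim; apply: eq_bigr => i _.
  by rewrite /Zi big_map /= big_const_seq count_predT size_tuple iter_addn_0.
- by move=> s t; rewrite big_cat.
- by rewrite big_nil.
Qed.

Variables (X : n.+1.-tuple V) (w : 'I_n.+1 -> nat).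
Hypotheses (Xb : basis_of fullv X) (w0 : forall i, (0 < w i)%N)
  (Xw : forall i : 'I_n.+1, X`_i \in layer G (w i)).

Definition to_coords x : V := \row_i coord X i x.
Definition of_coords y : V := \sum_i y ord0 i *: X`_i.

Lemma to_coords_is_linear : linear to_coords.
Proof. by move=> c x y; apply/rowP => i; rewrite !mxE linearP. Qed.
HB.instance Definition _ := GRing.isLinear.Build R V V *:%R to_coords to_coords_is_linear.

Lemma of_coords_is_linear : linear of_coords.
Proof.
move=> c x y; rewrite /of_coords scaler_sumr -big_split/=; apply: eq_bigr => i _.
by rewrite !mxE scalerDl scalerA.
Qed.
HB.instance Definition _ := GRing.isLinear.Build R V V *:%R of_coords of_coords_is_linear.

Lemma to_coordsK x : of_coords (to_coords x) = x.
Proof.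
rewrite [RHS](coord_basis Xb (memvf x)); apply: eq_bigr => i _.
by rewrite mxE.
Qed.

Lemma of_coordsK y : to_coords (of_coords y) = y.
Proof.
by apply/rowP => i; rewrite mxE (coord_sum_free (fun i => y ord0 i) i (basis_free Xb)).
Qed.

Lemma coord_dilation t x i : coord X i (dilation G t x) = t ^+ w i * coord X i x.
Proof.
rewrite {1}(coord_basis Xb (memvf x)) (linear_sum (dilation G t)).
under eq_bigr => j _ do rewrite linearZ/= (dilation_layer _ _ (Xw j))// scalerA mulrC.
by rewrite (coord_sum_free _ i (basis_free Xb)).
Qed.

(** The dilation by 2 multiplies this coordinate by 2^k, since x is in V_k, and by 2^(w i). *)
Lemma coord_layer k x i : (0 < k)%N -> x \in layer G k -> w i != k -> coord X i x = 0.
Proof.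
move=> k0 xk wk; have := coord_dilation 2 x i.
rewrite (dilation_layer _ k0 xk) linearZ/= => /eqP; rewrite -subr_eq0 -mulrBl mulf_eq0.
by rewrite subr_eq0 -!natrX eqr_nat eqn_exp2l// eq_sym (negbTE wk) => /eqP.
Qed.

(** The ideal V_k + V_(k+1) + ... of the descending filtration, in coordinates. *)
Definition filtr (k : nat) x : Prop := forall i, (w i < k)%N -> coord X i x = 0.

(** The term x_j y_l [X_j, X_l] lives in weight w_j + w_l. It can reach a coordinate of weight at
    most [k] only if w_j < k, and then x_j = 0. *)
Lemma filtr_bracketl k x y : filtr k x -> filtr k.+1 (br x y).
Proof.
move=> xk i; rewrite ltnS => wi.
rewrite (coord_basis Xb (memvf x)) (coord_basis Xb (memvf y)) bracket_suml linear_sum.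
apply: big1 => j _; rewrite bracket_sumr linear_sum; apply: big1 => l _.
rewrite bracketZl bracketZr !linearZ/=.
have [wij|wij] := eqVneq (w i) (w j + w l)%N.
  by rewrite xk ?mul0r// (leq_trans _ wi)// wij -[X in (X < _)%N]addn0 ltn_add2l.
by rewrite (coord_layer _ (layer_bracket (w0 j) (w0 l) (Xw j) (Xw l))) ?mulr0// addn_gt0 w0.
Qed.

Lemma filtrN k x : filtr k x -> filtr k (- x).
Proof. by move=> h i wi; rewrite linearN/= h// oppr0. Qed.

Lemma filtrD k x y : filtr k x -> filtr k y -> filtr k (x + y).
Proof. by move=> hx hy i wi; rewrite linearD/= hx// hy// addr0. Qed.

Lemma filtr0 k : filtr k 0.
Proof. by move=> i _; rewrite linear0. Qed.

Lemma filtrZ k c x : filtr k x -> filtr k (c *: x).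
Proof. by move=> h i wi; rewrite linearZ/= h// mulr0. Qed.

Lemma filtrW k x : filtr k.+1 x -> filtr k x.
Proof. by move=> h i wi; apply: h; exact: ltnW. Qed.

Lemma filtr_bracketr k x y : filtr k x -> filtr k.+1 (br y x).
Proof. by move=> xk; rewrite bracketC; apply/filtrN/filtr_bracketl. Qed.

(** Telescoping: [p, u] - [q, v] = [p - q, u] + [q, u - v]. Each bracket with a difference in the
    filtration gains one degree, which is why words of length at least 2 do better. *)
Lemma filtr_iterated_bracket k a x x' (s : seq bool) : filtr k (x - x') ->
  let D := iterated_bracket br [seq if c then a else x | c <- s] -
           iterated_bracket br [seq if c then a else x' | c <- s] in
  filtr k D /\ ((1 < size s)%N -> filtr k.+1 D).
Proof.
move=> xk; elim: s => [|c s [IH _]] /=; first by rewrite subrr; split => //; exact: filtr0.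
have ck : filtr k ((if c then a else x) - (if c then a else x')).
  by case: c => //; rewrite subrr; exact: filtr0.
case: s IH => [//|d s IH].
suff H : filtr k.+1 (br (if c then a else x) (iterated_bracket br [seq if c then a else x | c <- d :: s])
    - br (if c then a else x') (iterated_bracket br [seq if c then a else x' | c <- d :: s])).
  by split => // *; exact: filtrW.
set u := iterated_bracket _ _ in IH *; set v := iterated_bracket _ _ in IH *.
set p := if c then a else x in ck *; set q := if c then a else x' in ck *.
have -> : br p u - br q v = br (p - q) u + br q (u - v).
  by rewrite bracketDl bracketDr bracketNl bracketNr addrA subrK.
by apply: filtrD; [exact: filtr_bracketl|exact: filtr_bracketr].
Qed.

(* Subtracting the case [a = 0], where [BCH] is the identity, cancels the words
   of length 1 without computing their coefficients. *)
Lemma filtr_mul k a x x' : filtr k (x - x') ->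
  filtr k.+1 ((sg_mul G a x - sg_mul G a x') - (x - x')).
Proof.
move=> xk; rewrite -{2}(sg_mul0x G x) -{2}(sg_mul0x G x') !sg_mulE /BCH -!sumrB.
apply: (big_ind (filtr k.+1)) => [||j _]; [exact: filtr0|exact: filtrD|].
rewrite -!scalerBr -!sumrB; apply: filtrZ.
apply: (big_ind (filtr k.+1)) => [||e _]; [exact: filtr0|exact: filtrD|].
rewrite -!scalerBr; apply: filtrZ; rewrite !BCH_wordE.
set s := BCH_word e; have [_ h1] := filtr_iterated_bracket a s xk.
have [_ h2] := filtr_iterated_bracket 0 s xk.
case: s h1 h2 => [_ _|c [_ _|d s h1 h2]].
- by rewrite /= !subrr; exact: filtr0.
- by case: c; rewrite /= !subrr ?subr0; exact: filtr0.
- by apply: filtrD; [exact: h1|apply: filtrN; exact: h2].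
Qed.

End adapted_coordinates.

(** * Quasi-metric and volume of balls *)

Section ball_geometry.
Context {R : realType} {n : nat} (G : stratified_group R n).
Local Notation V := 'rV[R]_n.+1.
Local Notation mu := (lebesgue_outer R n).
Local Notation Q := (homogeneous_dim G).
Local Notation "x ** y" := (sg_mul G x y) (at level 40, left associativity).
Implicit Types (x y z a : V) (E : set V).

(** In adapted coordinates a left translation is triangular and a dilation diagonal with determinant
    t^Q. The linear changes of coordinates are Lipschitz, and conjugating by them costs the constant
    C2 C1, the same for all maps. *)
Lemma outer_image_mul_dilation : exists2 C : R, 0 < C & forall E,
  (forall a, (mu (sg_mul G a @` E) <= C%:E * mu E)%E) /\
  (forall t, 0 < t -> (mu (dilation G t @` E) <= (C * t ^+ Q)%:E * mu E)%E).
Proof.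
have [X [w [Xb w0 Xw wQ]]] := adapted_basis G.
pose P : {linear V -> V} := to_coords X; pose P' : {linear V -> V} := of_coords X.
have PK x : P' (P x) = x by exact: to_coordsK.
have P'K x : P (P' x) = x by exact: of_coordsK.
have [M1 M10 M1P] := linear_lipschitz P; have [M2 M20 M2P] := linear_lipschitz P'.
have [C1 C10 C1P] := outer_image_lipschitz M10 M1P.
have [C2 C20 C2P] := outer_image_lipschitz M20 M2P.
exists (C2 * C1); first exact: mulr_gt0.
have conj (f : V -> V) E (c : R) : 0 <= c ->
    (forall E', mu ((P \o f \o P') @` E') <= c%:E * mu E')%E ->
    (mu (f @` E) <= (C2 * C1 * c)%:E * mu E)%E.
  move=> c0 hf; apply: (@le_trans _ _ (mu (P' @` ((P \o f \o P') @` (P @` E))))).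
    apply: le_outer_measure => _ [x Ex <-]; exists (P (f x)) => //.
    by exists (P x); [exists x|rewrite /= PK].
  apply: (le_trans (C2P _)); rewrite -!mulrA !EFinM -!muleA lee_pmul2l//.
  apply: (le_trans (hf _)).
  by rewrite muleCA lee_wpmul2l// lee_fin.
move=> E; split => [a|t t0].
  rewrite -[C2 * C1]mulr1; apply: conj => // E'; rewrite mul1e.
  pose phi y : V := P (a ** P' y) - y.
  rewrite (_ : P \o _ \o P' = (fun y => y + phi y)); last first.
    by apply/funext => y /=; rewrite /phi addrC subrK.
  apply: (@outer_image_triangular _ _ w).
  - move=> y; apply: (@cvgB _ _ _ (nbhs y)); last exact: cvg_id.
    apply: (@continuous_comp _ _ _ (fun y => a ** P' y) P); last exact: continuous_linear.
    apply: (@continuous_comp _ _ _ P' (sg_mul G a)); first exact: continuous_linear.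
    exact: continuous_mull.
  - move=> i x y xy; apply/eqP; rewrite -subr_eq0; apply/eqP.
    (* Agreement in the weights below [w i] puts the difference in the filtration at [w i];
       [filtr_mul] then says that translation changes coordinate [i] of the difference by nothing,
       that is, [phi] takes equal values there. *)
    have : filtr X w (w i) (P' x - P' y).
      move=> j wj; rewrite -linearB/=.
      have := P'K (x - y) => /rowP/(_ j); rewrite !mxE => ->.
      by rewrite xy// subrr.
    move=> /(filtr_mul Xb w0 Xw a)/(_ i (ltnSn _)).
    rewrite !linearB/= /phi !mxE.
    have E1 (z : V) : coord X i (P' z) = z ord0 i.
      by have := P'K z => /rowP/(_ i); rewrite !mxE.
    rewrite !E1 => <-; lra.
apply: conj => [|E']; first by rewrite exprn_ge0 ?ltW.
rewrite (_ : P \o _ \o P' = scale_coord (fun i => t ^+ w i)); last first.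
  apply/funext => y; apply/rowP => i; rewrite !mxE (coord_dilation Xb w0 Xw).
  by have := P'K y => /rowP/(_ i); rewrite !mxE => ->.
rewrite -wQ -prodrXr; apply: outer_image_scale => i; exact: exprn_gt0.
Qed.

Variable rho : V -> R.
Hypothesis hrho : homogeneous_norm G rho.

Lemma rho0 : rho 0 = 0. Proof. exact/(hnorm_eq0 hrho). Qed.

Lemma rho_gt0 x : x != 0 -> 0 < rho x.
Proof.
move=> x0; rewrite lt_neqAle (hnorm_ge0 hrho) andbT eq_sym.
by apply: contra_neq x0 => /(hnorm_eq0 hrho).
Qed.

(** c is the minimum of [rho] on the unit sphere of the sup norm. If |x| >= 1, the intermediate
    value theorem gives t in (0, 1] for which the dilate of x by t has norm 1, so c <= t rho(x) <=
    rho(x). *)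
Lemma rho_small : exists2 c : R, 0 < c & forall x, rho x < c -> `|x| < 1.
Proof.
pose S := [set x : V | `|x| = 1].
have cS : compact S.
  apply: bounded_closed_compact.
    by exists 1; split; [exact: num_real|move=> r r1 x /= ->; exact: ltW].
  apply: (@preimage_closed _ _ (fun x : V => `|x|) [set 1]).
    by move=> x _; exact: norm_continuous.
  exact: closed_eq.
have S0 : S !=set0.
  exists (const_mx 1); rewrite /S/=; apply/eqP; rewrite eq_le; apply/andP; split.
    by apply/rV_norm_le => // i; rewrite mxE normr1.
  by have := rV_coord_le (const_mx 1 : V) ord0; rewrite mxE normr1.
have [|p pS pmin] := compact_EVT_min S0 cS (f := rho).
  exact/continuous_subspaceT/(hnorm_continuous hrho).
exists (rho p).
  apply: rho_gt0; apply/eqP => p0; move: pS; rewrite inE /S/= p0 normr0.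
  by move/eqP; rewrite eq_sym oner_eq0.
move=> x; apply: contraTT; rewrite -!leNgt => x1.
have [||t t01 tx] := @IVT R (fun t => `|dilation G t x|) 0 1 1 ler01.
- apply: continuous_subspaceT => t.
  exact: (continuous_comp (@continuous_dilationl _ _ G x t) (@norm_continuous _ _ _)).
- by rewrite dilation0 dilation1 normr0 min_l ?max_r ?ler01.
have t0 : 0 < t.
  rewrite lt_neqAle eq_sym; move: t01; rewrite in_itv/= => /andP[-> _]; rewrite andbT.
  apply/eqP => t0; move: tx; rewrite t0 dilation0 normr0 => /eqP.
  by rewrite eq_sym oner_eq0.
apply: (le_trans (pmin (dilation G t x) _)); first by rewrite inE.
rewrite (hnorm_dilation hrho)// ler_piMl ?(hnorm_ge0 hrho)//.
by move: t01; rewrite in_itv/= => /andP[].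
Qed.

Lemma dilationVK t x : 0 < t -> dilation G t (dilation G t^-1 x) = x.
Proof. by move=> t0; rewrite dilationM divff ?gt_eqF// dilation1. Qed.

Lemma compact_rho_le r : compact [set x | rho x <= r].
Proof.
have [c c0 cP] := rho_small.
have cle : compact [set x | rho x <= c / 2].
  apply: bounded_closed_compact.
    exists 1; split; [exact: num_real|move=> s s1 x /= xc].
    by apply: (le_trans _ (ltW s1)); apply/ltW/cP; lra.
  apply: (@preimage_closed _ _ rho [set y | y <= c / 2]); last exact: closed_le.
  by move=> x _; exact: (hnorm_continuous hrho).
(* Dilation by 1/t brings the sublevel set of [r] into that of c/2, which is bounded by
   [rho_small]. *)
pose t := (1 + `|r|) / (c / 2).
have c2 : 0 < c / 2 by lra.
have t0 : 0 < t by rewrite divr_gt0// ltr_pwDl.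
apply: (@subclosed_compact _ _ (dilation G t @` [set x | rho x <= c / 2])).
- apply: (@preimage_closed _ _ rho [set y | y <= r]); last exact: closed_le.
  by move=> x _; exact: (hnorm_continuous hrho).
- apply: continuous_compact => //; apply: continuous_subspaceT.
  exact: continuous_dilation.
- move=> x /= xr; exists (dilation G t^-1 x); last exact: dilationVK.
  rewrite (hnorm_dilation hrho) ?invr_gt0// /t invf_div mulrAC ler_pdivrMr ?ltr_pwDl//.
  by rewrite ler_pM2l//; apply: (le_trans xr); apply: (le_trans (ler_norm r)); lra.
Qed.

(** By homogeneity x and y may be divided by s = rho(x) + rho(y); then the maximum of rho(x y) over
    the compact product of unit balls bounds the quotient. The summand 1 in K ensures K >= 1. *)
Lemma rho_mul_le : exists2 K : R, 1 <= K & forall x y, rho (x ** y) <= K * (rho x + rho y).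
Proof.
pose S := [set x | rho x <= 1].
have cS : compact (S `*` S) by apply: compact_setX; exact: compact_rho_le.
have S0 : S `*` S !=set0 by exists (0, 0); split; rewrite /S/= rho0.
have [|p pS pmax] := compact_EVT_max S0 cS (f := fun z : V * V => rho (z.1 ** z.2)).
  apply: continuous_subspaceT => z.
  apply: (@continuous_comp _ _ _ (fun z : V * V => z.1 ** z.2) rho); last exact: (hnorm_continuous hrho).
  by move: z; apply: continuous_mul => z; [exact: cvg_fst|exact: cvg_snd].
exists (1 + rho (p.1 ** p.2)); first by rewrite lerDl (hnorm_ge0 hrho).
move=> x y; have rx := hnorm_ge0 hrho x; have ry := hnorm_ge0 hrho y.
have [s0|s0] := leP (rho x + rho y) 0.
  have /(hnorm_eq0 hrho) -> : rho x = 0 by lra.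
  have /(hnorm_eq0 hrho) -> : rho y = 0 by lra.
  by rewrite sg_mul0x rho0 addr0 mulr0.
set s := rho x + rho y in s0 *.
rewrite -[x in leLHS](dilationVK _ s0) -[y in leLHS](dilationVK _ s0) -dilation_mul (hnorm_dilation hrho)//.
rewrite mulrC ler_pM2r//.
have := pmax (dilation G s^-1 x, dilation G s^-1 y); rewrite inE/=.
move=> /(_ _) h; apply: (le_trans (h _)); last by rewrite lerDr.
by rewrite /S/=; split => /=; rewrite (hnorm_dilation hrho) ?invr_gt0// mulrC ler_pdivrMr// mul1r /s; lra.
Qed.

Definition dist x y : R := rho ((- x) ** y).

Lemma distC x y : dist x y = dist y x.
Proof. by rewrite /dist -(hnorm_inv hrho) mul_inv opprK. Qed.

Lemma dist_ge0 x y : 0 <= dist x y. Proof. exact: (hnorm_ge0 hrho). Qed.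

Lemma distxx x : dist x x = 0. Proof. by rewrite /dist sg_mulNx rho0. Qed.

Lemma dist_eq0 x y : dist x y = 0 -> x = y.
Proof. by move=> /(hnorm_eq0 hrho) h; rewrite -(mulKN G x y) h mulx0. Qed.

Lemma dist_triangle : exists2 K : R, 1 <= K &
  forall x y z, dist x z <= K * (dist x y + dist y z).
Proof.
have [K K1 KP] := rho_mul_le; exists K => // x y z.
by rewrite /dist -{1}(mulKN G y z) sg_mulA; exact: KP.
Qed.

Lemma hballE x r y : hball G rho x r y = (dist y x < r). Proof. by []. Qed.

Lemma continuous_dist x : continuous (dist x).
Proof.
move=> y; apply: (@continuous_comp _ _ _ (sg_mul G (- x)) rho).
  exact: continuous_mull.
exact: (hnorm_continuous hrho).
Qed.

Lemma open_hball x r : open (hball G rho x r).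
Proof.
rewrite (_ : hball _ _ _ _ = dist x @^-1` [set y | y < r]); last first.
  by apply/seteqP; split => y /=; rewrite hballE distC.
apply: open_comp; last exact: open_lt.
by move=> y _; exact: continuous_dist.
Qed.

Lemma compact_dist_le x r : compact [set y | dist x y <= r].
Proof.
rewrite (_ : [set _ | _] = sg_mul G x @` [set y | rho y <= r]); last first.
  apply/seteqP; split => [y /= xy|_ /= [y /= yr <-]].
    by exists ((- x) ** y) => //; rewrite mulKN.
  by rewrite /dist mulNK.
apply: continuous_compact; last exact: compact_rho_le.
exact/continuous_subspaceT/continuous_mull.
Qed.

Lemma compact_outer_fin E : compact E -> (mu E < +oo)%E.
Proof.
move=> /compact_bounded[M [_ /(_ (M + 1))]] hM.
have {}hM : forall x, E x -> `|x| <= M + 1 by apply: hM; rewrite ltrDl.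
pose r := `|M| + 2.
apply: (@le_lt_trans _ _ (mu (box (0 - const_mx r, 0 + const_mx r)))).
  apply: le_outer_measure => x /hM xM; apply: mem_box_center; first by rewrite ltr_wpDl.
  by rewrite subr0 (le_lt_trans xM)// ler_ltD ?ler_norm// ltr1n.
by rewrite outer_box ltry.
Qed.

Lemma open_outer_gt0 E x : open E -> E x -> (0 < mu E)%E.
Proof.
move=> oE Ex; have [k [kx kE]] := @rat_box_nbhs _ _ x E (open_nbhs_nbhs (conj oE Ex)).
apply: (@lt_le_trans _ _ (mu (box (rat_box k)))); last exact: le_outer_measure.
move: kx; case: (rat_box k) => a b abx; rewrite outer_box lte_fin bvolE.
  by apply: prodr_gt0 => i _; have /andP[/= ? ?] := abx i; lra.
by move=> i; have /andP[/= ? ?] := abx i; lra.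
Qed.

(** The ball is contained in the image of the unit ball by a dilation and a translation, which gives
    the upper bound. Conversely the unit ball is contained in the image of the ball by the inverse
    maps, and the upper estimate for these is the lower bound. *)
Lemma hball_volume : exists c1 c2 : R, [/\ 0 < c1, 0 < c2 & forall x r, 0 < r ->
  (((c1 * r ^+ Q)%:E <= mu (hball G rho x r)) /\ (mu (hball G rho x r) <= (c2 * r ^+ Q)%:E))%E].
Proof.
have [C C0 CP] := outer_image_mul_dilation.
pose B := hball G rho 0 1.
have B0 : (0 < mu B)%E.
  by apply: (@open_outer_gt0 _ 0); [exact: open_hball|rewrite /B hballE distxx].
have Boo : (mu B < +oo)%E.
  apply: (@le_lt_trans _ _ (mu [set y | dist 0 y <= 1])).
    by apply: le_outer_measure => y; rewrite /B hballE distC => /ltW.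
  exact/compact_outer_fin/compact_dist_le.
have BE : mu B = (fine (mu B))%:E by rewrite fineK// ge0_fin_numE// ltW.
set v := fine (mu B) in BE; have v0 : 0 < v by rewrite -lte_fin -BE.
have CC : 0 < C * C by exact: mulr_gt0.
exists (v / (C * C)), (C * C * v); split; [exact: divr_gt0|exact: mulr_gt0|].
move=> x r r0; have rQ : 0 < r ^+ Q by exact: exprn_gt0.
have mem0 y s : hball G rho 0 s y = (rho y < s).
  by rewrite hballE /dist mulx0 (hnorm_inv hrho).
have up E s a : 0 < s -> (mu (sg_mul G a @` (dilation G s @` E)) <= (C * (C * s ^+ Q))%:E * mu E)%E.
  move=> s0; apply: (le_trans ((CP _).1 a)); rewrite EFinM -muleA lee_pmul2l//.
  exact: (CP _).2.
split; last first.
  apply: (@le_trans _ _ (mu (sg_mul G x @` (dilation G r @` B)))).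
    apply: le_outer_measure => y; rewrite hballE distC => xy.
    exists ((- x) ** y); last exact: mulKN.
    exists (dilation G r^-1 ((- x) ** y)); last exact: dilationVK.
    by rewrite /B mem0 (hnorm_dilation hrho) ?invr_gt0// mulrC ltr_pdivrMr// mul1r.
  apply: (le_trans (up _ _ _ r0)); by rewrite BE -EFinM lee_fin mulrA mulrAC.
have : (mu B <= (C * (C * r^-1 ^+ Q))%:E * mu (hball G rho x r))%E.
  apply: (@le_trans _ _ (mu (dilation G r^-1 @` (sg_mul G (- x) @` hball G rho x r)))).
    apply: le_outer_measure => y; rewrite /B mem0 => y1.
    exists (dilation G r y); last by rewrite dilationM mulVf ?gt_eqF// dilation1.
    exists (x ** dilation G r y); last by rewrite mulNK.
    by rewrite hballE distC /dist mulNK (hnorm_dilation hrho)// -[ltRHS]mulr1 ltr_pM2l.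
  apply: (le_trans ((CP _).2 _ _)); first by rewrite invr_gt0.
  rewrite [(C * (C * _))%:E]EFinM (muleC C%:E) -muleA lee_wpmul2l//; last exact: (CP _).1.
  by rewrite lee_fin mulr_ge0 ?exprn_ge0 ?invr_ge0 ?ltW.
rewrite BE exprVn mulrA -lee_pdivrMl; last by rewrite mulr_gt0// invr_gt0.
by rewrite -EFinM invf_div mulrC mulrA mulrAC.
Qed.

End ball_geometry.

Section integration.
Context d {T : measurableType d} {R : realType} (mu : {measure set T -> \bar R}).
Local Open Scope ereal_scope.

Import HBNNSimple.

(** The integral is a supremum over simple functions: one that lies below f, set to 0 on the
    exceptional null set, lies below g and keeps its integral. Valid for arbitrary nonnegative f and
    g, it applies to commutators and local maximal functions. *)
Lemma ae_le_integral_ge0 (f g : T -> \bar R) :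
  (forall x, 0 <= f x) -> (forall x, 0 <= g x) ->
  {ae mu, forall x, f x <= g x} -> \int[mu]_x f x <= \int[mu]_x g x.
Proof.
move=> f0 g0 [N [mN N0 fgN]].
rewrite (ge0_integralTE _ f0) (ge0_integralTE _ g0).
apply: ge_ereal_sup => _ [h /= hf <-].
have [h' h'E] : exists h' : {nnsfun T >-> R}, forall x, (h' x = h x * (x \in ~` N)%:R)%R.
  by exists (mul_nnsfun h (indic_nnsfun R (measurableC mN))) => x; rewrite /= mindicE.
apply: ereal_sup_ubound; exists h' => /= [x|].
  rewrite h'E; case: (boolP (x \in _)) => xN; last by rewrite mulr0.
  rewrite mulr1; apply: (le_trans (hf x)).
  by move: xN; rewrite inE => xN; apply: contrapT => /fgN.
rewrite -!integralT_nnsfun; apply: ge0_ae_eq_integral => //.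
- by apply/measurable_EFinP; exact: measurable_funP.
- by apply/measurable_EFinP; exact: measurable_funP.
- by move=> x _; rewrite lee_fin.
- by move=> x _; rewrite lee_fin.
exists N; split => // x /=; apply: contra_notP => xN _.
by rewrite h'E mem_set ?mulr1.
Qed.

End integration.

(** * Vitali covering lemma *)

Section vitali.
Context {R : realType} {n : nat} (G : stratified_group R n) (rho : 'rV[R]_n.+1 -> R).
Hypothesis hrho : homogeneous_norm G rho.
Local Notation V := 'rV[R]_n.+1.
Local Notation T := (lebesgue_rV_type R n).
Local Notation mu := (lebesgue_rV R n).
Local Notation Q := (homogeneous_dim G).
Local Notation B := (hball G rho).
Local Open Scope ereal_scope.

Lemma measurable_hball x r : measurable (B x r : set T).
Proof. exact/open_measurable_rV/open_hball. Qed.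

Lemma hball_doubling (c : R) : (0 < c)%R -> exists2 D : R, (0 < D)%R &
  forall x r, (0 < r)%R -> mu (B x (c * r)%R) <= D%:E * mu (B x r).
Proof.
move=> c0; have [c1 [c2 [c10 c20 h]]] := hball_volume hrho.
exists (c2 * c ^+ Q / c1)%R; first by rewrite divr_gt0// mulr_gt0// exprn_gt0.
move=> x r r0; apply: (le_trans (h x _ (mulr_gt0 c0 r0)).2).
apply: (@le_trans _ _ ((c2 * c ^+ Q / c1)%:E * (c1 * r ^+ Q)%:E)).
  by rewrite -EFinM lee_fin exprMn !mulrA divfK ?gt_eqF.
rewrite lee_wpmul2l ?(h x _ r0).1// lee_fin.
by rewrite divr_ge0 ?mulr_ge0 ?exprn_ge0 ?ltW.
Qed.

Definition hball_of (b : V * R) : set V := B b.1 b.2.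

(* Greedy choice of a ball of maximal radius; disjointness is recorded through
   the superadditivity of the integrals, which is all that is used. *)
Lemma vitali_finite : exists2 c : R, (0 < c)%R & forall s : seq (V * R),
  (forall b, b \in s -> (0 < b.2)%R) -> exists s' : seq (V * R),
  [/\ {subset s' <= s},
      forall b, b \in s -> exists2 b', b' \in s' & hball_of b `<=` B b'.1 (c * b'.2)%R &
      forall (g : T -> \bar R) (A : set T), measurable_fun setT g -> (forall x, 0 <= g x) ->
        measurable A -> (forall b, b \in s -> hball_of b `<=` A) ->
        \sum_(b <- s') \int[mu]_(x in hball_of b) g x <= \int[mu]_(x in A) g x].
Proof.
have [K K1 KP] := dist_triangle hrho; have K0 : (0 < K)%R by lra.
(* If a ball of radius s <= r about y meets the ball of radius r about x at z, then d(y, x) <= 2 K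
   r, and a second use of the quasi-triangle inequality gives d(u, x) < K (r + 2 K r). *)
exists (K + 2 * K * K)%R; first by rewrite addr_gt0// !mulr_gt0.
have engulf x r y s z : (0 < s)%R -> (s <= r)%R -> B x r z -> B y s z ->
    B y s `<=` B x ((K + 2 * K * K) * r)%R.
  rewrite !hballE => s0 sr zx zy u; rewrite !hballE => uy.
  apply: (le_lt_trans (KP u y x)).
  have h1 : (dist G rho y x <= K * (dist G rho z y + dist G rho z x))%R.
    by rewrite [X in (_ <= _ * (X + _))%R](distC hrho); exact: KP.
  have h2 : (K * (dist G rho z y + dist G rho z x) <= K * (2 * r))%R.
    by rewrite ler_pM2l//; lra.
  have -> : ((K + 2 * K * K) * r = K * (r + K * (2 * r)))%R by ring.
  by rewrite ltr_pM2l//; lra.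
move=> s; have [k] := ubnP (size s); elim: k s => // k IH s /ltnSE sk s0.
case: (eqVneq s [::]) => [->|sn].
  by exists [::]; split => // g A _ g0 _ _; rewrite big_nil; exact: integral_ge0.
have [b1 b1s b1max] : exists2 b1, b1 \in s & forall b, b \in s -> (b.2 <= b1.2)%R.
  elim: s sn {sk s0} => // b s IHs _; have [->|/IHs[b1 b1s b1max]] := eqVneq s [::].
    by exists b; rewrite ?mem_head// => c; rewrite inE => /eqP ->.
  have [bb1|bb1] := leP b.2 b1.2.
    by exists b1; [rewrite inE b1s orbT|move=> c; rewrite inE => /predU1P[->//|]; exact: b1max].
  exists b; first by rewrite mem_head.
  by move=> c; rewrite inE => /predU1P[->//|/b1max cb]; exact: le_trans (ltW bb1).
(* Balls that meet the largest ball [b1] are engulfed by its dilate; the recursion treats the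
   others, and the list shortens because [b1] meets itself. *)
pose far b := `[< hball_of b `&` hball_of b1 = set0 >].
pose s1 := [seq b <- s | far b].
have b1far : ~~ far b1.
  apply/asboolPn; rewrite setIid => /seteqP[h _].
  by apply: (h b1.1); rewrite /hball_of hballE (distxx hrho) s0.
have ss1 : {subset s1 <= s} by move=> b; rewrite mem_filter => /andP[].
have [|b bs1|s' [s's1 s'c s'g]] := IH s1.
- apply: leq_trans sk; rewrite size_filter -(count_predC far) -[ltnLHS]addn0 ltn_add2l.
  by rewrite -has_count; apply/hasP; exists b1.
- exact/s0/ss1.
exists (b1 :: s'); split.
- by move=> b; rewrite inE => /predU1P[->//|/s's1/ss1].
- move=> b bs; have [fb|] := boolP (far b).
    have [|b' b's' bb'] := s'c b; first by rewrite mem_filter fb.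
    by exists b' => //; rewrite inE b's' orbT.
  move=> /asboolPn/eqP/set0P[z [zb zb1]]; exists b1; first by rewrite mem_head.
  exact: (engulf _ _ _ _ z (s0 b bs) (b1max b bs)).
move=> g A mg g0 mA sA; rewrite big_cons.
have mb1 : measurable (hball_of b1 : set T) by exact: measurable_hball.
have mA1 : measurable (A `\` hball_of b1 : set T) by exact: measurableD.
(* The balls chosen later miss [b1], so they lie in A minus [b1], where the induction hypothesis is
   used. *)
have -> : \int[mu]_(x in A) g x =
    \int[mu]_(x in hball_of b1) g x + \int[mu]_(x in A `\` hball_of b1) g x.
  rewrite -ge0_integral_setU//.
  - by rewrite setDUK//; exact: sA.
  - exact: measurable_funTS.
  - by apply/disj_set2P; rewrite setDIK.
apply: leeD => //; apply: s'g => // b bs1.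
move: (bs1); rewrite mem_filter => /andP[/asboolP bb1 bs] x bx; split; first exact: (sA b).
by move=> b1x; have : (hball_of b `&` hball_of b1) x by []; rewrite bb1.
Qed.

End vitali.

(** * The maximal function *)

Section weak_type_to_L2.
Context d {T : measurableType d} {R : realType} (mu : {measure set T -> \bar R}).
Local Open Scope ereal_scope.

Lemma nneseries_term_le (u : (\bar R)^nat) j : (forall k, 0 <= u k) ->
  u j <= \sum_(k <oo) u k.
Proof.
move=> u0; apply: (@le_trans _ _ (\sum_(0 <= k < j.+1) u k)).
  by rewrite big_nat_recr//= leeDr// sume_ge0.
by apply: nneseries_lim_ge => k _.
Qed.

(** If the last term e 2^N is present, then e 2^N < 2 g, and the earlier terms together are at most
    e 2^N. *)
Lemma dyadic_sum_le (e g : R) N : (0 < e)%R -> (0 <= g)%R ->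
  (\sum_(0 <= j < N) e * 2 ^+ j * (e * 2 ^+ j / 2 < g)%R%:R <= 4 * g)%R.
Proof.
move=> e0 g0; elim: N => [|N IH]; first by rewrite big_geq// mulr_ge0.
rewrite big_nat_recr//=; case: ltP => h; last by rewrite mulr0 addr0.
have : (\sum_(0 <= j < N) e * 2 ^+ j * (e * 2 ^+ j / 2 < g)%R%:R <= e * 2 ^+ N)%R.
  elim: N {IH h} => [|N IH]; first by rewrite big_geq// expr0 mulr1 ltW.
  rewrite big_nat_recr//= exprS; have := ltW (mulr_gt0 e0 (exprn_gt0 N (ltr0Sn R 1))).
  by case: (_ < g)%R => /=; lra.
by move=> ?; rewrite mulr1; lra.
Qed.

(** The large part in the Marcinkiewicz splitting of [g] at height [s]. *)
Definition above (g : T -> R) (s : R) (y : T) : R := (g y * (s < g y)%R%:R)%R.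

Lemma measurable_above (g : T -> R) (s : R) :
  measurable_fun setT g -> measurable_fun setT (above g s).
Proof.
move=> mg; apply: measurable_funM => //.
rewrite (_ : (fun y => _) = \1_(g @^-1` `]s, +oo[%classic)).
  by apply: measurable_indic; rewrite -[X in measurable X]setTI; apply: mg.
by apply/funext => y; rewrite indicE; congr (_ %:R); congr nat_of_bool;
  apply/idP/idP; rewrite inE/= in_itv/= andbT.
Qed.

Lemma above_ge0 (g : T -> R) (s : R) y : (forall y, (0 <= g y)%R) -> (0 <= above g s y)%R.
Proof. by move=> g0; rewrite mulr_ge0. Qed.

Variables (C : R) (h : T -> \bar R) (g : T -> R).
Hypotheses (C0 : (0 < C)%R) (mh : measurable_fun setT h) (h0 : forall x, 0 <= h x)
  (mg : measurable_fun setT g) (g0 : forall x, (0 <= g x)%R).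
Hypothesis weak : forall s : R, (0 < s)%R ->
  mu [set x | s%:E < h x] <= (C / s)%:E * \int[mu]_y (above g (s / 2) y)%:E.

Lemma measurable_gt (t : R) : measurable [set x | t%:E < h x].
Proof.
by rewrite -[X in measurable X]setTI; exact: emeasurable_fun_o_infty.
Qed.

(** Marcinkiewicz interpolation on dyadic levels; the truncation at [e] makes them start at j = 0.
    Where e 2^j < h <= e 2^(j+1), h^2 is at most c_j = (e 2^(j+1))^2. The weak bound turns c_j into
    4 C e 2^j times the integral of the part of g above e 2^j / 2, and [dyadic_sum_le] sums these to
    16 C g^2. *)
Lemma weak_type_L2_trunc (e : R) : (0 < e)%R ->
  \int[mu]_(x in [set x | e%:E < h x]) (h x * h x) <= (16 * C)%:E * \int[mu]_x (g x * g x)%:E.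
Proof.
move=> e0.
pose E j := [set x | (e * 2 ^+ j)%:E < h x].
have e2 j : (0 < e * 2 ^+ j)%R by rewrite mulr_gt0// exprn_gt0.
pose c j := (e * e * 4 ^+ j.+1)%R.
have c0 j : (0 <= c j)%R by rewrite ltW// !mulr_gt0// exprn_gt0.
have pt x : e%:E < h x -> h x * h x <= \sum_(j <oo) (c j * \1_(E j) x)%:E.
  have trm j : (e * 2 ^+ j)%:E < h x -> (c j)%:E <= \sum_(j <oo) (c j * \1_(E j) x)%:E.
    move=> jx; apply: le_trans (nneseries_term_le j _); last first.
      by move=> k; rewrite lee_fin mulr_ge0.
    by rewrite indicE mem_set// mulr1.
  (* Stated for a real lower bound [r] of h(x), so that it also serves where h(x) is infinite, with
     [r] arbitrarily large. *)
  have key (r : R) : (0 < r)%R -> e%:E < r%:E -> r%:E <= h x ->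
      (r * r)%:E <= \sum_(j <oo) (c j * \1_(E j) x)%:E.
    rewrite lte_fin => r0 er rh.
    have exN : exists N, (r <= e * 2 ^+ N)%R.
      exists (Num.bound (r / e)); rewrite -ler_pdivrMl// mulrC.
      apply/ltW/(lt_trans (archi_boundP _)); first by rewrite divr_ge0 ?ltW.
      by rewrite -natrX ltr_nat ltn_expl.
    case: (ex_minnP exN) => -[|N] rN minN.
      by move: rN; rewrite expr0 mulr1 leNgt er.
    have Nr : (e * 2 ^+ N < r)%R.
      by rewrite ltNge; apply/negP => /minN; rewrite ltnn.
    apply: le_trans (trm N _); last by apply: lt_le_trans rh; rewrite lte_fin.
    rewrite lee_fin /c (_ : 4 ^+ N.+1 = 2 ^+ N.+1 * 2 ^+ N.+1)%R; last by rewrite -exprMn; congr (_ ^+ _)%R; lra.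
    by rewrite mulrACA; apply: ler_pM => //; exact: ltW.
  move=> ex; case hx : (h x) => [r| |].
  - rewrite -EFinM; apply: key; rewrite -?hx//.
    by move: ex; rewrite hx lte_fin; exact: lt_trans.
  - suff -> : \sum_(j <oo) (c j * \1_(E j) x)%:E = +oo by rewrite leey.
    apply/eqyP => A A0; pose r := (Num.max (e + 1) (Num.max 1 A))%R.
    apply: (@le_trans _ _ (r * r)%:E).
      have r1 : (1 <= r)%R by rewrite !le_max lexx orbT.
      rewrite lee_fin (@le_trans _ _ r)//; first by rewrite !le_max lexx !orbT.
      by rewrite ler_peMl// (le_trans ler01).
    apply: key; rewrite ?hx ?leey//.
      by rewrite (lt_le_trans ltr01)// !le_max lexx orbT.
    by rewrite lte_fin lt_max ltrDl ltr01.
  - by have := h0 x; rewrite hx.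
pose k j := above g (e * 2 ^+ j / 2).
have mk j : measurable_fun setT (k j) by exact: measurable_above.
have k0 j y : (0 <= k j y)%R by exact: above_ge0.
have mE j : measurable (E j) by exact: measurable_gt.
have muE j : mu (E j) <= (C / (e * 2 ^+ j))%:E * \int[mu]_y (k j y)%:E.
  exact: weak.
apply: (@le_trans _ _ (\int[mu]_x \sum_(j <oo) (c j * \1_(E j) x)%:E)).
  rewrite [leLHS]integral_mkcond; apply: ae_le_integral_ge0.
  - by move=> x; apply: erestrict_ge0 => y _; exact: mule_ge0.
  - by move=> x; apply: nneseries_ge0 => j _ _; rewrite lee_fin mulr_ge0.
  - apply: aeW => x; rewrite patchE; case: ifPn => [|_].
      by rewrite inE; exact: pt.
    by apply: nneseries_ge0 => j _ _; rewrite lee_fin mulr_ge0.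
rewrite integral_nneseries//; last 2 first.
- by move=> j; apply/measurable_EFinP; apply: measurable_funM => //; exact: measurable_indic.
- by move=> j x _; rewrite lee_fin mulr_ge0.
apply: (@le_trans _ _ (\sum_(j <oo) \int[mu]_y (4 * C * (e * 2 ^+ j) * k j y)%:E)).
  apply: lee_nneseries => j _.
    by move=> _; apply: integral_ge0 => x _; rewrite lee_fin mulr_ge0.
  rewrite [leRHS](eq_integral (fun y => (4 * C * (e * 2 ^+ j))%:E * (k j y)%:E)); last first.
    by move=> y _; rewrite EFinM.
  rewrite ge0_integralZl//; last 3 first.
  - exact/measurable_EFinP.
  - by move=> y _; rewrite lee_fin.
  - by rewrite lee_fin !mulr_ge0// ltW.
  rewrite [leLHS](integralZl_indic measurableT (fun=> E j))//; last by rewrite ltNge c0.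
  rewrite integral_indic// setIT.
  apply: (le_trans (lee_wpmul2l _ (muE j))); first by rewrite lee_fin.
  rewrite muleA -EFinM lee_wpmul2r//; first by apply: integral_ge0 => y _; rewrite lee_fin.
  rewrite lee_fin /c.
  rewrite (_ : 4 ^+ j.+1 = 4 * (2 ^+ j * 2 ^+ j))%R; last by rewrite exprS -exprMn; congr (_ * _ ^+ _)%R; lra.
  rewrite le_eqVlt; apply/orP; left; apply/eqP.
  have := e2 j; move: (2 ^+ j)%R => q eq0; field.
  by apply/andP; split; apply: contraTneq eq0 => ->; rewrite ?mulr0 ?mul0r ltxx.
rewrite -integral_nneseries//; last 2 first.
- by move=> j; apply/measurable_EFinP; apply: measurable_funM.
- by move=> j x _; rewrite lee_fin !mulr_ge0// ltW.
rewrite -ge0_integralZl//; last 3 first.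
- by apply/measurable_EFinP; exact: measurable_funM.
- by move=> x _; rewrite lee_fin mulr_ge0.
- by rewrite lee_fin mulr_ge0// ltW.
apply: ae_le_integral_ge0.
- by move=> x; apply: nneseries_ge0 => j _ _; rewrite lee_fin !mulr_ge0// ltW.
- by move=> x; rewrite mule_ge0// lee_fin ?mulr_ge0// ltW.
apply: aeW => x; apply: lime_le.
  by apply: is_cvg_nneseries => j _ _; rewrite lee_fin !mulr_ge0// ltW.
apply: nearW => N; rewrite sumEFin lee_fin.
have -> : (\sum_(0 <= j < N) 4 * C * (e * 2 ^+ j) * k j x =
    4 * C * g x * \sum_(0 <= j < N) e * 2 ^+ j * (e * 2 ^+ j / 2 < g x)%R%:R)%R.
  by rewrite mulr_sumr; apply: eq_bigr => j _; rewrite /k /above; ring.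
rewrite (_ : 16 * C * (g x * g x) = 4 * C * g x * (4 * g x))%R; last by ring.
by rewrite ler_wpM2l ?dyadic_sum_le// !mulr_ge0// ltW.
Qed.

(** Monotone convergence as the truncation level 1/(N+1) decreases to 0; points where h = 0
    contribute nothing. *)
Lemma weak_type_L2 : \int[mu]_x (h x * h x) <= (16 * C)%:E * \int[mu]_x (g x * g x)%:E.
Proof.
pose iv N : R := (N.+1%:R^-1)%R.
pose S N : set T := [set x | (iv N)%:E < h x].
pose F N x := (h x * h x) * (\1_(S N) x)%:E.
have mF N : measurable_fun setT (F N : T -> \bar R).
  apply: emeasurable_funM; first exact: emeasurable_funM.
  by apply/measurable_EFinP; apply: measurable_indic; exact: measurable_gt.
have F0 N x : 0 <= F N x by rewrite mule_ge0 ?mule_ge0// lee_fin.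
have ndF x : nondecreasing_seq (F ^~ x).
  move=> N M NM; rewrite /F lee_wpmul2l ?mule_ge0// lee_fin !indicE ler_nat.
  case: (boolP (x \in _)) => //; rewrite inE/= => hN; rewrite mem_set//=.
  by apply: le_lt_trans hN; rewrite lee_fin /iv lef_pV2 ?posrE// ler_nat.
have limF x : h x * h x = limn (F ^~ x).
  apply/esym/cvg_lim => //; have [hx|hx] := eqVneq (h x) 0.
    rewrite (_ : F^~ x = fun=> h x * h x); first exact: cvg_cst.
    by apply/funext => N; rewrite /F hx !mul0e.
  apply: cvg_near_cst.
  have [N hN] : exists N : nat, (iv N)%:E < h x.
    have : 0 < h x by rewrite lt_neqAle eq_sym hx h0.
    case: (h x) => [r| |] //; last by move=> _; exists 0%N; rewrite ltry.
    rewrite lte_fin => r0; exists (Num.bound r^-1).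
    rewrite lte_fin /iv invf_plt ?posrE//.
    by apply: (lt_trans (archi_boundP _)); rewrite ?invr_ge0 ?ltW// ltr_nat.
  exists N => // M /= NM; rewrite /F indicE mem_set ?mule1//=.
  by apply: le_lt_trans hN; rewrite lee_fin /iv lef_pV2 ?posrE// ler_nat.
rewrite (eq_integral (fun x => limn (F ^~ x))); last by move=> x _; exact: limF.
rewrite monotone_convergence//.
apply: lime_le.
  apply: ereal_nondecreasing_is_cvgn => N M NM.
  by apply: ge0_le_integral => // x _; exact: ndF.
apply: nearW => N; apply: (le_trans _ (@weak_type_L2_trunc (iv N) _)); last by rewrite invr_gt0.
rewrite [leRHS]integral_mkcond; apply: ae_le_integral_ge0 => //.
  by move=> x; apply: erestrict_ge0 => y _; exact: mule_ge0.
apply: aeW => x; rewrite /F patchE indicE; case: ifPn => _; rewrite ?mule1 ?mule0//.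
Qed.

End weak_type_to_L2.

Section ball_averages.
Context d {T : measurableType d} {R : realType} (mu : {measure set T -> \bar R}).
Variable B : T * R -> set T.
Local Open Scope ereal_scope.
Implicit Types (b : T * R) (g : T -> \bar R).

Definition vol b : R := fine (mu (B b)).

Definition ball_avg g b : \bar R := (vol b)^-1%:E * \int[mu]_(x in B b) g x.

Definition hlmax g (x : T) : \bar R :=
  ereal_sup [set ball_avg g b | b in [set b | (0 < b.2)%R /\ B b x]].

Lemma ball_avg_ge0 g b : (forall x, 0 <= g x) -> 0 <= ball_avg g b.
Proof.
by move=> g0; rewrite mule_ge0 ?integral_ge0// lee_fin invr_ge0 fine_ge0.
Qed.

Lemma hlmax_ge g b x : (0 < b.2)%R -> B b x -> ball_avg g b <= hlmax g x.
Proof. by move=> b0 bx; apply: ereal_sup_ubound; exists b. Qed.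

Lemma hlmax_gtP g (t : \bar R) x : t < hlmax g x <->
  exists b, [/\ (0 < b.2)%R, B b x & t < ball_avg g b].
Proof.
split => [/ereal_sup_gt[_ [b [b0 bx] <-] tb]|[b [b0 bx tb]]]; first by exists b.
exact: lt_le_trans tb (hlmax_ge _ b0 bx).
Qed.

Hypothesis mB : forall b, measurable (B b).
Hypothesis volE : forall b, (0 < b.2)%R -> mu (B b) = (vol b)%:E.
Hypothesis vol_gt0 : forall b, (0 < b.2)%R -> (0 < vol b)%R.
Hypothesis B_center : forall x r, (0 < r)%R -> B (x, r) x.

Lemma hlmax_ge0 g x : (forall x, 0 <= g x) -> 0 <= hlmax g x.
Proof.
move=> g0; apply: (@le_trans _ _ (ball_avg g (x, 1%R))); first exact: ball_avg_ge0.
by apply: hlmax_ge => //; exact: B_center.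
Qed.

(** On a ball where the average of [g] exceeds [s], the values at most s/2 account for at most s/2
    of it. *)
Lemma hlmax_superlevel (g : T -> R) (s : R) x : measurable_fun setT g ->
  (forall y, (0 <= g y)%R) -> (0 < s)%R -> s%:E < hlmax (EFin \o g) x ->
  (s / 2)%:E < hlmax (EFin \o above g (s / 2)) x.
Proof.
move=> mg g0 s0 /hlmax_gtP[b [b0 bx sb]]; apply/hlmax_gtP; exists b; split => //.
have v0 := vol_gt0 b0.
move: sb; rewrite /ball_avg !lte_pdivlMl// => sb.
have mg1 := measurable_above (s / 2) mg.
have : \int[mu]_(y in B b) (g y)%:E <=
    \int[mu]_(y in B b) (above g (s / 2) y)%:E + (s / 2)%:E * (vol b)%:E.
  rewrite -(volE b0) -integral_cst// -ge0_integralD//; first last.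
  - by move=> y _; rewrite lee_fin ltW// divr_gt0.
  - by apply/measurable_EFinP; exact: measurable_funTS.
  - by move=> y _; rewrite lee_fin above_ge0.
  apply: ge0_le_integral => //.
  - by move=> y _; rewrite lee_fin.
  - by apply/measurable_EFinP; exact: measurable_funTS.
  - apply: emeasurable_funD => //; apply/measurable_EFinP; exact: measurable_funTS.
  move=> y _; rewrite /cst -EFinD lee_fin /above; case: ltP => h; rewrite ?mulr1 ?mulr0 ?add0r//.
  by rewrite lerDl ltW// divr_gt0.
move=> /(lt_le_trans sb) {sb} h.
have -> : (vol b)%:E * (s / 2)%:E =
    (vol b)%:E * s%:E - (s / 2)%:E * (vol b)%:E.
  by rewrite -!EFinM -EFinB; congr EFin; lra.
by rewrite lteBlDr.
Qed.

End ball_averages.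

Section maximal_function.
Context {R : realType} {n : nat} (G : stratified_group R n) (rho : 'rV[R]_n.+1 -> R).
Hypothesis hrho : homogeneous_norm G rho.
Local Notation V := 'rV[R]_n.+1.
Local Notation T := (lebesgue_rV_type R n).
Local Notation mu := (lebesgue_rV R n).
Local Notation Q := (homogeneous_dim G).
Local Notation ball_of := (hball_of G rho).
Local Notation vol := (vol mu ball_of).
Local Notation ball_avg := (ball_avg mu ball_of).
Local Notation hlmax := (hlmax mu ball_of).
Local Open Scope ereal_scope.
Implicit Types (b : V * R) (g : T -> \bar R).

Lemma hball_of_volE b : (0 < b.2)%R -> mu (ball_of b) = (vol b)%:E.
Proof.
move=> b0; have [c1 [c2 [_ _ h]]] := hball_volume hrho.
by rewrite fineK// ge0_fin_numE// (le_lt_trans (h b.1 _ b0).2)// ltry.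
Qed.

Lemma vol_gt0 b : (0 < b.2)%R -> (0 < vol b)%R.
Proof.
move=> b0; have [c1 [c2 [c10 _ h]]] := hball_volume hrho.
rewrite -lte_fin -hball_of_volE//; apply: lt_le_trans (h b.1 _ b0).1.
by rewrite lte_fin mulr_gt0// exprn_gt0.
Qed.

Lemma vol_bounds : exists c1 c2 : R, [/\ (0 < c1)%R, (0 < c2)%R & forall b, (0 < b.2)%R ->
  (c1 * b.2 ^+ Q <= vol b)%R /\ (vol b <= c2 * b.2 ^+ Q)%R].
Proof.
have [c1 [c2 [c10 c20 h]]] := hball_volume hrho; exists c1, c2; split => // b b0.
by rewrite -!lee_fin -hball_of_volE//; exact: h.
Qed.

Lemma measurable_ball_of b : measurable (ball_of b : set T).
Proof. exact: measurable_hball. Qed.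

(** The balls are open and need not be centred at x: one that witnesses the inequality at x does so
    at all of its points. *)
Lemma open_hlmax_gt g (t : \bar R) : open [set x | t < hlmax g x].
Proof.
rewrite openE => x /= /hlmax_gtP[b [b0 bx tb]].
apply: (@filterS _ _ _ (ball_of b)).
  by move=> y yb; apply/hlmax_gtP; exists b.
apply: open_nbhs_nbhs; split => //; exact: open_hball.
Qed.

Lemma measurable_hlmax g : measurable_fun setT (hlmax g : T -> \bar R).
Proof.
apply: (measurability _ (ErealGenOInfty.measurableE R)) => _ [_ [r ->] <-].
rewrite setTI; apply: open_measurable_rV.
rewrite (_ : _ @^-1` _ = [set x | r%:E < hlmax g x]); first exact: open_hlmax_gt.
by apply/seteqP; split => x /=; rewrite in_itv/= andbT.
Qed.

Lemma outer_le_sum (s : seq (V * R)) (F : V * R -> set V) (E : set V) :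
  (forall x, E x -> exists2 b, b \in s & F b x) ->
  lebesgue_outer R n E <= \sum_(b <- s) lebesgue_outer R n (F b).
Proof.
elim: s E => [|b s IH] E Es.
  by rewrite big_nil (_ : E = set0) ?outer_measure0// -subset0 => x /Es[].
rewrite big_cons; apply: (@le_trans _ _ (lebesgue_outer R n (F b `|` (E `\` F b)))).
  by apply: le_outer_measure => x Ex; case: (pselect (F b x)) => h; [left|right].
apply: (le_trans (outer_measureU2 _ _ _)); apply: leeD => //; apply: IH => x [Ex nF].
by have [c] := Es x Ex; rewrite inE => /predU1P[->//|cs Fc]; exists c.
Qed.

(** By Vitali's lemma a finite union of balls of average above [t] is covered by the c-dilates of
    selected ones. Each dilate has volume at most D |B| <= (D / t) times the integral of g over B,
    and the selected integrals add up to at most the whole. *)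
Lemma hlmax_weak_type : exists2 C : R, (0 < C)%R & forall g (t : R),
  measurable_fun setT g -> (forall x, 0 <= g x) -> (0 < t)%R ->
  mu [set x | t%:E < hlmax g x] <= (C / t)%:E * \int[mu]_x g x.
Proof.
have [c c0 vit] := vitali_finite hrho.
have [D D0 dbl] := hball_doubling hrho c0.
exists D => // g t mg g0 t0.
(* One ball of large average is chosen for each rational box that fits into such a ball. These
   countably many balls already exhaust the superlevel set. *)
pose good k b := [/\ (0 < b.2)%R, t%:E < ball_avg g b & box (rat_box k) `<=` ball_of b].
pose P k (o : option (V * R)) := if o is Some b then good k b else ~ exists b, good k b.
have /choice[F FP] : forall k, exists o, P k o.
  move=> k; have [[b gb]|nb] := pselect (exists b, good k b); first by exists (Some b).
  by exists None.
pose W k : set T := if F k is Some b then ball_of b else set0.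
have mW k : measurable (W k).
  by rewrite /W; case: (F k) => [b|]; [exact: measurable_ball_of|exact: measurable0].
have -> : [set x | t%:E < hlmax g x] = \bigcup_N \big[setU/set0]_(k < N.+1) W k.
  rewrite bigcup_bigsetU_bigcup; apply/seteqP; split => x /=.
    move=> /hlmax_gtP[b [b0 bx tb]].
    have [k [kx kb]] := @rat_box_nbhs _ _ x (ball_of b) (open_nbhs_nbhs (conj (@open_hball _ _ _ _ hrho _ _) bx)).
    exists k => //; rewrite /W; have := FP k; case: (F k) => [b'|] /=; first by move=> [_ _]; apply.
    by case; exists b.
  move=> [k _]; rewrite /W; have := FP k; case: (F k) => [b'|]//= [b0 tb _] b'x.
  by apply/hlmax_gtP; exists b'.
(* Continuity from below reduces the countable union to finite ones, to which the finite Vitali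
   lemma applies. *)
have cvg : mu (\big[setU/set0]_(k < N.+1) W k) @[N --> \oo] -->
    mu (\bigcup_N \big[setU/set0]_(k < N.+1) W k).
  apply: nondecreasing_cvg_mu.
  - by move=> N; exact: bigsetU_measurable.
  - by apply: bigcup_measurable => N _; exact: bigsetU_measurable.
  - by move=> N M NM; apply/subsetPset; exact: subset_bigsetU.
rewrite -(cvg_lim _ cvg)//; apply: lime_le; first by apply/cvg_ex; eexists; exact: cvg.
apply: nearW => N.
pose s := pmap F (iota 0 N.+1).
have sP b : b \in s -> (0 < b.2)%R /\ t%:E < ball_avg g b.
  rewrite mem_pmap => /mapP[k _ /esym Fk].
  by have := FP k; rewrite Fk /= => -[].
have [|s' [s's s'c s'g]] := vit s; first by move=> b /sP[].
apply: (@le_trans _ _ (\sum_(b <- s') lebesgue_outer R n (hball G rho b.1 (c * b.2)%R))).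
  apply: outer_le_sum => x; rewrite -bigcup_mkord => -[k /= kN]; rewrite /W.
  case Fk : (F k) => [b|]// bx; have [|b' b's' bb'] := s'c b.
    by rewrite mem_pmap; apply/mapP; exists k; rewrite ?mem_iota.
  by exists b' => //; exact: bb'.
apply: (@le_trans _ _ (\sum_(b <- s') (D / t)%:E * \int[mu]_(x in ball_of b) g x)).
  rewrite big_seq [leRHS]big_seq; apply: lee_sum => b /s's/sP[b0 tb].
  apply: (le_trans (dbl _ _ b0)); rewrite EFinM -muleA lee_pmul2l//.
  rewrite lee_pdivlMl// -/(ball_of b) hball_of_volE// muleC.
  by move: tb; rewrite /ball_avg lte_pdivlMl ?vol_gt0// => /ltW.
rewrite -ge0_sume_distrr; last by move=> b _; exact: integral_ge0.
rewrite lee_wpmul2l//; first by rewrite lee_fin divr_ge0 ?ltW.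
exact: s'g.
Qed.

Lemma ball_of_center x r : (0 < r)%R -> ball_of (x, r) x.
Proof. by rewrite /hball_of hballE (distxx hrho). Qed.

Lemma hlmax_L2 : exists2 C : R, (0 < C)%R & forall (g : T -> R),
  measurable_fun setT g -> (forall y, (0 <= g y)%R) ->
  \int[mu]_x (hlmax (EFin \o g) x * hlmax (EFin \o g) x) <=
  C%:E * \int[mu]_x (g x * g x)%:E.
Proof.
have [C C0 weak] := hlmax_weak_type.
(* The weak type bound is used at height s/2 for the part of [g] above s/2, which doubles C. *)
exists (16 * (C * 2))%R; first by rewrite !mulr_gt0.
move=> g mg g0; apply: weak_type_L2.
- by rewrite mulr_gt0.
- exact: measurable_hlmax.
- by move=> x; apply: hlmax_ge0 => [|y]; [exact: ball_of_center|rewrite /= lee_fin].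
- exact: mg.
- exact: g0.
move=> s s0; apply: (@le_trans _ _ (mu [set x | (s / 2)%:E < hlmax (EFin \o above g (s / 2)) x])).
  apply: le_outer_measure => x; apply: hlmax_superlevel => //.
  - exact: measurable_ball_of.
  - exact: hball_of_volE.
  - exact: vol_gt0.
rewrite (_ : C * 2 / s = C / (s / 2))%R; last by rewrite invf_div mulrA.
apply: weak; last by rewrite divr_gt0.
  by apply/measurable_EFinP; exact: measurable_above.
by move=> y; rewrite lee_fin above_ge0.
Qed.

End maximal_function.

(** * Variable exponents *)

Section variable_modular.
Context d {T : measurableType d} {R : realType} (mu : {measure set T -> \bar R}).
Local Open Scope ereal_scope.
Implicit Types (p : T -> R) (f g : T -> \bar R).

Definition vmod p f (eta : R) : \bar R := \int[mu]_x (`|f x| * eta^-1%:E) `^ p x.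

Definition vnorm p f : \bar R :=
  ereal_inf [set eta%:E | eta in [set eta | (0 < eta)%R /\ vmod p f eta <= 1]].

Lemma vmod_mono p f g (eta zeta : R) : (forall x, (0 <= p x)%R) -> (0 < eta)%R -> (0 < zeta)%R ->
  {ae mu, forall x, `|f x| * eta^-1%:E <= `|g x| * zeta^-1%:E} ->
  vmod p f eta <= vmod p g zeta.
Proof.
move=> p0 eta0 zeta0 fg; apply: ae_le_integral_ge0.
- by move=> x; exact: poweR_ge0.
- by move=> x; exact: poweR_ge0.
apply: filterS fg => x fgx; apply: gt0_ler_poweR => //; rewrite in_itv/= leey andbT.
  by rewrite mule_ge0// lee_fin invr_ge0 ltW.
by rewrite mule_ge0// lee_fin invr_ge0 ltW.
Qed.

Lemma vnorm_ge0 p f : 0 <= vnorm p f.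
Proof. by apply: le_ereal_inf_tmp => _ [eta [eta0 _] <-]; rewrite lee_fin ltW. Qed.

Lemma vnorm_le p f (eta : R) : (0 < eta)%R -> vmod p f eta <= 1 -> vnorm p f <= eta%:E.
Proof. by move=> eta0 h; apply: ereal_inf_lbound; exists eta. Qed.

(** The strict inequality provides an admissible parameter below [eta], without appeal to attainment
    of the infimum. This is the source of the enlarged constants, such as C + 1 or 2 C0, in what
    follows. *)
Lemma vnorm_lt p f (eta : R) : (forall x, (0 <= p x)%R) -> vnorm p f < eta%:E ->
  vmod p f eta <= 1.
Proof.
move=> p0 /ereal_inf_lt[_ [z [z0 zf] <-]]; rewrite lte_fin => ze.
apply: le_trans zf; apply: vmod_mono => //; first exact: lt_trans ze.
apply: aeW => x; rewrite lee_wpmul2l// lee_fin lef_pV2 ?posrE ?ltW//.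
exact: lt_trans ze.
Qed.

Lemma measurable_powR_fun (F e : T -> R) : measurable_fun setT F -> measurable_fun setT e ->
  (forall x, (0 < e x)%R) -> measurable_fun setT (fun x => F x `^ e x)%R.
Proof.
move=> mF me e0.
have -> : (fun x => F x `^ e x)%R = (fun x => expR (e x * ln (F x)) * \1_(F @^-1` [set~ 0]) x)%R.
  apply/funext => x; rewrite /powR (gt_eqF (e0 x)) indicE.
  case: eqVneq => Fx; first by rewrite memNset ?mulr0//= => /(_ Fx).
  by rewrite mem_set ?mulr1//=; exact/eqP.
apply: measurable_funM.
  apply: measurableT_comp => //; apply: measurable_funM => //.
  exact: measurableT_comp.
apply: measurable_indic; rewrite -[X in measurable X]setTI; apply: mF => //.
exact: measurableC.
Qed.

Lemma young_powR (t x y : R) : (0 < t < 1)%R -> (0 <= x)%R -> (0 <= y)%R ->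
  (x `^ (1 - t) * y `^ t <= (1 - t) * x + t * y)%R.
Proof.
move=> /andP[t0 t1] x0 y0; have t1' : (0 < 1 - t)%R by rewrite subr_gt0.
have := @conjugate_powR R (x `^ (1 - t))%R (y `^ t)%R (1 - t)^-1%R t^-1%R (powR_ge0 _ _) (powR_ge0 _ _).
rewrite !invr_gt0 !invrK => /(_ t1' t0); rewrite subrK => /(_ erefl).
by rewrite -!powRrM !mulfV ?gt_eqF// !powRr1// (mulrC x) (mulrC y).
Qed.

Lemma vmod_EFin (h : T -> R) x (eta e : R) :
  (`|(EFin \o h) x| * eta^-1%:E) `^ e = ((`|h x| / eta) `^ e)%R%:E.
Proof. by []. Qed.

Lemma vmod_indic_le p (A : set T) (z v : R) : measurable A -> (forall x, (1 < p x)%R) ->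
  mu A = v%:E -> (1 <= z)%R -> (v <= z)%R -> vmod p (EFin \o \1_A) z <= 1.
Proof.
move=> mA p1 muA z1 vz; have z0 : (0 < z)%R by exact: lt_le_trans z1.
apply: (@le_trans _ _ (\int[mu]_x (z^-1 * \1_A x)%:E)).
  apply: ae_le_integral_ge0 => [x|x|]; first exact: poweR_ge0.
    by rewrite lee_fin mulr_ge0// invr_ge0 ltW.
  apply: aeW => x; rewrite vmod_EFin lee_fin ger0_norm// indicE.
  case: (x \in A); rewrite ?mul1r ?mulr1 ?mul0r ?mulr0.
    apply: ge1r_powR; last exact/ltW/p1.
    by rewrite invr_gt0 z0 invf_le1.
  by rewrite powR0// gt_eqF// (lt_trans ltr01).
rewrite (integralZl_indic measurableT (fun=> A))//; last by rewrite ltNge invr_ge0 ltW.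
by rewrite integral_indic// setIT muA -EFinM lee_fin mulrC ler_pdivrMr// mul1r.
Qed.

Lemma vmod_indic_ge p (A : set T) (z v : R) : measurable A -> (forall x, (1 < p x)%R) ->
  mu A = v%:E -> (0 < z)%R -> vmod p (EFin \o \1_A) z <= 1 -> (Num.min 1 v <= z)%R.
Proof.
move=> mA p1 muA z0; apply: contraTT; rewrite -ltNge -ltNge lt_min => /andP[z1 zv].
apply: (@lt_le_trans _ _ (\int[mu]_x (z^-1 * \1_A x)%:E)).
  rewrite (integralZl_indic measurableT (fun=> A))//; last by rewrite ltNge invr_ge0 ltW.
  by rewrite integral_indic// setIT muA -EFinM lte_fin mulrC ltr_pdivlMr// mul1r.
apply: ae_le_integral_ge0 => [x|x|]; last 2 first.
- exact: poweR_ge0.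
- apply: aeW => x; rewrite vmod_EFin lee_fin ger0_norm// indicE.
  case: (x \in A); rewrite ?mul1r ?mulr1 ?mul0r ?mulr0 ?powR_ge0//.
  apply: le1r_powR; last exact/ltW/p1.
  by rewrite invf_ge1// ltW.
by rewrite lee_fin mulr_ge0// invr_ge0 ltW.
Qed.

(** The norm lies between min(1, v) and max(1, v), because p > 1 puts z^-p below 1/z for z >= 1 and
    above it for z < 1. *)
Lemma vnorm_indic p (A : set T) (v : R) : measurable A -> (forall x, (1 < p x)%R) ->
  mu A = v%:E -> (0 < v)%R -> exists2 N : R, (0 < N)%R & vnorm p (EFin \o \1_A) = N%:E.
Proof.
move=> mA p1 muA v0.
have h1 : (Num.min 1 v)%:E <= vnorm p (EFin \o \1_A).
  apply: le_ereal_inf_tmp => _ [z [z0 hz] <-]; rewrite lee_fin.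
  exact: vmod_indic_ge hz.
have h2 : vnorm p (EFin \o \1_A) <= (Num.max 1 v)%:E.
  apply: vnorm_le; first by rewrite lt_max ltr01.
  by apply: (vmod_indic_le mA p1 muA); rewrite le_max lexx ?orbT.
have fN : vnorm p (EFin \o \1_A) \is a fin_num.
  by rewrite ge0_fin_numE ?vnorm_ge0// (le_lt_trans h2)// ltry.
exists (fine (vnorm p (EFin \o \1_A))); last by rewrite fineK.
rewrite -lte_fin fineK//; apply: lt_le_trans h1.
by rewrite lte_fin lt_min ltr01.
Qed.

End variable_modular.

Section variable_exponent_averages.
Context d {T : measurableType d} {R : realType} (mu : {measure set T -> \bar R}).
Variable B : T * R -> set T.
Local Notation vol := (vol mu B).
Local Notation ball_avg := (ball_avg mu B).
Local Notation hlmax := (hlmax mu B).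
Hypothesis mB : forall b, measurable (B b).
Hypothesis volE : forall b, (0 < b.2) -> mu (B b) = (vol b)%:E.
Hypothesis vol_gt0 : forall b, 0 < b.2 -> 0 < vol b.
Hypothesis B_center : forall x r, 0 < r -> B (x, r) x.
Local Open Scope ereal_scope.
Implicit Types (p : T -> R) (h : T -> R) (b : T * R).

Definition bounded_maximal p := exists2 C : R, (0 < C)%R & forall f : T -> R,
  measurable_fun setT f -> (exists2 eta : R, (0 < eta)%R & vmod mu p (EFin \o f) eta < +oo) ->
  vnorm mu p (hlmax (fun y => `|f y|%:E)) <= C%:E * vnorm mu p (EFin \o f).

Lemma bounded_maximal_vmod p : (forall x, (1 < p x)%R) -> bounded_maximal p ->
  exists2 C : R, (0 < C)%R & forall (f : T -> R) (eta : R), measurable_fun setT f ->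
  (0 < eta)%R -> vmod mu p (EFin \o f) eta <= 1 ->
  vmod mu p (hlmax (fun y => `|f y|%:E)) (C * eta) <= 1.
Proof.
move=> p1 [C C0 CP]; have C1 : (0 < C + 1)%R by lra.
exists (C + 1)%R => // f eta mf eta0 fe; apply: vnorm_lt.
  by move=> x; apply: ltW; exact: lt_trans (p1 x).
apply: (le_lt_trans (CP f mf _)); first by exists eta => //; rewrite (le_lt_trans fe)// ltry.
apply: (@le_lt_trans _ _ (C * eta)%:E).
  by rewrite EFinM lee_wpmul2l ?vnorm_le// lee_fin ltW.
by rewrite lte_fin ltr_pM2r//; lra.
Qed.

(** The role of Hoelder's inequality with the conjugate exponent is taken by the maximal operator:
    on all of B it dominates the average of [h] over B. An average above C A would make the norm of
    the indicator of B strictly less than itself. *)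
Lemma bounded_maximal_avg p : (forall x, (1 < p x)%R) -> bounded_maximal p ->
  exists2 C : R, (0 < C)%R & forall b h (A : R), (0 < b.2)%R -> measurable_fun setT h ->
  (forall x, (0 <= h x)%R) -> (0 < A)%R ->
  (forall zeta : R, (0 < zeta)%R -> vmod mu p (EFin \o \1_(B b)) zeta <= 1 ->
     vmod mu p (EFin \o h) (A * zeta) <= 1) ->
  \int[mu]_(x in B b) (h x)%:E <= (C * A * vol b)%:E.
Proof.
move=> p1 bp; have p0 x : (0 <= p x)%R by apply: ltW; exact: lt_trans (p1 x).
have [C C0 CP] := bounded_maximal_vmod p1 bp.
exists C => // b h A b0 mh h0 A0 hA; have v0 := vol_gt0 b0.
rewrite mulrC EFinM -lee_pdivrMl// leNgt; apply/negP => ltavg.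
have CA0 : (0 < C * A)%R by rewrite mulr_gt0.
(* A real number between C A and the average, which may be infinite. *)
have [a CAa aavg] : exists2 a : R, (C * A < a)%R & a%:E <= ball_avg (EFin \o h) b.
  rewrite /ball_avg; case: (_ * _) ltavg => [a| |]//; first by rewrite lte_fin => ?; exists a.
  by move=> _; exists (C * A + 1)%R; rewrite ?leey// ltrDl.
have a0 : (0 < a)%R by exact: lt_trans CAa.
have [N N0 NE] := vnorm_indic (mB b) p1 (volE b0) v0.
(* If z is admissible for the indicator, then C A z is admissible for the maximal function of [h],
   which is at least [a] on B; so (C A / a) z is admissible for the indicator as well, and z >= (a /
   (C A)) N. *)
have : (a / (C * A) * N)%:E <= vnorm mu p (EFin \o \1_(B b)).
  apply: le_ereal_inf_tmp => _ [z [z0 hz] <-].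
  rewrite lee_fin -ler_pdivlMl ?divr_gt0// invf_div.
  rewrite -lee_fin -NE; apply: vnorm_le; first by rewrite mulr_gt0// divr_gt0.
  have := CP h _ mh (mulr_gt0 A0 z0) (hA _ z0 hz); apply: le_trans.
  apply: vmod_mono => //; [by rewrite mulr_gt0// divr_gt0|by rewrite !mulr_gt0|].
  have hlE : (fun y => `|h y|%:E) = EFin \o h by apply/funext => y /=; rewrite ger0_norm.
  apply: aeW => x; rewrite hlE /= indicE; case: (boolP (x \in B b)) => xB; last first.
    by rewrite normr0 mul0e mule_ge0// lee_fin invr_ge0 ltW// !mulr_gt0.
  rewrite normr1 mul1e; apply: (@le_trans _ _ (a%:E * ((C * (A * z))^-1)%:E)).
    rewrite -EFinM lee_fin le_eqVlt; apply/orP; left; apply/eqP; field.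
    by rewrite !lt0r_neq0.
  rewrite lee_wpmul2r//; first by rewrite lee_fin invr_ge0 ltW// !mulr_gt0.
  apply: (le_trans aavg); apply: (le_trans _ (lee_abs _)).
  by apply: hlmax_ge => //; rewrite inE in xB.
rewrite NE lee_fin leNgt => /negP; apply.
by rewrite ltr_pMl// ltr_pdivlMr// mul1r.
Qed.

Lemma powR_inv (z a : R) : (0 <= z)%R -> (z^-1 `^ a = (z `^ a)^-1)%R.
Proof. by move=> z0; rewrite -powRN -powR_inv1// -powRrM mulN1r. Qed.

(** * Interpolation between the exponents p, q and s *)

Section sobolev_exponents.
Variables (theta : R) (p q s : T -> R).
Hypotheses (th0 : (0 < theta)%R) (th1 : (theta < 1)%R).
Hypotheses (p1 : forall x, (1 < p x)%R) (s1 : forall x, (1 < s x)%R).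
Hypothesis qE : forall x, ((q x)^-1 = (p x)^-1 - theta)%R.
Hypothesis sE : forall x, (s x = q x * (1 - theta))%R.
Hypotheses (mp : measurable_fun setT p) (ms : measurable_fun setT s).

Lemma sobolev_q_gt0 x : (0 < q x)%R.
Proof.
have := s1 x; rewrite sE => h; have : (0 < q x * (1 - theta))%R by exact: lt_trans h.
by rewrite pmulr_lgt0// subr_gt0.
Qed.

Lemma sobolev_pth x : (0 < p x * theta < 1)%R.
Proof.
have p0 : (0 < p x)%R by exact: lt_trans (p1 x).
rewrite mulr_gt0//= mulrC -ltr_pdivlMr// mul1r -subr_gt0 -qE invr_gt0.
exact: sobolev_q_gt0.
Qed.

Lemma sobolev_qE x : (q x * (1 - p x * theta) = p x)%R.
Proof.
have p0 : (0 < p x)%R by exact: lt_trans (p1 x).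
have q0 := sobolev_q_gt0 x.
have -> : (q x * (1 - p x * theta) = q x * p x * ((p x)^-1 - theta))%R.
  by field; exact: lt0r_neq0.
by rewrite -qE mulrAC mulfV ?mul1r// gt_eqF.
Qed.

Lemma sobolev_sE x : (s x * (1 - p x * theta) = p x * (1 - theta))%R.
Proof. by rewrite sE mulrAC sobolev_qE. Qed.

Lemma measurable_sobolev_q : measurable_fun setT q.
Proof.
have -> : q = (fun x => s x * (1 - theta)^-1)%R.
  by apply/funext => x; rewrite sE mulfK// gt_eqF// subr_gt0.
exact: measurable_funM.
Qed.

Lemma measurable_vmod_term (e h : T -> R) (eta : R) : measurable_fun setT h ->
  measurable_fun setT e -> (forall x, (0 < e x)%R) ->
  measurable_fun setT (fun x => (`|h x| / eta) `^ e x)%R.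
Proof.
move=> mh me e0; apply: measurable_powR_fun => //; apply: measurable_funM => //.
exact: measurableT_comp.
Qed.

(** Interpolation of the indicator between L^s and L^1. As s (1 - p theta) = p (1 - theta), Young's
    inequality with weight p theta bounds the p-th power by z^-s + 1/|B|, of integral at most 2; the
    factor 2 in front compensates, since 2^-p <= 1/2. *)
Lemma sobolev_indic (b : T * R) (z : R) : (0 < b.2)%R -> (0 < z)%R ->
  vmod mu s (EFin \o \1_(B b)) z <= 1 ->
  vmod mu p (EFin \o \1_(B b)) (2 * (z `^ (1 - theta) * vol b `^ theta)) <= 1.
Proof.
move=> b0 z0 hz; have v0 := vol_gt0 b0; set v := vol b in v0 *.
have s0 x : (0 < s x)%R by exact: lt_trans (s1 x).
have zt : (0 < z `^ (1 - theta))%R by exact: powR_gt0.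
have vt : (0 < v `^ theta)%R by exact: powR_gt0.
apply: (@le_trans _ _ (\int[mu]_x (2^-1%:E * ((`|\1_(B b) x| / z) `^ s x + v^-1 * \1_(B b) x)%R%:E))).
  apply: ae_le_integral_ge0.
  - by move=> x; exact: poweR_ge0.
  - by move=> x; rewrite mule_ge0// lee_fin addr_ge0 ?powR_ge0// mulr_ge0// invr_ge0 ltW.
  apply: aeW => x; rewrite vmod_EFin -EFinM lee_fin indicE.
  have p0 : (0 < p x)%R by exact: lt_trans (p1 x).
  have /andP[pt0 pt1] := sobolev_pth x.
  case: (x \in B b); last first.
    by rewrite normr0 !mul0r !mulr0 !powR0 ?gt_eqF// addr0 mulr0.
  rewrite normr1 !mul1r mulr1 invfM powRM; last 2 first.
  - by rewrite invr_ge0.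
  - by rewrite invr_ge0 ltW// mulr_gt0.
  apply: ler_pM; rewrite ?powR_ge0//.
    by apply: ge1r_powR; [rewrite invr_gt0 ltr0n invf_le1 ?ltr0n// ler1n|exact/ltW/p1].
  rewrite invfM -!powR_inv ?(ltW z0) ?(ltW v0)// powRM ?powR_ge0//.
  have := @young_powR R (p x * theta) (z^-1 `^ s x)%R v^-1%R.
  rewrite pt0 pt1 powR_ge0 invr_ge0 (ltW v0) => /(_ erefl erefl erefl).
  rewrite -!powRrM sobolev_sE [((1 - theta) * p x)%R]mulrC [(theta * p x)%R]mulrC => h.
  apply: (le_trans h); apply: lerD.
    by rewrite ler_piMl ?powR_ge0//; lra.
  by rewrite ler_piMl ?invr_ge0 ?(ltW v0)// ltW.
rewrite ge0_integralZl//; last 2 first.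
- apply/measurable_EFinP; apply: measurable_funD.
    by apply: measurable_vmod_term => //; exact: measurable_indic.
  by apply: measurable_funM => //; exact: measurable_indic.
- by move=> x _; rewrite lee_fin addr_ge0 ?powR_ge0// mulr_ge0// invr_ge0 ltW.
rewrite lee_pdivrMl// mule1.
under eq_integral do rewrite EFinD.
rewrite ge0_integralD//; last 4 first.
- by move=> x _; rewrite lee_fin powR_ge0.
- by apply/measurable_EFinP; apply: measurable_vmod_term => //; exact: measurable_indic.
- by move=> x _; rewrite lee_fin mulr_ge0// invr_ge0 ltW.
- by apply/measurable_EFinP; apply: measurable_funM => //; exact: measurable_indic.
rewrite (_ : 2%:E = 1 + 1); last by rewrite -EFinD.
apply: leeD; first exact: hz.
rewrite (integralZl_indic measurableT (fun=> B b))//; last by rewrite ltNge invr_ge0 ltW.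
by rewrite integral_indic// setIT volE// -EFinM lee_fin mulVf// gt_eqF.
Qed.

(** Hoelder's inequality for 1/s = 1/q + theta/s, from Young's inequality with weights 1 - theta and
    theta; these sum to 1, so no constant appears. *)
Lemma sobolev_interpolation (b : T * R) (h : T -> R) (eta z : R) : (0 < b.2)%R ->
  (0 < eta)%R -> (0 < z)%R -> measurable_fun setT h -> (forall x, ~ B b x -> h x = 0%R) ->
  vmod mu q (EFin \o h) eta <= 1 -> vmod mu s (EFin \o \1_(B b)) z <= 1 ->
  vmod mu s (EFin \o h) (eta * z `^ theta) <= 1.
Proof.
move=> b0 eta0 z0 mh hB hq hs.
have s0 x : (0 < s x)%R by exact: lt_trans (s1 x).
have q0 := sobolev_q_gt0; have zt : (0 < z `^ theta)%R by exact: powR_gt0.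
apply: (@le_trans _ _ (\int[mu]_x ((1 - theta)%:E * ((`|h x| / eta) `^ q x)%R%:E
    + theta%:E * ((`|\1_(B b) x| / z) `^ s x)%R%:E))).
  apply: ae_le_integral_ge0.
  - by move=> x; exact: poweR_ge0.
  - by move=> x; rewrite -!EFinM -EFinD lee_fin addr_ge0// mulr_ge0 ?powR_ge0// ltW// subr_gt0.
  apply: aeW => x; rewrite vmod_EFin -!EFinM -EFinD lee_fin indicE.
  case: (boolP (x \in B b)) => xB; last first.
    rewrite hB; last by move/negP: xB; rewrite inE.
    by rewrite normr0 !mul0r !powR0 ?gt_eqF// !mulr0 addr0.
  rewrite normr1 invfM mulrA powRM; last 2 first.
  - by rewrite divr_ge0// ltW.
  - by rewrite invr_ge0 ltW.
  have := @young_powR R theta ((`|h x| / eta) `^ q x)%R ((1 / z) `^ s x)%R.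
  rewrite th0 th1 !powR_ge0 => /(_ erefl erefl erefl); apply: le_trans.
  rewrite -powRrM -sE ler_wpM2l ?powR_ge0// div1r.
  by rewrite -powR_inv ?(ltW z0)// -!powRrM mulrC.
rewrite ge0_integralD//; last 4 first.
- by move=> x _; rewrite -EFinM lee_fin mulr_ge0 ?powR_ge0// ltW// subr_gt0.
- apply: measurable_funeM; apply/measurable_EFinP.
  by apply: measurable_vmod_term => //; exact: measurable_sobolev_q.
- by move=> x _; rewrite -EFinM lee_fin mulr_ge0 ?powR_ge0// ltW.
- apply: measurable_funeM; apply/measurable_EFinP.
  by apply: measurable_vmod_term => //; exact: measurable_indic.
rewrite !ge0_integralZl//; last 6 first.
- by apply/measurable_EFinP; apply: measurable_vmod_term => //; exact: measurable_indic.
- by move=> x _; rewrite lee_fin powR_ge0.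
- by rewrite lee_fin ltW.
- by apply/measurable_EFinP; apply: measurable_vmod_term => //; exact: measurable_sobolev_q.
- by move=> x _; rewrite lee_fin powR_ge0.
- by rewrite lee_fin ltW// subr_gt0.
apply: (@le_trans _ _ ((1 - theta)%:E * 1 + theta%:E * 1)).
  by apply: leeD; rewrite lee_wpmul2l// lee_fin ltW// subr_gt0.
by rewrite !mule1 -EFinD subrK.
Qed.

End sobolev_exponents.

End variable_exponent_averages.

(** * Fractional averages and the commutator *)

Section fractional_averages.
Context d {T : measurableType d} {R : realType} (mu : {measure set T -> \bar R}).
Variable B : T * R -> set T.
Local Notation vol := (vol mu B).
Local Notation hlmax := (hlmax mu B).
Hypothesis mB : forall b, measurable (B b).
Hypothesis volE : forall b, (0 < b.2) -> mu (B b) = (vol b)%:E.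
Hypothesis vol_gt0 : forall b, 0 < b.2 -> 0 < vol b.
Hypothesis B_center : forall x r, 0 < r -> B (x, r) x.
Local Open Scope ereal_scope.
Implicit Types (a : R) (g : T -> \bar R) (f h : T -> R) (b c : T * R) (x y : T).

(** The parameter [a] stands for alpha/Q. *)
Definition favg a g b : \bar R := (vol b `^ (a - 1))%R%:E * \int[mu]_(x in B b) g x.

Definition fmax a g x : \bar R :=
  ereal_sup [set favg a g b | b in [set b | (0 < b.2)%R /\ B b x]].

Definition local_fmax a (c : T * R) g x : \bar R :=
  ereal_sup [set favg a g b | b in [set b | [/\ (0 < b.2)%R, B b x & B b `<=` B c]]].

Definition commutator a (u f : T -> R) x : \bar R :=
  (u x)%:E * fmax a (fun y => `|f y|%:E) x - fmax a (fun y => `|u y * f y|%:E) x.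

Lemma favg_ge0 a g b : (forall x, 0 <= g x) -> 0 <= favg a g b.
Proof. by move=> g0; rewrite mule_ge0 ?integral_ge0// lee_fin powR_ge0. Qed.

Lemma fmax_ge a g b x : (0 < b.2)%R -> B b x -> favg a g b <= fmax a g x.
Proof. by move=> b0 bx; apply: ereal_sup_ubound; exists b. Qed.

Lemma fmax_le a g x (M : \bar R) :
  (forall b, (0 < b.2)%R -> B b x -> favg a g b <= M) -> fmax a g x <= M.
Proof. by move=> h; apply: ge_ereal_sup => _ [b [b0 bx] <-]; exact: h. Qed.

Lemma fmax_ge0 a g x : (forall x, 0 <= g x) -> 0 <= fmax a g x.
Proof.
move=> g0; apply: (@le_trans _ _ (favg a g (x, 1%R))); first exact: favg_ge0.
by apply: fmax_ge => //; exact: B_center.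
Qed.

Lemma vol_le b c : (0 < b.2)%R -> (0 < c.2)%R -> B b `<=` B c -> (vol b <= vol c)%R.
Proof.
by move=> b0 c0 bc; rewrite -lee_fin -!volE//; apply: le_measure; rewrite ?inE.
Qed.

Lemma powRD_gt0 (v r s : R) : (0 < v)%R -> (v `^ (r + s) = v `^ r * v `^ s)%R.
Proof. by move=> v0; rewrite powRD// (gt_eqF v0) implybT. Qed.

Lemma vol_powRS b a : (0 < b.2)%R -> (vol b `^ (a - 1) * vol b = vol b `^ a)%R.
Proof.
move=> b0; have v0 := vol_gt0 b0.
by rewrite -{2}(powRr1 (ltW v0)) -powRD_gt0// subrK.
Qed.

(** B itself attains the supremum. A ball of smaller volume v yields at most v^a; for a larger one
    v^(a-1) is at most |B|^(a-1), and the intersection has measure at most |B|. *)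
Lemma fmax_indic a b x : (0 < a < 1)%R -> (0 < b.2)%R -> B b x ->
  fmax a (fun y => `|\1_(B b) y|%R%:E) x = (vol b `^ a)%:E.
Proof.
move=> /andP[a0 a1] b0 bx; have v0 := vol_gt0 b0.
have intE c : \int[mu]_(y in B c) `|\1_(B b) y|%R%:E = mu (B b `&` B c).
  rewrite -integral_indic//; apply: eq_integral => y _.
  by rewrite ger0_norm.
apply/eqP; rewrite eq_le; apply/andP; split; last first.
  apply: (@le_trans _ _ (favg a (fun y => `|\1_(B b) y|%R%:E) b)); last exact: fmax_ge.
  by rewrite /favg intE setIid volE// -EFinM vol_powRS.
apply: fmax_le => c c0 cx; rewrite /favg intE; have w0 := vol_gt0 c0.
have [cb|/ltW bc] := leP (vol c) (vol b).
  apply: (@le_trans _ _ ((vol c `^ (a - 1))%R%:E * (vol c)%:E)).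
    rewrite lee_wpmul2l// ?lee_fin ?powR_ge0// -volE//.
    by apply: le_measure; rewrite ?inE//; exact: measurableI.
  rewrite -EFinM vol_powRS// lee_fin.
  by apply: ge0_ler_powR => //; rewrite ?nnegrE; exact: ltW.
apply: (@le_trans _ _ ((vol b `^ (a - 1))%R%:E * (vol b)%:E)); last first.
  by rewrite -EFinM vol_powRS.
apply: lee_pmul.
- by rewrite lee_fin powR_ge0.
- exact: measure_ge0.
- rewrite lee_fin -opprB !powRN lef_pV2 ?posrE ?powR_gt0//.
  by apply: ge0_ler_powR => //; rewrite ?nnegrE ?subr_ge0; exact: ltW.
- by rewrite -volE//; apply: le_measure; rewrite ?inE//; exact: measurableI.
Qed.

Variable u : T -> R.
Hypothesis mu_ : measurable_fun setT u.
Hypothesis u_loc : forall b, (0 < b.2)%R -> \int[mu]_(x in B b) `|u x|%:E < +oo.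

Definition abs_mean b : R := ((vol b)^-1 * fine (\int[mu]_(x in B b) `|u x|%:E))%R.

(* The negative part of [u - |u|_B], controlled both by the commutator and by
   the oscillation functional because [|u|_B] bounds from below the maximal
   functions occurring in them. *)
Definition deficit b x : R := (Num.max 0 (abs_mean b - u x) * \1_(B b) x)%R.

Lemma deficit_ge0 b x : (0 <= deficit b x)%R.
Proof. by rewrite mulr_ge0// le_max lexx. Qed.

Lemma measurable_deficit b : measurable_fun setT (deficit b).
Proof.
apply: measurable_funM; last exact: measurable_indic.
by apply: measurable_maxr => //; exact: measurable_funB.
Qed.

Lemma int_abs_fin b : (0 < b.2)%R ->
  \int[mu]_(x in B b) `|u x|%:E = (abs_mean b * vol b)%:E.
Proof.
move=> b0; rewrite /abs_mean mulrC mulVKf ?gt_eqF ?vol_gt0// fineK//.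
by rewrite ge0_fin_numE ?u_loc// integral_ge0.
Qed.

Lemma favg_abs_mean a b : (0 < b.2)%R ->
  favg a (fun y => `|u y|%:E) b = (vol b `^ a * abs_mean b)%:E.
Proof.
move=> b0; rewrite /favg int_abs_fin// -EFinM -(vol_powRS a b0).
by rewrite [(abs_mean b * _)%R]mulrC mulrA.
Qed.

(** On B the commutator of the indicator is |B|^a u - M(u 1_B), and B competes in the supremum, so
    M(u 1_B) >= |B|^a |u|_B. An infinite M(u 1_B) makes the right side infinite. *)
Lemma deficit_le_commutator a b x : (0 < a < 1)%R -> (0 < b.2)%R ->
  (vol b `^ a * deficit b x)%:E <= `|commutator a u \1_(B b) x|.
Proof.
move=> a01 b0; have va : (0 < vol b `^ a)%R by rewrite powR_gt0// vol_gt0.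
rewrite /deficit indicE; case: (boolP (x \in B b)) => [|_]; last by rewrite !mulr0 abse_ge0.
rewrite inE mulr1 => bx; rewrite maxr_pMr ?(ltW va)// mulr0.
case: (leP 0%R (vol b `^ a * (abs_mean b - u x))%R) => [h|_]; last exact: abse_ge0.
rewrite /commutator fmax_indic//.
have hM : (vol b `^ a * abs_mean b)%:E <= fmax a (fun y => `|u y * \1_(B b) y|%R%:E) x.
  rewrite -favg_abs_mean//; apply: le_trans (fmax_ge a _ b0 bx).
  rewrite /favg [in leRHS](eq_integral (fun y => `|u y|%:E))// => y.
  by rewrite inE => yb; rewrite indicE mem_set// mulr1.
case: (fmax _ _ _) hM => [M| |]//.
  rewrite -EFinM -EFinB lee_fin => hM; rewrite abse_EFin lee_fin distrC.
  by apply: (le_trans _ (ler_norm _)); rewrite mulrBr lerB// mulrC.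
by move=> _; rewrite /= leey.
Qed.

Lemma deficit_le_oscillation a b x : (0 < b.2)%R ->
  (deficit b x)%:E <= `|((u x)%:E - (vol b `^ a)^-1%:E *
     local_fmax a b (fun y => `|u y|%:E) x) * (\1_(B b) x)%:E|.
Proof.
move=> b0; have va : (0 < vol b `^ a)%R by rewrite powR_gt0// vol_gt0.
rewrite /deficit indicE; case: (boolP (x \in B b)) => [|_]; last by rewrite mulr0 abse_ge0.
rewrite inE mulr1 mule1 => bx.
case: (leP 0%R (abs_mean b - u x)%R) => [h|_]; last exact: abse_ge0.
have hM : (abs_mean b)%:E <= (vol b `^ a)^-1%:E * local_fmax a b (fun y => `|u y|%:E) x.
  rewrite lee_pdivlMl// -EFinM -favg_abs_mean//.
  by apply: ereal_sup_ubound; exists b => //; split.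
case: (_ * _) hM => [M| |]//; last by move=> _; rewrite /= leey.
rewrite lee_fin => hM; rewrite -EFinB abse_EFin lee_fin distrC.
by apply: (le_trans _ (ler_norm _)); rewrite lerB.
Qed.

Section exponents.
Variables (s : T -> R) (e : R).
Hypotheses (s1 : forall x, (1 < s x)%R) (bs : bounded_maximal mu B s).

Lemma deficit_avg (C0 : R) : (0 < C0)%R ->
  (forall b (z : R), (0 < b.2)%R -> (0 < z)%R -> vmod mu s (EFin \o \1_(B b)) z <= 1 ->
     vmod mu s (EFin \o deficit b) (C0 * vol b `^ e * z) <= 1) ->
  exists2 C : R, (0 < C)%R & forall b, (0 < b.2)%R ->
    \int[mu]_(x in B b) (deficit b x)%:E <= (C * vol b `^ e * vol b)%:E.
Proof.
move=> C00 h; have [C C_gt0 CP] := bounded_maximal_avg mB volE vol_gt0 s1 bs.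
exists (C * C0)%R; first exact: mulr_gt0.
move=> b b0; rewrite -(mulrA C); apply: CP.
- exact: b0.
- exact: measurable_deficit.
- by move=> x; exact: deficit_ge0.
- by rewrite mulr_gt0// powR_gt0 ?vol_gt0.
by move=> z z0 hz; exact: h.
Qed.

Lemma deficit_avg_oscillation (a C0 : R) : (0 < C0)%R ->
  (forall b, (0 < b.2)%R -> vnorm mu s (fun x => ((u x)%:E - (vol b `^ a)^-1%:E *
     local_fmax a b (fun y => `|u y|%:E) x) * (\1_(B b) x)%:E) <=
     (C0 * vol b `^ e)%:E * vnorm mu s (EFin \o \1_(B b))) ->
  exists2 C : R, (0 < C)%R & forall b, (0 < b.2)%R ->
    \int[mu]_(x in B b) (deficit b x)%:E <= (C * vol b `^ e * vol b)%:E.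
Proof.
move=> C00 h; apply: (@deficit_avg (2 * C0)); first by rewrite mulr_gt0.
move=> b z b0 z0 hz; have ve : (0 < vol b `^ e)%R by rewrite powR_gt0// vol_gt0.
have s0 x : (0 <= s x)%R by apply: ltW; exact: lt_trans (s1 x).
have Cz : (0 < C0 * vol b `^ e * z)%R by rewrite !mulr_gt0.
have := h b b0; move/le_lt_trans => /(_ (2 * C0 * vol b `^ e * z)%:E).
have -> : (C0 * vol b `^ e)%:E * vnorm mu s (EFin \o \1_(B b)) < (2 * C0 * vol b `^ e * z)%:E.
  apply: (@le_lt_trans _ _ (C0 * vol b `^ e * z)%:E).
    by rewrite [leRHS]EFinM lee_wpmul2l ?vnorm_le// lee_fin mulr_ge0// ltW.
  rewrite lte_fin; lra.
move=> /(_ erefl)/(vnorm_lt s0); apply: le_trans; apply: vmod_mono => //.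
- by rewrite !mulr_gt0.
- by rewrite !mulr_gt0.
apply: aeW => x; rewrite lee_wpmul2r//; first by rewrite lee_fin invr_ge0 ltW// !mulr_gt0.
rewrite [X in X <= _](_ : _ = (deficit b x)%:E); last by rewrite /= ger0_norm// deficit_ge0.
exact: deficit_le_oscillation.
Qed.

(** For z admissible for the indicator of B in L^s, [sobolev_indic] bounds it in L^p, the commutator
    bound and division by |B|^a bound the deficit in L^q, and [sobolev_interpolation] returns to
    L^s; the powers z^(1 - theta) and z^theta recombine to z. The factor 4 is 2 from [sobolev_indic]
    times 2 for strictness. *)
Lemma deficit_avg_commutator (a C0 : R) (p q : T -> R) : (0 < C0)%R ->
  (0 < a < 1)%R -> (0 < e)%R -> (a + e < 1)%R ->
  (forall x, (1 < p x)%R) -> measurable_fun setT p -> measurable_fun setT s ->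
  (forall x, ((q x)^-1 = (p x)^-1 - (a + e))%R) ->
  (forall x, (s x = q x * (1 - (a + e)))%R) ->
  (forall f : T -> R, measurable_fun setT f ->
     (exists2 eta : R, (0 < eta)%R & vmod mu p (EFin \o f) eta < +oo) ->
     vnorm mu q (commutator a u f) <= C0%:E * vnorm mu p (EFin \o f)) ->
  exists2 C : R, (0 < C)%R & forall b, (0 < b.2)%R ->
    \int[mu]_(x in B b) (deficit b x)%:E <= (C * vol b `^ e * vol b)%:E.
Proof.
move=> C00 a01 e0 ae1 p1 mp ms qE sE h.
have /andP[a0 a1] := a01; set th := (a + e)%R in ae1 qE sE.
have th0 : (0 < th)%R by rewrite addr_gt0.
have q0 := sobolev_q_gt0 ae1 s1 sE.
apply: (@deficit_avg (4 * C0)); first by rewrite mulr_gt0.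
move=> b z b0 z0 hz; have v0 := vol_gt0 b0.
have ve : (0 < vol b `^ e)%R by rewrite powR_gt0.
have hp := sobolev_indic mB volE vol_gt0 th0 ae1 p1 s1 qE sE ms b0 z0 hz.
set eta := (2 * (z `^ (1 - th) * vol b `^ th))%R in hp.
have eta0 : (0 < eta)%R by rewrite !mulr_gt0// powR_gt0.
have mI : measurable_fun setT (\1_(B b) : T -> R) by exact: measurable_indic.
have hq : vmod mu q (commutator a u \1_(B b)) (2 * C0 * eta) <= 1.
  apply: vnorm_lt; first by move=> x; exact/ltW/q0.
  apply: (le_lt_trans (h _ mI _)); first by exists eta => //; rewrite (le_lt_trans hp)// ltry.
  apply: (@le_lt_trans _ _ (C0 * eta)%:E); first by rewrite EFinM lee_wpmul2l ?vnorm_le// lee_fin ltW.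
  by rewrite lte_fin -mulrA; have := mulr_gt0 C00 eta0; lra.
have hd : vmod mu q (EFin \o deficit b) (4 * C0 * (z `^ (1 - th) * vol b `^ e)) <= 1.
  apply: le_trans hq; apply: vmod_mono.
  - by move=> x; exact/ltW/q0.
  - by rewrite !mulr_gt0// powR_gt0.
  - by rewrite mulr_gt0// mulr_gt0.
  apply: aeW => x; have := deficit_le_commutator x a01 b0 => hx.
  have va : (0 < vol b `^ a)%R by rewrite powR_gt0.
  rewrite lee_pdivlMr; last by rewrite mulr_gt0// mulr_gt0.
  apply: le_trans _ hx.
  rewrite /= -!EFinM lee_fin ger0_norm ?deficit_ge0// le_eqVlt; apply/orP; left; apply/eqP.
  rewrite /eta (powRD_gt0 _ _ v0); field.
  by rewrite !lt0r_neq0// powR_gt0.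
rewrite (_ : 4 * C0 * vol b `^ e * z =
   4 * C0 * (z `^ (1 - th) * vol b `^ e) * z `^ th)%R; last first.
  have zE : (z = z `^ (1 - th) * z `^ th)%R.
    by rewrite -powRD_gt0// subrK powRr1// ltW.
  by rewrite {1}zE; ring.
apply: (sobolev_interpolation mB th0 ae1 s1 sE ms b0 _ z0 (measurable_deficit b) _ hd hz).
  by rewrite !mulr_gt0// powR_gt0.
by move=> x nx; rewrite /deficit indicE memNset ?mulr0.
Qed.

End exponents.

End fractional_averages.

(** * Campanato's theorem *)

Section campanato.
Context d {T : measurableType d} {R : realType} (mu : {measure set T -> \bar R}).
Variables (B : T * R -> set T) (dist : T -> T -> R) (K c1 c2 : R) (Q : nat).
Local Notation vol := (vol mu B).
Hypothesis mB : forall b, measurable (B b).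
Hypothesis volE : forall b, (0 < b.2) -> mu (B b) = (vol b)%:E.
Hypothesis vol_gt0 : forall b, 0 < b.2 -> 0 < vol b.
Hypothesis BE : forall b y, B b y = (dist y b.1 < b.2) :> Prop.
Hypotheses (K1 : 1 <= K) (dist_ge0 : forall x y, 0 <= dist x y)
  (dist_sym : forall x y, dist x y = dist y x)
  (dist_tri : forall x y z, dist x z <= K * (dist x y + dist y z))
  (dist_xx : forall x, dist x x = 0) (dist_eq : forall x y, dist x y = 0 -> x = y).
Hypotheses (c10 : 0 < c1) (c20 : 0 < c2) (Q0 : (0 < Q)%N).
Hypothesis vol_ge : forall b, 0 < b.2 -> c1 * b.2 ^+ Q <= vol b.
Hypothesis vol_le_pow : forall b, 0 < b.2 -> vol b <= c2 * b.2 ^+ Q.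
Variable beta : R.
Hypothesis beta0 : 0 < beta.
Local Open Scope ereal_scope.

Lemma vol_powR b : (0 < b.2)%R ->
  (vol b `^ (beta / Q%:R) <= c2 `^ (beta / Q%:R) * b.2 `^ beta)%R.
Proof.
move=> b0; apply: (@le_trans _ _ ((c2 * b.2 ^+ Q) `^ (beta / Q%:R))%R).
  apply: ge0_ler_powR; rewrite ?nnegrE ?vol_le_pow//.
  - by rewrite divr_ge0// ltW.
  - by rewrite ltW// vol_gt0.
  - by rewrite mulr_ge0 ?exprn_ge0// ltW.
rewrite powRM ?exprn_ge0 ?(ltW c20) ?(ltW b0)// -powR_mulrn ?(ltW b0)// -powRrM.
by rewrite mulrCA mulfV ?mulr1 ?lexx// pnatr_eq0 -lt0n.
Qed.

Lemma vol_powR_ge b : (0 < b.2)%R ->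
  (c1 `^ (beta / Q%:R) * b.2 `^ beta <= vol b `^ (beta / Q%:R))%R.
Proof.
move=> b0; apply: (@le_trans _ _ ((c1 * b.2 ^+ Q) `^ (beta / Q%:R))%R); last first.
  apply: ge0_ler_powR; rewrite ?nnegrE ?vol_ge//.
  - by rewrite divr_ge0// ltW.
  - by rewrite mulr_ge0 ?exprn_ge0// ltW.
  - by rewrite ltW// vol_gt0.
rewrite powRM ?exprn_ge0 ?(ltW c10) ?(ltW b0)// -powR_mulrn ?(ltW b0)// -powRrM.
by rewrite mulrCA mulfV ?mulr1 ?lexx// pnatr_eq0 -lt0n.
Qed.

Hypothesis vitali : exists2 c : R, (0 < c)%R & forall s : seq (T * R),
  (forall b, b \in s -> (0 < b.2)%R) -> exists s' : seq (T * R),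
  [/\ {subset s' <= s},
      forall b, b \in s -> exists2 b', b' \in s' & B b `<=` B (b'.1, c * b'.2)%R &
      forall (g : T -> \bar R) (A : set T), measurable_fun setT g -> (forall x, 0 <= g x) ->
        measurable A -> (forall b, b \in s -> B b `<=` A) ->
        \sum_(b <- s') \int[mu]_(x in B b) g x <= \int[mu]_(x in A) g x].
Hypothesis cover : forall x0 r0 r, (0 < r)%R -> exists s : seq (T * R),
  (forall b, b \in s -> b.2 = r /\ (dist x0 b.1 <= r0)%R) /\
  (forall x, (dist x x0 < r0)%R -> exists2 b, b \in s & B b x).
Hypothesis measurable_lipschitz : forall (f : T -> R) (C : R),
  (forall x y, `|f x - f y| <= C * dist x y `^ beta)%R -> measurable_fun setT f.

Lemma integral_le_sum (g : T -> \bar R) (s : seq (T * R)) (F : T * R -> set T) (E : set T) :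
  measurable_fun setT g -> (forall x, 0 <= g x) -> measurable E ->
  (forall b, measurable (F b)) -> (forall x, E x -> exists2 b, b \in s & F b x) ->
  \int[mu]_(x in E) g x <= \sum_(b <- s) \int[mu]_(x in F b) g x.
Proof.
move=> mg g0 + mF; elim: s E => [|b s IH] E mE Es.
  by rewrite big_nil (_ : E = set0) ?integral_set0// -subset0 => x /Es[].
rewrite big_cons.
have mEF : measurable (E `\` F b) by exact: measurableD.
apply: (@le_trans _ _ (\int[mu]_(x in F b `|` (E `\` F b)) g x)).
  apply: ge0_subset_integral => //.
  - exact: measurableU.
  - exact: measurable_funTS.
  - by move=> x Ex; case: (pselect (F b x)) => h; [left|right].
rewrite ge0_integral_setU//; last 2 first.
- exact: measurable_funTS.
- by apply/disj_set2P; rewrite setDIK.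
apply: leeD => //; apply: IH => // x [Ex nF].
by have [c] := Es x Ex; rewrite inE => /predU1P[->//|cs Fc]; exists c.
Qed.

(* Replaces Lebesgue's differentiation theorem: a fixed ball is covered by balls
   of radius [r], and on the dilates of the disjoint ones among them given by
   Vitali's lemma the integrals sum to O(r^beta). *)
Lemma ae_eq0_of_small_averages (g : T -> R) (C : R) :
  measurable_fun setT g -> (forall x, (0 <= g x)%R) -> (0 < C)%R ->
  (forall b, (0 < b.2)%R -> \int[mu]_(x in B b) (g x)%:E <= (C * b.2 `^ beta * vol b)%:E) ->
  {ae mu, forall x, g x = 0%R}.
Proof.
move=> mg g0 C0 hg; have [c c0 vit] := vitali.
pose x0 : T := point.
have mgE : measurable_fun setT (EFin \o g) by exact/measurable_EFinP.
have gE0 x : 0 <= (EFin \o g) x by rewrite lee_fin.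
suff H N : \int[mu]_(x in B (x0, N%:R)) (g x)%:E = 0.
  have hN N : {ae mu, forall x, B (x0, N%:R) x -> g x = 0%R}.
    have := H N; rewrite (eq_integral (fun x => `|(g x)%:E|)); last first.
      by move=> x _; rewrite gee0_abs// lee_fin.
    have mgB : measurable_fun (B (x0, N%:R)) (EFin \o g) by exact: measurable_funTS.
    move=> /(ae_eq_integral_abs mu (mB _) mgB); apply: filterS => x hx /hx.
    by case.
  apply: filterS (ae_foralln hN) => x hx; apply: (hx (Num.bound (dist x x0))).
  by rewrite BE/=; apply: archi_boundP.
have [-> | N0] := eqVneq N 0%N.
  rewrite (_ : B _ = set0) ?integral_set0// -subset0 => x; rewrite BE/=.
  by rewrite ltNge dist_ge0.
have N1 : (0 < N%:R :> R)%R by rewrite ltr0n lt0n.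
apply/eqP; rewrite eq_le; apply/andP; split; last by apply: integral_ge0 => x _; rewrite lee_fin.
(* A ball that contains every ball of radius r <= 1 centred within N of [x0]; its volume bounds the
   total volume of the selected balls. *)
pose big : T * R := (x0, K * (1 + N%:R))%R.
have big0 : (0 < big.2)%R by rewrite mulr_gt0 ?addr_gt0//; exact: lt_le_trans K1.
pose D := (C * c `^ beta * (c2 * c ^+ Q / c1) * vol big)%R.
have D0 : (0 < D)%R by rewrite !mulr_gt0 ?vol_gt0 ?powR_gt0 ?exprn_gt0 ?invr_gt0.
have small (r : R) : (0 < r)%R -> (r <= 1)%R ->
    \int[mu]_(x in B (x0, N%:R)) (g x)%:E <= (D * r `^ beta)%:E.
  move=> r0 r1; have [s [sr scov]] := cover x0 N%:R r0.
  have [|s' [s's s'c s'g]] := vit s; first by move=> b /sr[->].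
  apply: (@le_trans _ _ (\sum_(b <- s') \int[mu]_(x in B (b.1, c * b.2)%R) (g x)%:E)).
    apply: (@integral_le_sum (EFin \o g) s' (fun b => B (b.1, c * b.2)%R)) => //.
    move=> x; rewrite BE/= => /scov[b bs bx]; have [b' b's bb'] := s'c b bs.
    by exists b' => //; exact: bb'.
  apply: (@le_trans _ _ (\sum_(b <- s') (C * c `^ beta * (c2 * c ^+ Q / c1) * r `^ beta)%:E *
       \int[mu]_(x in B b) 1)).
    rewrite big_seq [leRHS]big_seq; apply: lee_sum => b /s's/sr[br _].
    have cb0 : (0 < (b.1, c * b.2)%R.2)%R by rewrite /= br mulr_gt0.
    have b0 : (0 < b.2)%R by rewrite br.
    apply: (le_trans (hg _ cb0)); rewrite integral_cst// mul1e volE// -EFinM lee_fin /= br.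
    rewrite powRM ?(ltW c0) ?(ltW r0)//.
    have h1 : (vol (b.1, c * r) <= c2 * c ^+ Q / c1 * vol b)%R.
      apply: (le_trans (vol_le_pow _)); first by rewrite /= mulr_gt0.
      apply: (@le_trans _ _ (c2 * c ^+ Q / c1 * (c1 * r ^+ Q))%R).
        by rewrite /= exprMn !mulrA divfK// gt_eqF.
      by rewrite ler_wpM2l ?divr_ge0 ?mulr_ge0 ?exprn_ge0 ?(ltW c0) ?(ltW c20) ?(ltW c10)// -br vol_ge.
    apply: (@le_trans _ _ (C * (c `^ beta * r `^ beta) * (c2 * c ^+ Q / c1 * vol b))%R).
      by rewrite ler_wpM2l// !mulr_ge0 ?powR_ge0// ltW.
    by rewrite le_eqVlt; apply/orP; left; apply/eqP; ring.
  rewrite -ge0_sume_distrr; last by move=> b _; exact: integral_ge0.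
  apply: (@le_trans _ _ ((C * c `^ beta * (c2 * c ^+ Q / c1) * r `^ beta)%:E * (vol big)%:E)).
    have e0 : (0 <= C * c `^ beta * (c2 * c ^+ Q / c1) * r `^ beta)%R.
      by rewrite !mulr_ge0 ?powR_ge0 ?exprn_ge0 ?invr_ge0 ?ltW.
    rewrite lee_wpmul2l ?lee_fin// -volE//.
    have := s'g (fun=> 1) (B big); rewrite integral_cst// mul1e; apply => //; move=> b /sr[br x0b] y; rewrite !BE /= br => yb.
      apply: (le_lt_trans (dist_tri y b.1 x0)); rewrite ltr_pM2l ?(lt_le_trans ltr01)//.
      by rewrite (dist_sym b.1) ltr_leD// (lt_le_trans yb).
  by rewrite -EFinM lee_fin /D mulrAC.
apply/lee_addgt0Pr => eps eps0; rewrite add0e.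
(* Chosen so that r <= 1 and D r^beta <= eps. *)
pose r := Num.min 1%R ((eps / D) `^ beta^-1)%R.
have r0 : (0 < r)%R by rewrite lt_min ltr01 powR_gt0// divr_gt0.
apply: (le_trans (small r r0 _)); first by rewrite ge_min lexx.
rewrite lee_fin -ler_pdivlMl// mulrC.
apply: (@le_trans _ _ (((eps / D) `^ beta^-1) `^ beta)%R).
  apply: ge0_ler_powR; rewrite ?nnegrE ?powR_ge0 ?(ltW beta0) ?(ltW r0)//.
  by rewrite ge_min lexx orbT.
by rewrite -powRrM mulVf ?gt_eqF// powRr1// divr_ge0 ?ltW.
Qed.

Variable u : T -> R.
Hypothesis mu_ : measurable_fun setT u.
Hypothesis u_loc : forall b, (0 < b.2)%R -> \int[mu]_(x in B b) `|u x|%:E < +oo.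
Local Notation A := (abs_mean mu B u).
Local Notation deficit := (deficit mu B u).
Variable C : R.
Hypotheses (C0 : (0 < C)%R) (hC : forall b, (0 < b.2)%R ->
    \int[mu]_(x in B b) (deficit b x)%:E <= (C * vol b `^ (beta / Q%:R) * vol b)%:E).

Lemma abs_mean_ge0 b : (0 <= A b)%R.
Proof.
by rewrite mulr_ge0// ?invr_ge0 fine_ge0//; apply: integral_ge0.
Qed.

(* No cancellation of integrals is needed: [|u - A| + A <= |u| + 2 (A - u)^+]
   and the integrals of [A] and [|u|] over the ball agree. *)
Lemma abs_mean_oscillation b : (0 < b.2)%R ->
  \int[mu]_(x in B b) `|u x - A b|%:E <= (2 * C * vol b `^ (beta / Q%:R) * vol b)%:E.
Proof.
move=> b0; have A0 := abs_mean_ge0 b.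
have mD : measurable_fun (B b) (fun x => (deficit b x)%:E).
  by apply: measurable_funTS; apply/measurable_EFinP; exact: measurable_deficit.
have mabs (v : T -> R) : measurable_fun setT v -> measurable_fun (B b) (fun x => `|v x|%:E).
  by move=> mv; apply: measurable_funTS; apply/measurable_EFinP; exact: measurableT_comp.
have muA : measurable_fun setT (fun x => u x - A b)%R by exact: measurable_funB.
have H : \int[mu]_(x in B b) `|u x - A b|%:E + \int[mu]_(x in B b) (A b)%:E <=
    \int[mu]_(x in B b) `|u x|%:E + \int[mu]_(x in B b) (2%:E * (deficit b x)%:E).
  rewrite -!ge0_integralD//; [|exact: mabs|by move=> x _; rewrite mule_ge0// lee_fin deficit_ge0
    |exact: measurable_funeM|exact: mabs].
  apply: ge0_le_integral => //.
  - by move=> x _; rewrite -EFinD lee_fin addr_ge0.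
  - by apply: emeasurable_funD => //; exact: mabs.
  - by apply: emeasurable_funD; [exact: mabs|exact: measurable_funeM].
  move=> x xb; rewrite -!EFinM -!EFinD lee_fin /deficit indicE mem_set// mulr1.
  case: (leP 0%R (A b - u x)%R) => h; last first.
    by rewrite gtr0_norm; have := ler_norm (u x); lra.
  by rewrite ler0_norm; have := ler_norm (u x); lra.
move: H; rewrite integral_cst// volE// (int_abs_fin vol_gt0 u_loc b0) ge0_integralZl//; last first.
  by move=> x _; rewrite lee_fin deficit_ge0.
rewrite addeC -EFinM leeD2lE// => /le_trans; apply.
apply: (@le_trans _ _ (2%:E * (C * vol b `^ (beta / Q%:R) * vol b)%:E)).
  by rewrite lee_wpmul2l// hC.
by rewrite -EFinM lee_fin !mulrA.
Qed.

(** Integrate |A_b - A_c| <= |u - A_b| + |u - A_c| over the smaller ball and enlarge the domain of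
    the last term to the larger one. *)
Lemma abs_mean_diff b c (D : R) : (0 < b.2)%R -> (0 < c.2)%R -> B b `<=` B c ->
  (vol c <= D * vol b)%R ->
  (`|A b - A c| <= 2 * C * (1 + D) * vol c `^ (beta / Q%:R))%R.
Proof.
move=> b0 c0 bc cD; have vb := vol_gt0 b0; have vc := vol_gt0 c0.
have e0 : (0 <= beta / Q%:R)%R by rewrite divr_ge0// ltW.
have mabs S (t : R) : measurable_fun S (fun x => `|u x - t|%:E).
  apply: measurable_funTS; apply/measurable_EFinP; apply: measurableT_comp => //.
  exact: measurable_funB.
have : \int[mu]_(x in B b) `|A b - A c|%:E <=
    \int[mu]_(x in B b) `|u x - A b|%:E + \int[mu]_(x in B c) `|u x - A c|%:E.
  apply: (@le_trans _ _ (\int[mu]_(x in B b) `|u x - A b|%:E + \int[mu]_(x in B b) `|u x - A c|%:E)).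
    rewrite -ge0_integralD//; apply: ge0_le_integral => //.
    - exact: emeasurable_funD.
    - move=> x _; rewrite -EFinD lee_fin.
      rewrite (_ : A b - A c = (u x - A c) - (u x - A b))%R; last by ring.
      by rewrite [leRHS]addrC; exact: ler_normB.
  by rewrite leeD2l//; apply: ge0_subset_integral.
rewrite integral_cst// volE// => /le_trans => /(_ _ (leeD (abs_mean_oscillation b0) (abs_mean_oscillation c0))).
rewrite -EFinM -EFinD lee_fin => h.
rewrite -(ler_pM2r vb); apply: (le_trans h).
have h1 : (vol b `^ (beta / Q%:R) <= vol c `^ (beta / Q%:R))%R.
  by apply: ge0_ler_powR; rewrite ?nnegrE ?(ltW vb) ?(ltW vc)//; exact: vol_le.
have P0 := powR_ge0 (vol c) (beta / Q%:R).
rewrite (_ : 2 * C * (1 + D) * _ * _ = 2 * C * vol c `^ (beta / Q%:R) * vol b +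
  2 * C * vol c `^ (beta / Q%:R) * (D * vol b))%R; last by ring.
by apply: lerD; [rewrite ler_wpM2r ?(ltW vb)// ler_wpM2l//|rewrite ler_wpM2l//];
  rewrite !mulr_ge0 ?(ltW C0).
Qed.

(** The ratio 2 K serves both uses: halving a radius, as K >= 1, and the inclusion of B(y, d) in
    B(x, 2 K d) for d = d(x, y). *)
Lemma abs_mean_scale : exists2 E : R, (0 < E)%R & forall b c, (0 < b.2)%R ->
  (b.2 <= c.2)%R -> (c.2 <= 2 * K * b.2)%R -> B b `<=` B c ->
  (`|A b - A c| <= E * c.2 `^ beta)%R.
Proof.
pose D := (c2 * (2 * K) ^+ Q / c1)%R.
have K0 : (0 < K)%R by exact: lt_le_trans K1.
have D0 : (0 < D)%R by rewrite divr_gt0// mulr_gt0// exprn_gt0// mulr_gt0.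
exists (2 * C * (1 + D) * c2 `^ (beta / Q%:R))%R.
  by rewrite !mulr_gt0 ?powR_gt0// addr_gt0.
move=> b c b0 bc cb Bbc; have c0 := lt_le_trans b0 bc.
apply: (le_trans (@abs_mean_diff b c D b0 c0 Bbc _)).
  apply: (le_trans (vol_le_pow c0)).
  apply: (@le_trans _ _ (c2 * (2 * K * b.2) ^+ Q)%R).
    by rewrite ler_pM2l// lerXn2r// nnegrE ?ltW// !mulr_gt0.
  apply: (@le_trans _ _ (D * (c1 * b.2 ^+ Q))%R).
    by rewrite /D exprMn !mulrA divfK// gt_eqF.
  by rewrite ler_wpM2l ?(ltW D0)// vol_ge.
rewrite -[leRHS]mulrA ler_wpM2l ?vol_powR// !mulr_ge0 ?(ltW C0)//.
by rewrite addr_ge0// ltW.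
Qed.

(** Halving [r] until it is within a factor 2 of [s] sums a geometric series of ratio h = 2^-beta;
    the constant E / (1 - h) is the solution of C1 h + E = C1. *)
Lemma abs_mean_cauchy : exists2 C1 : R, (0 < C1)%R & forall x s r, (0 < s)%R ->
  (s <= r)%R -> (`|A (x, s) - A (x, r)| <= C1 * r `^ beta)%R.
Proof.
have [E E0 hE] := abs_mean_scale.
have K0 : (0 < K)%R by exact: lt_le_trans K1.
pose h : R := (2^-1 `^ beta)%R.
have h1 : (h < 1)%R.
  have -> : 1%R = (1 `^ beta)%R :> R by rewrite powR1.
  by apply: gt0_ltr_powR => //; rewrite ?nnegrE//; lra.
have h'0 : (0 < 1 - h)%R by rewrite subr_gt0.
exists (E / (1 - h))%R; first exact: divr_gt0.
have EC : (E = E / (1 - h) * (1 - h))%R by rewrite divfK// gt_eqF.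
have h0 : (0 <= h)%R by exact: powR_ge0.
have EC1 : (E <= E / (1 - h))%R by rewrite {1}EC; have := divr_gt0 E0 h'0; nra.
have sub x s r : (s <= r)%R -> B (x, s) `<=` B (x, r).
  by move=> sr y; rewrite !BE /= => /lt_le_trans; exact.
suff H k x s r : (0 < s)%R -> (s <= r)%R -> (r <= 2 ^+ k * s)%R ->
    (`|A (x, s) - A (x, r)| <= E / (1 - h) * r `^ beta)%R.
  move=> x s r s0 sr; apply: (H (Num.bound (r / s)%R)) => //.
  rewrite -ler_pdivrMr// ltW// (lt_le_trans (archi_boundP _))//.
    by rewrite divr_ge0 ?(ltW s0)// (le_trans (ltW s0)).
  by rewrite -natrX ler_nat ltnW// ltn_expl.
elim: k r => [|k IH] r s0 sr.
  rewrite expr0 mul1r => rs; have -> : s = r by apply/eqP; rewrite eq_le sr.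
  by rewrite subrr normr0 mulr_ge0 ?powR_ge0// divr_ge0 ?ltW.
have r0 := lt_le_trans s0 sr.
have [r2 _|r2] := leP r (2 * s)%R.
  apply: (@le_trans _ _ (E * r `^ beta)%R); last by rewrite ler_wpM2r ?powR_ge0.
  apply: (hE (x, s) (x, r)) => //=; last exact: sub.
  by apply: (le_trans r2); rewrite ler_pM2r// ler_peMr.
rewrite exprS -mulrA => rk.
rewrite (_ : A (x, s) - A (x, r) = (A (x, s) - A (x, r / 2)) + (A (x, r / 2) - A (x, r)))%R; last by ring.
apply: (le_trans (ler_normD _ _)).
apply: (@le_trans _ _ (E / (1 - h) * (r / 2) `^ beta + E * r `^ beta)%R).
  apply: lerD; first by apply: IH => //; lra.
  apply: (hE (x, r / 2)%R (x, r)) => //=; [lra|lra| |apply: sub; lra].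
  by have := ler_peMl (ltW r0) K1; lra.
rewrite powRM ?(ltW r0)// -/h {2}EC le_eqVlt; apply/orP; left; apply/eqP; ring.
Qed.

Theorem campanato :
  (exists2 u' : T -> R, {ae mu, forall x, u x = u' x} & exists2 L : R, (0 < L)%R &
     forall x y, (`|u' x - u' y| <= L * dist x y `^ beta)%R) /\
  {ae mu, forall x, (0 <= u x)%R}.
Proof.
have [E E0 hE] := abs_mean_scale; have [C1 C10 hC1] := abs_mean_cauchy.
have K0 : (0 < K)%R by exact: lt_le_trans K1.
pose S x : set R := [set (A (x, r) + C1 * r `^ beta)%R | r in [set r | (0 < r)%R]].
(* The limit of [A (x, r)] as [r] goes to 0, without passing to the limit. *)
pose u' x := inf (S x).
(* By [abs_mean_cauchy] the intervals of centre A(x, r) and half-width C1 r^beta meet pairwise, so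
   the infimum of their upper ends belongs to all of them. *)
have lbS x s : (0 < s)%R -> lbound (S x) (A (x, s) - C1 * s `^ beta)%R.
  move=> s0 _ [r /= r0 <-].
  have r'0 : (0 <= C1 * r `^ beta)%R by rewrite mulr_ge0 ?powR_ge0// ltW.
  have s'0 : (0 <= C1 * s `^ beta)%R by rewrite mulr_ge0 ?powR_ge0// ltW.
  have [sr|/ltW rs] := leP s r.
    by have := hC1 x s r s0 sr; rewrite ler_norml => /andP[]; lra.
  by have := hC1 x r s r0 rs; rewrite ler_norml => /andP[]; lra.
have u'A x s : (0 < s)%R -> (`|u' x - A (x, s)| <= C1 * s `^ beta)%R.
  move=> s0; rewrite ler_norml; apply/andP; split.
    rewrite lerBrDr addrC; apply: lb_le_inf; last exact: lbS.
    by exists (A (x, s) + C1 * s `^ beta)%R, s.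
  rewrite lerBlDl; apply: ge_inf; last by exists s.
  by exists (A (x, s) - C1 * s `^ beta)%R; exact: lbS.
(* Three comparisons, for d = d(x, y): u'(x) with the mean over B(x, 2 K d), this mean with that
   over B(y, d), and the latter with u'(y); their bounds are C1, E and C1 times at most (2 K
   d)^beta. *)
pose L := ((2 * C1 + E) * (2 * K) `^ beta)%R.
have k20 : (0 < 2 * K)%R by rewrite mulr_gt0.
have k2b : (1 <= (2 * K) `^ beta)%R.
  apply: (@le_trans _ _ (1 `^ beta)%R); first by rewrite powR1.
  apply: ge0_ler_powR; rewrite ?nnegrE ?(ltW beta0) ?(ltW k20)//.
  by have := K1; lra.
have L0 : (0 < L)%R by rewrite mulr_gt0 ?powR_gt0// addr_gt0// mulr_gt0.
have lip x y : (`|u' x - u' y| <= L * dist x y `^ beta)%R.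
  have [/dist_eq ->|d0] := eqVneq (dist x y) 0%R.
    by rewrite subrr normr0 mulr_ge0 ?powR_ge0// ltW.
  have {}d0 : (0 < dist x y)%R by rewrite lt_def d0 dist_ge0.
  set dd := dist x y in d0 *; have kd0 : (0 < 2 * K * dd)%R by rewrite mulr_gt0.
  have sub : B (y, dd) `<=` B (x, 2 * K * dd)%R.
    move=> z; rewrite !BE /= => zy; apply: (le_lt_trans (dist_tri z y x)).
    rewrite (_ : 2 * K * dd = K * (dd + dd))%R; last by ring.
    by rewrite ltr_pM2l// (dist_sym y x) -/dd ltrD2r.
  have h1 := u'A x _ kd0; have h2 := u'A y _ d0.
  have h3 : (`|A (y, dd) - A (x, 2 * K * dd)| <= E * (2 * K * dd) `^ beta)%R.
    apply: (hE (y, dd) (x, 2 * K * dd)%R) => //=.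
    by rewrite ler_peMl ?(ltW d0)//; have := K1; lra.
  rewrite (_ : u' x - u' y = (u' x - A (x, 2 * K * dd)) - (A (y, dd) - A (x, 2 * K * dd))
     - (u' y - A (y, dd)))%R; last by ring.
  apply: (le_trans (ler_normB _ _)); apply: (le_trans (lerD (ler_normB _ _) (lexx _))).
  apply: (le_trans (lerD (lerD h1 h3) h2)).
  rewrite powRM ?(ltW k20) ?(ltW d0)// /L.
  have : (C1 * dd `^ beta <= C1 * (2 * K) `^ beta * dd `^ beta)%R.
    by rewrite ler_wpM2r ?powR_ge0// ler_peMr// ltW.
  lra.
have mu' : measurable_fun setT u' by exact: measurable_lipschitz lip.
split.
  exists u'; last by exists L.
  have mabs S' (v : T -> R) : measurable_fun setT v -> measurable_fun S' (fun x => `|v x|%:E).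
    by move=> mv; apply: measurable_funTS; apply/measurable_EFinP; exact: measurableT_comp.
  (* On a ball of centre x0 and radius r, |u - u'| is at most |u - A| + |u' - u'(x0)| + |u'(x0) -
     A|; the last two terms are at most L r^beta and C1 r^beta. *)
  pose D := (2 * C * c2 `^ (beta / Q%:R) + (L + C1))%R.
  have D0 : (0 < D)%R by rewrite !addr_gt0// !mulr_gt0// powR_gt0.
  have muu' : measurable_fun setT (fun x => u x - u' x)%R by exact: measurable_funB.
  have : {ae mu, forall x, `|u x - u' x|%R = 0%R}.
    apply: (@ae_eq0_of_small_averages _ D) => //; first exact: measurableT_comp.
    move=> b b0; have vb := vol_gt0 b0.
    apply: (@le_trans _ _ (\int[mu]_(x in B b) `|u x - A b|%:E +
        \int[mu]_(x in B b) ((L + C1) * b.2 `^ beta)%:E)).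
      have muA : measurable_fun setT (fun x => u x - A b)%R by exact: measurable_funB.
      rewrite -ge0_integralD//; last 2 first.
      - exact: mabs.
      - by move=> x _; rewrite lee_fin mulr_ge0 ?powR_ge0// ltW// addr_gt0.
      apply: ge0_le_integral => //; first exact: mabs.
        by apply: emeasurable_funD => //; exact: mabs.
      move=> x; rewrite BE => xb; rewrite -EFinD lee_fin.
      rewrite (_ : u x - u' x = (u x - A b) - ((u' x - u' b.1) + (u' b.1 - A b)))%R; last by ring.
      apply: (le_trans (ler_normB _ _)); rewrite lerD2l; apply: (le_trans (ler_normD _ _)).
      rewrite mulrDl; apply: lerD; last first.
        by have := u'A b.1 _ b0; rewrite -surjective_pairing.
      apply: (le_trans (lip _ _)); rewrite ler_wpM2l ?(ltW L0)//.
      by apply: ge0_ler_powR; rewrite ?nnegrE ?dist_ge0//; exact: ltW.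
    apply: (le_trans (leeD (abs_mean_oscillation b0) (lexx _))).
    rewrite integral_cst// volE// -EFinM -EFinD lee_fin /D.
    rewrite -[leLHS](mulrDl _ _ (vol b)) ler_pM2r// [leRHS]mulrDl lerD2r -[leRHS]mulrA.
    by rewrite ler_wpM2l ?vol_powR// mulr_ge0// ltW.
  by apply: filterS => x /normr0_eq0/eqP; rewrite subr_eq0 => /eqP.
(* The mean of |u| is nonnegative, so the negative part of [u] is below the deficit of every ball
   and its averages are O(r^beta) too. *)
have : {ae mu, forall x, (Num.max 0 (- u x) = 0)%R}.
  have mm : measurable_fun setT (fun x => Num.max 0 (- u x))%R.
    by apply: measurable_maxr => //; exact: measurableT_comp.
  apply: (@ae_eq0_of_small_averages _ (C * c2 `^ (beta / Q%:R))%R) => //.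
  - by move=> x; rewrite le_max lexx.
  - by rewrite mulr_gt0// powR_gt0.
  move=> b b0; apply: (@le_trans _ _ (\int[mu]_(x in B b) (deficit b x)%:E)).
    apply: ge0_le_integral => //.
    - by move=> x _; rewrite lee_fin le_max lexx.
    - by apply: measurable_funTS; exact/measurable_EFinP.
    - by apply: measurable_funTS; apply/measurable_EFinP; exact: measurable_deficit.
    move=> x xb; rewrite lee_fin /deficit indicE mem_set// mulr1.
    by rewrite ge_max !le_max lexx /= lerDr abs_mean_ge0 orbT.
  apply: (le_trans (hC b0)); rewrite lee_fin ler_pM2r ?vol_gt0//.
  by rewrite -mulrA ler_wpM2l ?vol_powR// ltW.
by apply: filterS => x mx; rewrite -oppr_le0 -mx le_max lexx orbT.
Qed.

End campanato.

(** * The commutator with a Lipschitz function *)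

Section ae_on_sets.
Context d {T : measurableType d} {R : realType} (mu : {measure set T -> \bar R}).
Local Open Scope ereal_scope.

Lemma ae_le_integral_ge0_in (D : set T) (f g : T -> \bar R) :
  (forall x, 0 <= f x) -> (forall x, 0 <= g x) -> {ae mu, forall x, f x <= g x} ->
  \int[mu]_(x in D) f x <= \int[mu]_(x in D) g x.
Proof.
move=> f0 g0 fg; rewrite integral_mkcond [leRHS]integral_mkcond.
apply: ae_le_integral_ge0 => [x|x|].
- by apply: erestrict_ge0.
- by apply: erestrict_ge0.
apply: filterS fg => x fgx; rewrite /patch; case: ifP => // _.
Qed.

End ae_on_sets.

(** * Hedberg-type estimate *)

Section maximal_interpolation.
Context d {T : measurableType d} {R : realType} (mu : {measure set T -> \bar R}).
Variable B : T * R -> set T.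
Local Notation vol := (vol mu B).
Local Notation hlmax := (hlmax mu B).
Local Notation favg := (favg mu B).
Local Notation fmax := (fmax mu B).
Hypothesis mB : forall b, measurable (B b).
Hypothesis volE : forall b, (0 < b.2) -> mu (B b) = (vol b)%:E.
Hypothesis vol_gt0 : forall b, 0 < b.2 -> 0 < vol b.
Hypothesis B_center : forall x r, 0 < r -> B (x, r) x.
Local Open Scope ereal_scope.

Variables (theta : R) (p q s : T -> R).
Hypotheses (th0 : (0 < theta)%R) (th1 : (theta < 1)%R).
Hypotheses (p1 : forall x, (1 < p x)%R) (s1 : forall x, (1 < s x)%R).
Hypothesis qE : forall x, ((q x)^-1 = (p x)^-1 - theta)%R.
Hypothesis sE : forall x, (s x = q x * (1 - theta))%R.
Hypotheses (mp : measurable_fun setT p) (ms : measurable_fun setT s).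
Variables (f : T -> R) (eta : R).
Hypotheses (mf : measurable_fun setT f) (eta0 : (0 < eta)%R)
  (fp : vmod mu p (EFin \o f) eta <= 1).

(** The exponent equals p/s, by [sobolev_sE]. *)
Definition sobolev_fun y : R := ((`|f y| / eta) `^ ((1 - p y * theta) / (1 - theta)))%R.

Let th'0 : (0 < 1 - theta)%R. Proof. by rewrite subr_gt0. Qed.

Let r0 y : (0 < (1 - p y * theta) / (1 - theta))%R.
Proof.
by rewrite divr_gt0// subr_gt0; have /andP[] := sobolev_pth th0 th1 p1 s1 qE sE y.
Qed.

Lemma measurable_sobolev_fun : measurable_fun setT sobolev_fun.
Proof.
apply: measurable_powR_fun => //.
  by apply: measurable_funM => //; exact: measurableT_comp.
apply: measurable_funM => //; apply: measurable_funB => //.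
exact: measurable_funM.
Qed.

Lemma sobolev_fun_ge0 y : (0 <= sobolev_fun y)%R.
Proof. exact: powR_ge0. Qed.

Lemma vmod_sobolev_fun : vmod mu s (EFin \o sobolev_fun) 1 <= 1.
Proof.
apply: le_trans fp; rewrite le_eqVlt; apply/orP; left; apply/eqP.
apply: eq_integral => y _; rewrite !vmod_EFin invr1 mulr1 ger0_norm ?sobolev_fun_ge0//.
rewrite /sobolev_fun -powRrM; congr (_ `^ _)%R%:E.
have := sobolev_sE th1 p1 s1 qE sE y => h.
by rewrite mulrAC [((1 - _) * s y)%R]mulrC h mulfK// gt_eqF.
Qed.

(* Young's inequality for [|f| / eta = g^(1 - theta) * h^theta], where [g] is
   [sobolev_fun] and [h = (|f| / eta)^p], with the weights that balance the
   bounds for the integrals of [g] and [h]. *)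
Lemma int_le_sobolev (b : T * R) (t : R) : (0 < b.2)%R -> (0 < t)%R ->
  \int[mu]_(y in B b) (sobolev_fun y)%:E <= (t * vol b)%:E ->
  \int[mu]_(y in B b) `|f y|%:E <= (eta * (t * vol b) `^ (1 - theta))%:E.
Proof.
move=> b0 t0 ht; have v0 := vol_gt0 b0; set w := (t * vol b)%R in ht *.
have w0 : (0 < w)%R by rewrite mulr_gt0.
pose h y : R := ((`|f y| / eta) `^ p y)%R.
have p0 y : (0 < p y)%R by exact: lt_trans (p1 y).
have mh : measurable_fun setT h by exact: measurable_vmod_term.
have mg := measurable_sobolev_fun.
have h1 : \int[mu]_(y in B b) (h y)%:E <= 1.
  apply: le_trans fp; apply: ge0_subset_integral => //.
    by apply/measurable_EFinP.
  by move=> y _; rewrite lee_fin powR_ge0.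
(* The factors w^-theta and w^(1 - theta) cancel in the geometric mean. After integration the two
   terms are at most (1 - theta) w^(1 - theta) and theta w^(1 - theta). *)
have pt y : (`|f y| <= eta * ((1 - theta) * (w `^ (- theta)) * sobolev_fun y +
    theta * w `^ (1 - theta) * h y))%R.
  rewrite -ler_pdivrMl// mulrC.
  set F := (`|f y| / eta)%R; have F0 : (0 <= F)%R by rewrite divr_ge0// ltW.
  have := @young_powR R theta (w `^ (- theta) * sobolev_fun y)%R (w `^ (1 - theta) * h y)%R.
  rewrite th0 th1 !mulr_ge0 ?powR_ge0// => /(_ erefl erefl erefl).
  rewrite !mulrA; apply: le_trans.
  rewrite /sobolev_fun /h -/F; clearbody F; clear ht; clearbody w; rewrite !powRM ?powR_ge0// -!powRrM.
  have [-> | F_neq0] := eqVneq F 0%R; first by rewrite !mulr_ge0 ?powR_ge0.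
  have {F_neq0}F_gt0 : (0 < F)%R by rewrite lt_def F_neq0.
  rewrite mulrACA -!powRD_gt0// divfK ?gt_eqF//.
  rewrite (_ : - theta * (1 - theta) + (1 - theta) * theta = 0)%R; last by ring.
  by rewrite powRr0 mul1r subrK powRr1.
have ptE y : `|f y|%:E <= eta%:E * (((1 - theta) * w `^ (- theta))%:E * (sobolev_fun y)%:E +
     (theta * w `^ (1 - theta))%:E * (h y)%:E).
  rewrite -[leRHS]/((eta * ((1 - theta) * w `^ (- theta) * sobolev_fun y +
    theta * w `^ (1 - theta) * h y))%R%:E) lee_fin; exact: pt.
apply: (@le_trans _ _ (\int[mu]_(y in B b) (eta%:E *
    (((1 - theta) * w `^ (- theta))%:E * (sobolev_fun y)%:E +
     (theta * w `^ (1 - theta))%:E * (h y)%:E)))).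
  apply: ae_le_integral_ge0_in => [y|y|].
  - by rewrite lee_fin.
  - by apply: le_trans (ptE y); rewrite lee_fin.
  by apply: aeW => y; exact: ptE.
have a0 : (0 <= (1 - theta) * w `^ (- theta))%R by rewrite mulr_ge0 ?powR_ge0// ltW.
have b'0 : (0 <= theta * w `^ (1 - theta))%R by rewrite mulr_ge0 ?powR_ge0// ltW.
have mg' : measurable_fun (B b) (EFin \o sobolev_fun).
  by apply: measurable_funTS; exact/measurable_EFinP.
have mh' : measurable_fun (B b) (EFin \o h).
  by apply: measurable_funTS; exact/measurable_EFinP.
rewrite ge0_integralZl//; last 3 first.
- by apply: emeasurable_funD; exact: measurable_funeM.
- by move=> y _; rewrite -!EFinM -EFinD lee_fin addr_ge0 ?mulr_ge0 ?powR_ge0// ltW.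
- by rewrite lee_fin ltW.
rewrite ge0_integralD//; last 4 first.
- by move=> y _; rewrite -EFinM lee_fin mulr_ge0// powR_ge0.
- exact: measurable_funeM.
- by move=> y _; rewrite -EFinM lee_fin mulr_ge0// powR_ge0.
- exact: measurable_funeM.
rewrite !ge0_integralZl//; last 2 first.
- by move=> y _; rewrite lee_fin powR_ge0.
- by move=> y _; rewrite lee_fin powR_ge0.
rewrite [leRHS]EFinM lee_wpmul2l ?lee_fin ?(ltW eta0)//.
apply: (@le_trans _ _ (((1 - theta) * w `^ (- theta))%:E * w%:E + (theta * w `^ (1 - theta))%:E * 1)).
  by apply: leeD; rewrite lee_wpmul2l.
rewrite mule1 -EFinM -EFinD lee_fin -mulrA -{2}(powRr1 (ltW w0)) -powRD_gt0//.
rewrite [(- theta + 1)%R]addrC -mulrDl.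
by rewrite subrK mul1r.
Qed.

(** On a ball of volume v, v^(theta - 1) cancels the volume in (t v)^(1 - theta) from
    [int_le_sobolev]. That lemma needs t > 0; for M = 0, t tends to 0. *)
Lemma fmax_le_sobolev x (M : R) : (0 <= M)%R ->
  hlmax (fun y => `|sobolev_fun y|%:E) x <= M%:E ->
  fmax theta (fun y => `|f y|%:E) x <= (eta * M `^ (1 - theta))%:E.
Proof.
suff H (t : R) : (0 < t)%R -> hlmax (fun y => `|sobolev_fun y|%:E) x <= t%:E ->
    fmax theta (fun y => `|f y|%:E) x <= (eta * t `^ (1 - theta))%:E.
  rewrite le_eqVlt => /predU1P[<-|]; last exact: H.
  move=> h; rewrite powR0 ?gt_eqF// mulr0.
  apply/lee_addgt0Pr => eps eps0; rewrite add0e.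
  have e0 : (0 < eps / eta)%R by rewrite divr_gt0.
  apply: le_trans (H ((eps / eta) `^ (1 - theta)^-1)%R _ _) _.
  - exact: powR_gt0.
  - by apply: (le_trans h); rewrite lee_fin powR_ge0.
  by rewrite -powRrM mulVf ?gt_eqF// powRr1 ?(ltW e0)// mulrC divfK// gt_eqF.
move=> t0 ht; apply: fmax_le => b b0 bx; have v0 := vol_gt0 b0.
have : \int[mu]_(y in B b) (sobolev_fun y)%:E <= (t * vol b)%:E.
  have := le_trans (hlmax_ge mu (fun y => `|sobolev_fun y|%:E) b0 bx) ht.
  rewrite /ball_avg lee_pdivrMl// -EFinM mulrC => h.
  by rewrite (eq_integral (fun y => `|sobolev_fun y|%:E))// => y _; rewrite ger0_norm// sobolev_fun_ge0.
move=> /(int_le_sobolev b0 t0) h.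
apply: (@le_trans _ _ ((vol b `^ (theta - 1))%:E * (eta * (t * vol b) `^ (1 - theta))%:E)).
  by rewrite lee_wpmul2l// lee_fin powR_ge0.
rewrite -EFinM lee_fin powRM ?(ltW t0) ?(ltW v0)// -(opprB theta).
rewrite [leLHS](_ : _ =
  eta * t `^ (- (theta - 1)) * (vol b `^ (theta - 1) * vol b `^ (- (theta - 1))))%R; last by ring.
by rewrite -powRD_gt0// subrr powRr0 mulr1.
Qed.

(** Excludes differences of infinities in the commutator. Balls of volume at least 1 are controlled
    by M_theta, as a < theta; for smaller ones v^(a-1) <= 1/v and |f|/eta <= 1 + (|f|/eta)^p. *)
Lemma fmax_fin (a : R) x : (0 < a < theta)%R ->
  hlmax (fun y => ((`|f y| / eta) `^ p y)%:E) x < +oo ->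
  fmax theta (fun y => `|f y|%:E) x < +oo -> fmax a (fun y => `|f y|%:E) x < +oo.
Proof.
move=> /andP[a0 ath] h1 h2.
have p0 y : (0 < p y)%R by exact: lt_trans (p1 y).
set h := fun y => ((`|f y| / eta) `^ p y)%:E in h1.
have hge0 y : 0 <= h y by rewrite lee_fin powR_ge0.
have hl0 : 0 <= hlmax h x by exact: hlmax_ge0.
have fm0 : 0 <= fmax theta (fun y => `|f y|%:E) x.
  by apply: fmax_ge0 => // y; rewrite lee_fin.
apply: (@le_lt_trans _ _ (fmax theta (fun y => `|f y|%:E) x + eta%:E * (1 + hlmax h x))); last first.
  by rewrite lte_add_pinfty// lte_mul_pinfty ?lee_fin ?(ltW eta0)// lte_add_pinfty// ltry.
apply: fmax_le => b b0 bx; have v0 := vol_gt0 b0.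
have I0 : 0 <= \int[mu]_(y in B b) `|f y|%:E by apply: integral_ge0 => y _; rewrite lee_fin.
have [v1|/ltW v1] := leP 1%R (vol b).
  apply: (@le_trans _ _ (favg theta (fun y => `|f y|%:E) b)).
    rewrite lee_wpmul2r// lee_fin ler_powR//; lra.
  apply: (le_trans (fmax_ge mu theta _ b0 bx)); rewrite leeDl//.
  by rewrite mule_ge0 ?adde_ge0// lee_fin ltW.
apply: (@le_trans _ _ (eta%:E * (1 + hlmax h x))); last by rewrite leeDr.
apply: (@le_trans _ _ ((vol b)^-1%:E * \int[mu]_(y in B b) `|f y|%:E)).
  rewrite lee_wpmul2r// lee_fin -powR_inv1 ?(ltW v0)//.
  by apply: ger_powR; rewrite ?v0//; lra.
rewrite lee_pdivrMl//.
apply: (@le_trans _ _ (\int[mu]_(y in B b) (eta%:E * (1 + h y)))).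
  apply: ae_le_integral_ge0_in => [y|y|].
  - by rewrite lee_fin.
  - by rewrite mule_ge0 ?adde_ge0// lee_fin ltW.
  apply: aeW => y; rewrite -EFinD -EFinM lee_fin -ler_pdivrMl// mulrC.
  set F := (`|f y| / eta)%R; have F0 : (0 <= F)%R by rewrite divr_ge0// ltW.
  have [F1|F1] := leP F 1%R; first by rewrite (le_trans F1)// lerDl powR_ge0.
  rewrite (@le_trans _ _ (F `^ p y)%R) ?lerDr//.
  by rewrite le1r_powR// ltW.
have mh : measurable_fun (B b) h.
  by apply: measurable_funTS; apply/measurable_EFinP; exact: measurable_vmod_term.
rewrite ge0_integralZl//; last 3 first.
- exact: emeasurable_funD.
- by move=> y _; rewrite adde_ge0.
- by rewrite lee_fin ltW.
rewrite muleCA lee_wpmul2l ?lee_fin ?(ltW eta0)//.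
rewrite ge0_integralD// integral_cst// mul1e volE// ge0_muleDr// mule1 leeD2l//.
by rewrite -lee_pdivrMl//; exact: hlmax_ge.
Qed.

End maximal_interpolation.

Section finiteness.
Context d {T : measurableType d} {R : realType} (mu : {measure set T -> \bar R}).
Variable B : T * R -> set T.
Local Notation hlmax := (hlmax mu B).
Local Open Scope ereal_scope.
Hypothesis mhl : forall g : T -> \bar R, measurable_fun setT (hlmax g).
Hypothesis weak : exists2 C : R, (0 < C)%R & forall (g : T -> \bar R) (t : R),
  measurable_fun setT g -> (forall x, 0 <= g x) -> (0 < t)%R ->
  mu [set x | t%:E < hlmax g x] <= (C / t)%:E * \int[mu]_x g x.

(** The infinity set lies in every superlevel set {hlmax g > n + 1}, whose measure is O(1/(n +
    1)). *)
Lemma hlmax_fin_ae (g : T -> \bar R) : measurable_fun setT g -> (forall x, 0 <= g x) ->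
  \int[mu]_x g x < +oo -> {ae mu, forall x, hlmax g x < +oo}.
Proof.
move=> mg g0 gfin; have [C C0 hC] := weak.
have I0 : 0 <= \int[mu]_x g x by exact: integral_ge0.
have mt (t : R) : measurable [set x | t%:E < hlmax g x].
  by rewrite -[X in measurable X]setTI; exact: emeasurable_fun_o_infty.
exists (\bigcap_n [set x | n.+1%:R%:E < hlmax g x]); split.
- exact: bigcapT_measurable.
- apply/eqP; rewrite eq_le measure_ge0 andbT.
  apply/lee_addgt0Pr => eps eps0; rewrite add0e.
  have Ifin : \int[mu]_x g x \is a fin_num by rewrite ge0_fin_numE.
  pose I := fine (\int[mu]_x g x); pose n := Num.bound (C * I / eps)%R.
  have I0' : (0 <= I)%R by exact: fine_ge0.
  apply: (@le_trans _ _ (mu [set x | n.+1%:R%:E < hlmax g x])).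
    by apply: le_measure; rewrite ?inE; [exact: bigcapT_measurable|exact: mt|exact: bigcap_inf].
  apply: (le_trans (hC _ _ mg g0 _)); first by rewrite ltr0n.
  rewrite -(fineK Ifin) -EFinM lee_fin -/I mulrAC ler_pdivrMr ?ltr0n// -ler_pdivrMl// mulrC.
  apply: ltW; apply: (lt_trans (archi_boundP _)).
    by rewrite divr_ge0 ?mulr_ge0// ltW.
  by rewrite ltr_nat.
move=> x /= /negP; rewrite -leNgt leye_eq => /eqP hx n _ /=.
by rewrite hx ltry.
Qed.

End finiteness.

(** * Bounds for a nonnegative Lipschitz function *)

Section lipschitz_side.
Context d {T : measurableType d} {R : realType} (mu : {measure set T -> \bar R}).
Variable B : T * R -> set T.
Local Notation vol := (vol mu B).
Local Notation hlmax := (hlmax mu B).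
Local Notation favg := (favg mu B).
Local Notation fmax := (fmax mu B).
Local Notation local_fmax := (local_fmax mu B).
Local Notation commutator := (commutator mu B).
Hypothesis mB : forall b, measurable (B b).
Hypothesis volE : forall b, (0 < b.2) -> mu (B b) = (vol b)%:E.
Hypothesis vol_gt0 : forall b, 0 < b.2 -> 0 < vol b.
Hypothesis B_center : forall x r, 0 < r -> B (x, r) x.
Local Open Scope ereal_scope.

Variables (u u' : T -> R) (C e a : R).
Hypotheses (mu_ : measurable_fun setT u) (C0 : (0 < C)%R) (e0 : (0 < e)%R)
  (a0 : (0 < a)%R) (ae1 : (a + e < 1)%R).
Hypothesis uu' : {ae mu, forall x, u x = u' x}.
Hypothesis u_ge0 : {ae mu, forall x, (0 <= u x)%R}.
Hypothesis lip : forall b x y, (0 < b.2)%R -> B b x -> B b y ->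
  (`|u' x - u' y| <= C * vol b `^ e)%R.

Lemma favgD_vol (g : T -> \bar R) b k r : (0 < b.2)%R ->
  k%:E * favg (r + e) g b = (k * vol b `^ e)%:E * favg r g b.
Proof.
move=> b0; rewrite /favg !muleA -!EFinM -mulrA -powRD_gt0 ?vol_gt0//.
by congr ((_ * _ `^ _)%:E * _); ring.
Qed.

Section averages_of_products.
Variables (f : T -> R) (mf : measurable_fun setT f).

Let mabs (D : set T) (v : T -> R) : measurable_fun setT v -> measurable_fun D (fun x => `|v x|%:E).
Proof.
by move=> mv; apply: measurable_funTS; apply/measurable_EFinP; exact: measurableT_comp.
Qed.

Let muf : measurable_fun setT (fun y => u y * f y)%R.
Proof. exact: measurable_funM. Qed.

(** For almost every y in a ball containing x, |u(y)| <= u(x) + C |B|^e; the factor |B|^e raises the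
    order of the average of |f| from r to r + e. [favg_mul_ge] is the reverse comparison. *)
Lemma favg_mul_le r x b : u x = u' x -> (0 <= u x)%R -> (0 < b.2)%R -> B b x ->
  favg r (fun y => `|u y * f y|%:E) b <=
    (u x)%:E * favg r (fun y => `|f y|%:E) b + C%:E * favg (r + e) (fun y => `|f y|%:E) b.
Proof.
move=> ux ux0 b0 bx; have v0 := vol_gt0 b0.
have c0 : (0 <= C * vol b `^ e)%R by rewrite mulr_ge0 ?powR_ge0// ltW.
rewrite (favgD_vol _ C r b0) -ge0_muleDl ?lee_fin// -EFinD.
rewrite /favg muleCA lee_wpmul2l ?lee_fin ?powR_ge0//.
rewrite -ge0_integralZl//; last 2 first.
- exact: mabs.
- by rewrite lee_fin addr_ge0.
rewrite integral_mkcond [leRHS]integral_mkcond; apply: ae_le_integral_ge0.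
- by apply: erestrict_ge0 => y _; rewrite lee_fin.
- by apply: erestrict_ge0 => y _; rewrite -EFinM lee_fin mulr_ge0// addr_ge0.
apply: filterS uu' => y uy; rewrite /patch; case: ifPn => //; rewrite inE => yb.
rewrite -EFinM lee_fin normrM ler_wpM2r// uy.
have := lip b0 yb bx; rewrite -ux => h.
rewrite -(subrK (u x) (u' y)); apply: (le_trans (ler_normD _ _)).
by rewrite (ger0_norm ux0) addrC lerD2l.
Qed.

Lemma favg_mul_ge r x b : u x = u' x -> (0 <= u x)%R -> (0 < b.2)%R -> B b x ->
  (u x)%:E * favg r (fun y => `|f y|%:E) b <=
    favg r (fun y => `|u y * f y|%:E) b + C%:E * favg (r + e) (fun y => `|f y|%:E) b.
Proof.
move=> ux ux0 b0 bx; have v0 := vol_gt0 b0.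
have c0 : (0 <= C * vol b `^ e)%R by rewrite mulr_ge0 ?powR_ge0// ltW.
have I0 : 0 <= \int[mu]_(y in B b) `|f y|%:E by apply: integral_ge0 => y _; rewrite lee_fin.
rewrite (favgD_vol _ C r b0) /favg muleCA [X in _ <= _ + X]muleCA -ge0_muleDr//; last 2 first.
- by apply: integral_ge0 => y _; rewrite lee_fin.
- by rewrite mule_ge0// lee_fin.
rewrite lee_wpmul2l ?lee_fin ?powR_ge0//.
rewrite -!ge0_integralZl//; last 2 first.
- exact: mabs.
- exact: mabs.
rewrite -ge0_integralD//; last 3 first.
- exact: mabs.
- by move=> y _; rewrite mule_ge0// lee_fin.
- by apply: measurable_funeM; exact: mabs.
rewrite integral_mkcond [leRHS]integral_mkcond; apply: ae_le_integral_ge0.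
- by apply: erestrict_ge0 => y _; rewrite mule_ge0// lee_fin.
- by apply: erestrict_ge0 => y _; rewrite adde_ge0 ?mule_ge0// lee_fin.
apply: filterS uu' => y uy; rewrite /patch; case: ifPn => //; rewrite inE => yb.
rewrite -!EFinM -EFinD lee_fin normrM -mulrDl ler_wpM2r// uy.
have := lip b0 bx yb; rewrite -ux => h.
rewrite -(ger0_norm ux0) -{1}(subrK (u' y) (u x)); apply: (le_trans (ler_normD _ _)).
by rewrite addrC lerD2l.
Qed.

(** Taking suprema in the two comparisons of averages bounds each term of the commutator by the
    other one plus C M_(a+e) f. The finiteness hypothesis lets them be subtracted; where M_(a+e) f
    is infinite, so is the bound. *)
Lemma commutator_le x : u x = u' x -> (0 <= u x)%R ->
  (fmax (a + e) (fun y => `|f y|%:E) x < +oo -> fmax a (fun y => `|f y|%:E) x < +oo) ->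
  `|commutator a u f x| <= C%:E * fmax (a + e) (fun y => `|f y|%:E) x.
Proof.
move=> ux ux0 hfin.
have fg0 r : 0 <= fmax r (fun y => `|f y|%:E) x by apply: fmax_ge0 => // y; rewrite lee_fin.
have [h|] := ltP (fmax (a + e) (fun y => `|f y|%:E) x) +oo; last first.
  by rewrite leye_eq => /eqP ->; rewrite gt0_muley ?lte_fin// leey.
have Fa := hfin h.
have F1 : fmax a (fun y => `|u y * f y|%:E) x <=
    (u x)%:E * fmax a (fun y => `|f y|%:E) x + C%:E * fmax (a + e) (fun y => `|f y|%:E) x.
  apply: fmax_le => b b0 bx; apply: (le_trans (favg_mul_le a ux ux0 b0 bx)).
  by apply: leeD; rewrite lee_wpmul2l ?lee_fin ?(ltW C0)//; exact: fmax_ge.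
have F2 : (u x)%:E * fmax a (fun y => `|f y|%:E) x <=
    fmax a (fun y => `|u y * f y|%:E) x + C%:E * fmax (a + e) (fun y => `|f y|%:E) x.
  have rhs0 : 0 <= fmax a (fun y => `|u y * f y|%:E) x + C%:E * fmax (a + e) (fun y => `|f y|%:E) x.
    rewrite adde_ge0// ?mule_ge0 ?lee_fin ?(ltW C0)//.
    by apply: fmax_ge0 => // y; rewrite lee_fin.
  (* The supremum is bounded after division by u(x); for u(x) = 0 the left side is 0, even if the
     maximal function is infinite. *)
  move: ux0; rewrite le_eqVlt => /predU1P[<-|uxp]; first by rewrite mul0e.
  rewrite -lee_pdivlMl//; apply: fmax_le => b b0 bx; rewrite lee_pdivlMl//.
  apply: (le_trans (favg_mul_ge a ux (ltW uxp) b0 bx)).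
  by apply: leeD; rewrite ?lee_wpmul2l ?lee_fin ?(ltW C0)//; exact: fmax_ge.
rewrite /commutator.
have ga := fg0 a; have ge := fg0 (a + e)%R.
have gu : 0 <= fmax a (fun y => `|u y * f y|%:E) x by apply: fmax_ge0 => // y; rewrite lee_fin.
move: F1 F2 Fa h ga ge gu.
case: (fmax a (fun y => `|f y|%:E) x) => [A| |]//.
case: (fmax (a + e) _ x) => [E| |]//.
case: (fmax a _ x) => [A'| |]//.
rewrite -!EFinM -EFinB abse_EFin -!EFinD !lee_fin => h1 h2 _ _ _ _ _.
by rewrite ler_norml; apply/andP; split; lra.
Qed.

End averages_of_products.

(** The comparisons of averages with f = 1, whose average of order r is |B|^r: balls inside B give
    the upper bound for the local maximal function, and B itself the lower one. *)
Lemma oscillation_le x b : u x = u' x -> (0 <= u x)%R -> (0 < b.2)%R -> B b x ->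
  `|(u x)%:E - (vol b `^ a)^-1%:E * local_fmax a b (fun y => `|u y|%:E) x| <=
    (C * vol b `^ e)%:E.
Proof.
move=> ux ux0 b0 bx; have v0 := vol_gt0 b0.
have va : (0 < vol b `^ a)%R by rewrite powR_gt0.
have c0 c : (0 <= C * vol c `^ e)%R by rewrite mulr_ge0 ?powR_ge0// ltW.
have favg1 r c : (0 < c.2)%R -> favg r (fun=> `|1%R : R|%:E) c = (vol c `^ r)%:E.
  by move=> c0'; rewrite /favg integral_cst// volE// normr1 mul1e -EFinM vol_powRS.
have m1 : measurable_fun setT (fun _ : T => 1%R : R) by exact: measurable_cst.
have fu c : favg a (fun y => `|u y * 1|%:E) c = favg a (fun y => `|u y|%:E) c.
  by congr (_ * _); apply: eq_integral => y _; rewrite mulr1.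
set L := local_fmax a b _ x.
have L1 : L <= ((u x + C * vol b `^ e) * vol b `^ a)%:E.
  apply: ge_ereal_sup => _ [c [cpos cx cb] <-].
  have := favg_mul_le m1 a ux ux0 cpos cx; rewrite fu !favg1// -!EFinM -EFinD => /le_trans; apply.
  have cv := vol_le mB volE cpos b0 cb; have w0 := vol_gt0 cpos.
  rewrite lee_fin powRD_gt0// mulrDl.
  have ha : (vol c `^ a <= vol b `^ a)%R by apply: ge0_ler_powR; rewrite ?nnegrE ?(ltW a0) ?(ltW e0) ?(ltW v0) ?(ltW w0).
  have he : (vol c `^ e <= vol b `^ e)%R by apply: ge0_ler_powR; rewrite ?nnegrE ?(ltW a0) ?(ltW e0) ?(ltW v0) ?(ltW w0).
  apply: lerD; first by rewrite ler_wpM2l.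
  rewrite -mulrA ler_wpM2l ?(ltW C0)// mulrC.
  by apply: ler_pM => //; exact: powR_ge0.
have L2 : (u x * vol b `^ a)%:E <= L + (C * vol b `^ e * vol b `^ a)%:E.
  have := favg_mul_ge m1 a ux ux0 b0 bx; rewrite fu !favg1// -!EFinM => /le_trans; apply.
  rewrite powRD_gt0// -mulrA [(vol b `^ e * _)%R]mulrC leeD2r//.
  by apply: ereal_sup_ubound; exists b => //; split.
move: L1 L2; case: L => [l| |]//.
rewrite -EFinM -EFinB abse_EFin -EFinD !lee_fin => h1 h2.
rewrite ler_norml; apply/andP; split.
  have : ((vol b `^ a)^-1 * l <= u x + C * vol b `^ e)%R by rewrite ler_pdivrMl// mulrC.
  lra.
have : (u x - C * vol b `^ e <= (vol b `^ a)^-1 * l)%R by rewrite ler_pdivlMl//; lra.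
lra.
Qed.

Lemma vnorm_oscillation_le (s : T -> R) b : (forall x, (1 < s x)%R) -> (0 < b.2)%R ->
  vnorm mu s (fun x => ((u x)%:E - (vol b `^ a)^-1%:E *
     local_fmax a b (fun y => `|u y|%:E) x) * (\1_(B b) x)%:E) <=
  (C * vol b `^ e)%:E * vnorm mu s (EFin \o \1_(B b)).
Proof.
move=> s1 b0; have v0 := vol_gt0 b0.
have k0 : (0 < C * vol b `^ e)%R by rewrite mulr_gt0// powR_gt0.
rewrite -lee_pdivrMl//; apply: le_ereal_inf_tmp => _ [z [z0 hz] <-].
rewrite lee_pdivrMl// -EFinM; apply: vnorm_le; first exact: mulr_gt0.
apply: le_trans hz; apply: vmod_mono => //.
- by move=> x; rewrite ltW// (lt_trans _ (s1 x)).
- exact: mulr_gt0.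
near=> x.
have ux : u x = u' x by near: x.
have ux0 : (0 <= u x)%R by near: x.
rewrite /= indicE; case: (boolP (x \in B b)) => xb; last by rewrite mule0 abse0 normr0 !mul0e.
rewrite mule1 normr1 mul1e invfM EFinM muleA -[leRHS]mul1e.
rewrite lee_wpmul2r ?lee_fin ?invr_ge0 ?(ltW z0)//.
rewrite lee_pdivrMr// mul1e; apply: oscillation_le => //.
by rewrite inE in xb.
Unshelve. all: by end_near. Qed.

Hypothesis hl_fin : forall g : T -> \bar R, measurable_fun setT g -> (forall x, 0 <= g x) ->
  \int[mu]_x g x < +oo -> {ae mu, forall x, hlmax g x < +oo}.

(** Pointwise |[u, M_a] f| <= C eta (M g)^(1 - theta) with g of s-modular at most 1. As s = q (1 -
    theta), the q-modular of the commutator at C C1^(1 - theta) eta is at most the s-modular of M g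
    at C1. *)
Lemma commutator_bounded (p q s : T -> R) :
  (forall x, (1 < p x)%R) -> (forall x, (1 < s x)%R) ->
  measurable_fun setT p -> measurable_fun setT s ->
  (forall x, ((q x)^-1 = (p x)^-1 - (a + e))%R) ->
  (forall x, (s x = q x * (1 - (a + e)))%R) -> bounded_maximal mu B s ->
  exists2 D : R, (0 < D)%R & forall f : T -> R, measurable_fun setT f ->
    vnorm mu q (commutator a u f) <= D%:E * vnorm mu p (EFin \o f).
Proof.
move=> p1 s1 mp ms qE sE bs; have th1 := ae1; set th := (a + e)%R in th1 qE sE.
have th0 : (0 < th)%R by rewrite addr_gt0.
have th'0 : (0 < 1 - th)%R by rewrite subr_gt0.
have q0 := sobolev_q_gt0 th1 s1 sE.
have s0 x : (0 < s x)%R by exact: lt_trans (s1 x).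
have p0 x : (0 < p x)%R by exact: lt_trans (p1 x).
have [C1 C10 hC1] := bounded_maximal_vmod s1 bs.
have C1t : (0 < C1 `^ (1 - th))%R by rewrite powR_gt0.
exists (C * C1 `^ (1 - th))%R; first by rewrite mulr_gt0.
move=> f mf; rewrite -lee_pdivrMl ?mulr_gt0//.
apply: le_ereal_inf_tmp => _ [eta [eta0 hf] <-].
rewrite lee_pdivrMl ?mulr_gt0// -EFinM.
apply: vnorm_le; first by rewrite !mulr_gt0.
pose g := sobolev_fun th p f eta.
have mg : measurable_fun setT g by exact: (measurable_sobolev_fun th0 th1 p1 s1 qE sE mp eta mf).
have g1 : vmod mu s (EFin \o g) 1 <= 1 by exact: (vmod_sobolev_fun th1 p1 s1 qE sE hf).
have := hC1 g 1%R mg ltr01 g1; rewrite mulr1; apply: le_trans.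
apply: ae_le_integral_ge0 => [x|x|]; [exact: poweR_ge0|exact: poweR_ge0|].
have hfin : {ae mu, forall x, hlmax (fun y => ((`|f y| / eta) `^ p y)%R%:E) x < +oo}.
  apply: hl_fin.
  - by apply/measurable_EFinP; exact: measurable_vmod_term.
  - by move=> x; rewrite lee_fin powR_ge0.
  - exact: le_lt_trans hf (ltry _).
near=> x.
have ux : u x = u' x by near: x.
have ux0 : (0 <= u x)%R by near: x.
have hx : hlmax (fun y => ((`|f y| / eta) `^ p y)%R%:E) x < +oo by near: x.
have cx : `|commutator a u f x| <= C%:E * fmax th (fun y => `|f y|%:E) x.
  apply: (commutator_le mf ux ux0) => h.
  apply: (@fmax_fin _ _ _ mu B mB volE vol_gt0 B_center th p p1 mp f eta) => //.
  by rewrite a0 ltrDl.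
have hl0 : 0 <= hlmax (fun y => `|g y|%:E) x.
  by apply: hlmax_ge0 => // y; rewrite lee_fin.
have := @fmax_le_sobolev _ _ _ mu B mB vol_gt0 th p q s th0 th1 p1 s1 qE sE mp f eta mf eta0 hf x.
rewrite -/g; move: hl0; case: (hlmax _ x) => [M| |]//; last first.
  (* Where M g is infinite, the dominating integrand is infinite. *)
  move=> _ _; have -> : `|+oo| * C1^-1%:E = +oo by rewrite gt0_mulye// lte_fin invr_gt0.
  by rewrite /poweR (gt_eqF (s0 x)) leey.
rewrite lee_fin => M0 /(_ M M0 (lexx _)) hM.
have {cx}cx : `|commutator a u f x| <= (C * (eta * M `^ (1 - th)))%:E.
  by apply: (le_trans cx); rewrite EFinM lee_wpmul2l// lee_fin ltW.
move: cx; case: (commutator a u f x) => [c| |]//; rewrite abse_EFin lee_fin => cx.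
rewrite abse_EFin -!EFinM !poweR_EFin lee_fin (ger0_norm M0).
rewrite sE [(q x * _)%R]mulrC powRrM.
apply: ge0_ler_powR; rewrite ?nnegrE ?(ltW (q0 x)) ?powR_ge0//.
  by rewrite divr_ge0// ltW// !mulr_gt0.
rewrite ler_pdivrMr ?mulr_gt0//; apply: (le_trans cx).
rewrite powRM ?invr_ge0 ?(ltW C10)// powR_inv ?(ltW C10)// le_eqVlt; apply/orP; left; apply/eqP.
by field; rewrite gt_eqF.
Unshelve. all: by end_near. Qed.

End lipschitz_side.

(** * The maximal operator for the constant exponent 2 *)

Section quadratic_modular.
Context d {T : measurableType d} {R : realType} (mu : {measure set T -> \bar R}).
Variable B : T * R -> set T.
Local Notation hlmax := (hlmax mu B).
Local Open Scope ereal_scope.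
Hypothesis B_center : forall x r, (0 < r)%R -> B (x, r) x.
Hypothesis mhl : forall g : T -> \bar R, measurable_fun setT (hlmax g).
Hypothesis maximal_L2 : exists2 C : R, (0 < C)%R & forall (g : T -> R),
  measurable_fun setT g -> (forall y, (0 <= g y)%R) ->
  \int[mu]_x (hlmax (EFin \o g) x * hlmax (EFin \o g) x) <= C%:E * \int[mu]_x (g x * g x)%:E.

Lemma bounded_maximal_two : bounded_maximal mu B (fun=> 2%R).
Proof.
(* C bounds the squared norms; C + 1 is at least the square root of C, which is all that C <= (C +
   1)^2 expresses below. *)
have [C C0 hC] := maximal_L2; exists (C + 1)%R; first by rewrite addr_gt0.
move=> f mf _; have C10 : (0 < C + 1)%R by rewrite addr_gt0.
rewrite -lee_pdivrMl//; apply: le_ereal_inf_tmp => _ [eta [eta0 hf] <-].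
have k0 : (0 < (C + 1) * eta)%R by rewrite mulr_gt0.
rewrite lee_pdivrMl// -EFinM; apply: vnorm_le => //.
have p2 (z : \bar R) : 0 <= z -> z `^ 2%R = z * z.
  case: z => [r| |]//; last by rewrite mulyy /poweR gt_eqF.
  by rewrite lee_fin => r0; rewrite poweR_EFin powR_mulrn// expr2 EFinM.
set k := ((C + 1) * eta)%R in k0 *.
set h := hlmax (fun y => `|f y|%:E).
have h0 x : 0 <= h x by apply: hlmax_ge0 => // y; rewrite lee_fin.
have mabs : measurable_fun setT (fun y => `|f y|)%R by exact: measurableT_comp.
have -> : vmod mu (fun=> 2%R) h k = (k^-1 * k^-1)%:E * \int[mu]_x (h x * h x).
  rewrite -ge0_integralZl//.
  - apply: eq_integral => x _; rewrite gee0_abs// p2; last first.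
      by rewrite mule_ge0// lee_fin invr_ge0 ltW.
    by rewrite muleACA -EFinM muleC.
  - by apply: emeasurable_funM; exact: mhl.
  - by move=> x _; rewrite mule_ge0.
  - by rewrite lee_fin mulr_ge0// invr_ge0 ltW.
have I : \int[mu]_x (`|f x| * `|f x|)%:E <= (eta * eta)%:E.
  rewrite -[leRHS]mule1; apply: le_trans (lee_wpmul2l _ hf); last first.
    by rewrite lee_fin mulr_ge0// ltW.
  rewrite -ge0_integralZl//.
  - apply: ae_le_integral_ge0 => [x|x|].
    + by rewrite lee_fin mulr_ge0.
    + by rewrite mule_ge0 ?poweR_ge0// lee_fin mulr_ge0// ltW.
    apply: aeW => x; rewrite vmod_EFin -EFinM lee_fin powR_mulrn ?divr_ge0 ?(ltW eta0)//.
    rewrite le_eqVlt; apply/orP; left; apply/eqP; field; by rewrite gt_eqF.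
  - by apply/measurable_EFinP; exact: measurable_vmod_term.
  - by move=> x _; exact: poweR_ge0.
  - by rewrite lee_fin mulr_ge0// ltW.
apply: (@le_trans _ _ ((k^-1 * k^-1)%:E * (C%:E * (eta * eta)%:E))).
  rewrite lee_wpmul2l ?lee_fin ?mulr_ge0 ?invr_ge0 ?(ltW k0)//.
  apply: (le_trans (hC _ mabs _)) => //.
  by rewrite lee_wpmul2l ?lee_fin ?(ltW C0).
rewrite -[leLHS]/((k^-1 / k * (C * (eta * eta)))%R%:E) lee_fin.
rewrite /k [leLHS](_ : _ = C / (C + 1) ^+ 2)%R; last by field; rewrite !gt_eqF//.
by rewrite ler_pdivrMr ?exprn_gt0// mul1r expr2; nra.
Qed.

End quadratic_modular.

Section lipschitz_on_balls.
Context d {T : measurableType d} {R : realType} (mu : {measure set T -> \bar R}).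
Variables (B : T * R -> set T) (dist : T -> T -> R) (K c1 : R) (Q : nat).
Local Notation vol := (vol mu B).
Hypothesis vol_gt0 : forall b, 0 < b.2 -> 0 < vol b.
Hypothesis BE : forall b y, B b y = (dist y b.1 < b.2) :> Prop.
Hypotheses (K1 : 1 <= K) (dist_ge0 : forall x y, 0 <= dist x y)
  (dist_sym : forall x y, dist x y = dist y x)
  (dist_tri : forall x y z, dist x z <= K * (dist x y + dist y z)).
Hypotheses (c10 : 0 < c1) (Q0 : (0 < Q)%N).
Hypothesis vol_ge : forall b, 0 < b.2 -> c1 * b.2 ^+ Q <= vol b.

(** Two points of a ball of radius r are at distance less than 2 K r, and r^beta is at most a
    multiple of the volume to the power beta/Q. *)
Lemma lipschitz_on_balls (beta L : R) (f : T -> R) : 0 < beta -> 0 < L ->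
  (forall x y, `|f x - f y| <= L * dist x y `^ beta) ->
  exists2 C : R, 0 < C & forall b x y, 0 < b.2 -> B b x -> B b y ->
    `|f x - f y| <= C * vol b `^ (beta / Q%:R).
Proof.
move=> beta0 L0 lip; have k20 : 0 < 2 * K by rewrite mulr_gt0// (lt_le_trans ltr01).
pose c := c1 `^ (beta / Q%:R); have cpos : 0 < c by exact: powR_gt0.
exists (L * (2 * K) `^ beta / c); first by rewrite divr_gt0// mulr_gt0// powR_gt0.
move=> b x y b0; rewrite !BE => xb yb.
apply: (le_trans (lip x y)); rewrite -!mulrA ler_pM2l//.
apply: (@le_trans _ _ ((2 * K) `^ beta * b.2 `^ beta)).
  rewrite -powRM ?(ltW k20) ?(ltW b0)//; apply: ge0_ler_powR.
  - exact: ltW.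
  - by rewrite nnegrE.
  - by rewrite nnegrE mulr_ge0 ?(ltW k20) ?(ltW b0).
  apply: (le_trans (dist_tri x b.1 y)); rewrite (dist_sym b.1 y).
  rewrite -mulrA mulrCA ler_pM2l ?(lt_le_trans ltr01)//; lra.
rewrite ler_pM2l ?powR_gt0// ler_pdivlMl//.
exact: (vol_powR_ge vol_gt0 c10 Q0 vol_ge beta0 b0).
Qed.

End lipschitz_on_balls.

(** * The five assertions *)

Section instantiation.
Context {R : realType} {n : nat} (G : stratified_group R n) (rho : 'rV[R]_n.+1 -> R).
Hypothesis hrho : homogeneous_norm G rho.
Local Notation V := 'rV[R]_n.+1.
Local Notation T := (lebesgue_rV_type R n).
Local Notation mu := (lebesgue_rV R n).
Local Notation Q := (homogeneous_dim G).
Local Notation B := (hball_of G rho).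
Local Notation vol := (vol mu B).
Local Notation dist := (dist G rho).
Local Open Scope ereal_scope.

Lemma poweR_volV (b : V * R) (r : R) : (0 < b.2)%R ->
  (mu (B b) `^ r)^-1 = (vol b `^ r)^-1%:E.
Proof.
move=> b0; rewrite (hball_of_volE hrho b0) poweR_EFin inver gt_eqF//.
exact: (powR_gt0 _ (vol_gt0 hrho b0)).
Qed.

Lemma frac_averageE alpha f (b : V * R) : (0 < b.2)%R ->
  frac_average G alpha f (B b) = favg mu B (alpha / Q%:R) (fun y => `|f y|%:E) b.
Proof.
move=> b0; rewrite /frac_average (poweR_volV _ b0) /favg; congr (_%:E * _).
by rewrite -powRN opprB.
Qed.

(** Carries suprema over balls as sets to suprema over pairs of a centre and a positive radius;
    distinct pairs may give the same set. *)
Lemma hball_of_ballP (A : set V) : is_hball G rho A <-> exists2 b : V * R, (0 < b.2)%R & A = B b.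
Proof.
split => [[x [r [r0 ->]]]|[[x r] r0 ->]]; first by exists (x, r).
by exists x, r; split.
Qed.

Lemma fractional_maximalE alpha f :
  fractional_maximal G rho alpha f = fmax mu B (alpha / Q%:R) (fun y => `|f y|%:E).
Proof.
apply/funext => x; rewrite /fractional_maximal /fmax; congr ereal_sup.
apply/seteqP; split => [_ [A [/hball_of_ballP[b b0 ->] bx] <-]|_ [b [b0 bx] <-]].
  by exists b; [split|rewrite (frac_averageE _ _ b0)].
by exists (B b); [split; [apply/hball_of_ballP; exists b|]|rewrite (frac_averageE _ _ b0)].
Qed.

Lemma local_fractional_maximalE alpha f (c : V * R) :
  local_fractional_maximal G rho alpha (B c) f =
  local_fmax mu B (alpha / Q%:R) c (fun y => `|f y|%:E).
Proof.
apply/funext => x; rewrite /local_fractional_maximal /local_fmax; congr ereal_sup.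
apply/seteqP; split => [_ [A [/hball_of_ballP[b b0 ->] bx bc] <-]|_ [b [b0 bx bc] <-]].
  by exists b; [split|rewrite (frac_averageE _ _ b0)].
by exists (B b); [split; [apply/hball_of_ballP; exists b| |]|rewrite (frac_averageE _ _ b0)].
Qed.

Lemma fractional_maximal0 f :
  fractional_maximal G rho 0 f = hlmax mu B (fun y => `|f y|%:E).
Proof.
rewrite fractional_maximalE mul0r; apply/funext => x.
rewrite /fmax /hlmax; congr ereal_sup; apply: eq_imagel => b [b0 _].
by rewrite /favg /ball_avg sub0r powR_inv1// fine_ge0// measure_ge0.
Qed.

Lemma maximal_commutatorE (b : V -> R) alpha f :
  maximal_commutator G rho b alpha f = commutator mu B (alpha / Q%:R) b f.
Proof.
by apply/funext => x; rewrite /maximal_commutator !fractional_maximalE.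
Qed.

Lemma bounded_maximalP p : bounded_operator p p (fractional_maximal G rho 0) <->
  bounded_maximal mu B p.
Proof.
split => [[C C0 h]|[C C0 h]]; exists C => // f.
  by move=> mf hf; have := h f (conj mf hf); rewrite fractional_maximal0; apply.
by move=> [mf hf]; rewrite fractional_maximal0; exact: h f mf hf.
Qed.

Lemma dist_cover x0 r0 r : (0 < r)%R -> exists s : seq (V * R),
  (forall b, b \in s -> b.2 = r /\ (dist x0 b.1 <= r0)%R) /\
  (forall x, (dist x x0 < r0)%R -> exists2 b, b \in s & B b x).
Proof.
move=> r_gt0; have : compact [set y | (dist x0 y <= r0)%R] by exact: (compact_dist_le hrho).
rewrite compact_cover.
move=> /(_ V [set y | (dist x0 y <= r0)%R] (fun y => hball G rho y r)) [| |D DA cov].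
- by move=> y _; exact: (open_hball hrho).
- by move=> y yr; exists y; [exact: yr|rewrite hballE (distxx hrho)].
exists [seq (y, r) | y <- finmap.enum_fset D]; split.
  by move=> b /mapP[y yD ->]; split => //; have := DA y yD; rewrite inE.
move=> x xr; have [|y yD xy] := cov x; first by rewrite /= (distC hrho) ltW.
by exists (y, r) => //; apply/mapP; exists y.
Qed.

(** Superlevel sets are open: for f(x) > r, the ball about x of radius ((f(x) - r) / D)^(1/beta)
    stays in the set. D = |C| + 1 is positive whatever the sign of C. *)
Lemma measurable_Holder (beta C : R) (f : V -> R) : (0 < beta)%R ->
  (forall x y, (`|f x - f y| <= C * dist x y `^ beta)%R) -> measurable_fun setT (f : T -> R).
Proof.
move=> beta0 lip; apply: (measurability _ (RGenOInfty.measurableE R)) => _ [_ [r ->] <-].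
rewrite setTI; apply: open_measurable_rV; rewrite openE => x /=; rewrite in_itv/= andbT => rx.
pose D := (`|C| + 1)%R; have D0 : (0 < D)%R by rewrite ltr_wpDl.
pose t := ((f x - r) / D)%R; have t0 : (0 < t)%R by rewrite divr_gt0// subr_gt0.
pose s := (t `^ beta^-1)%R; have s0 : (0 < s)%R by exact: powR_gt0.
apply: (@filterS _ _ _ (hball G rho x s)); last first.
  apply: open_nbhs_nbhs; split; first exact: (open_hball hrho).
  by rewrite hballE (distxx hrho).
move=> y; rewrite hballE => yx /=; rewrite in_itv/= andbT.
have h : (dist y x `^ beta < t)%R.
  rewrite -[ltRHS](powRr1 (ltW t0)) -(mulVf (lt0r_neq0 beta0)) powRrM.
  by apply: gt0_ltr_powR => //; rewrite nnegrE ?(ltW s0)// (dist_ge0 hrho).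
have h2 : (`|f y - f x| < f x - r)%R.
  apply: (le_lt_trans (lip y x)); rewrite -(divfK (lt0r_neq0 D0) (f x - r)%R) -/t [ltRHS]mulrC.
  apply: (@le_lt_trans _ _ (D * dist y x `^ beta)%R); last by rewrite ltr_pM2l.
  rewrite ler_wpM2r ?powR_ge0//; have := ler_norm C; rewrite /D; lra.
by move: h2; rewrite ltr_norml => /andP[]; lra.
Qed.

Lemma measurable_dist_le x r : measurable ([set y | (dist x y <= r)%R] : set T).
Proof.
rewrite -[X in measurable X]setCK; apply: measurableC; apply: open_measurable_rV.
rewrite (_ : ~` _ = dist x @^-1` [set y | (r < y)%R]); last first.
  by apply/seteqP; split => y /=; [move/negP; rewrite -ltNge|move=> h; apply/negP; rewrite -ltNge].
apply: open_comp; last exact: open_gt.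
by move=> y _; exact: (continuous_dist hrho).
Qed.

Lemma locally_integrable_ball (f : V -> R) (b : V * R) : locally_integrable_rV f -> (0 < b.2)%R ->
  \int[mu]_(x in B b) `|f x|%:E < +oo.
Proof.
move=> [mf fK] b0; apply: le_lt_trans (fK [set y | (dist b.1 y <= b.2)%R] _); last exact: (compact_dist_le hrho).
apply: ge0_subset_integral.
- exact: (measurable_ball_of hrho).
- exact: measurable_dist_le.
- by apply: measurable_funTS; apply/measurable_EFinP; exact: measurableT_comp.
- by move=> x _; rewrite lee_fin.
- by move=> x; rewrite /hball_of hballE (distC hrho) => /ltW.
Qed.

End instantiation.

Section assertions.
Context {R : realType} {n : nat} (G : stratified_group R n) (rho : 'rV[R]_n.+1 -> R).
Hypothesis hrho : homogeneous_norm G rho.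
Local Notation V := 'rV[R]_n.+1.
Local Notation T := (lebesgue_rV_type R n).
Local Notation mu := (lebesgue_rV R n).
Local Notation Q := (homogeneous_dim G).
Local Notation B := (hball_of G rho).
Local Notation vol := (vol mu B).
Local Notation dist := (dist G rho).
Local Open Scope ereal_scope.

Lemma maximal_exponent_two : maximal_exponent G rho (fun=> 2%R).
Proof.
have muT : 0 < mu [set: T] by exact: (@open_outer_gt0 R n setT 0 openT I).
split.
  split => //.
  - by move=> _; rewrite ltr1n.
  - by rewrite /exponent_minus (ess_inf_cst _ muT) lte_fin ltr1n.
  - by rewrite /exponent_plus (ess_sup_cst _ muT) ltry.
apply/(bounded_maximalP hrho).
apply: bounded_maximal_two.
- exact: (ball_of_center hrho).
- exact: (measurable_hlmax hrho).
- exact: (hlmax_L2 hrho).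
Qed.

Lemma fractional_exponents_exist (gamma : R) : (0 < gamma < Q%:R)%R ->
  exists p q, fractional_exponents G rho gamma p q.
Proof.
move=> /andP[g0 gQ]; have Q0 : (0 < Q%:R :> R)%R by exact: lt_trans gQ.
have muT : 0 < mu [set: T] by exact: (@open_outer_gt0 R n setT 0 openT I).
pose t := (gamma / Q%:R)%R.
have t0 : (0 < t)%R by rewrite divr_gt0.
have t1 : (t < 1)%R by rewrite ltr_pdivrMr// mul1r.
have t'0 : (0 < 1 + t)%R by rewrite addr_gt0.
have t''0 : (0 < 1 - t)%R by rewrite subr_gt0.
have p1 : (1 < 2 / (1 + t))%R by rewrite ltr_pdivlMr// mul1r; lra.
(* Chosen so that [q (1 - t) = 2]. *)
exists (fun=> 2 / (1 + t))%R, (fun=> 2 / (1 - t))%R; split.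
- split => //.
  + by rewrite /exponent_minus (ess_inf_cst _ muT) lte_fin.
  + by rewrite /exponent_plus (ess_sup_cst _ muT) ltry.
- rewrite /exponent_plus (ess_sup_cst _ muT) lte_fin -[(_ / gamma)%R]invf_div -/t.
  by rewrite ltr_pdivrMr// mulrC ltr_pdivlMr//; lra.
- by move=> x; rewrite -/t; field; rewrite !gt_eqF.
rewrite (_ : (fun x => _) = fun=> 2%R); first exact: maximal_exponent_two.
apply/funext => x; rewrite -mulrA mulrBl mulfV ?gt_eqF// -/t divfK// gt_eqF//.
Qed.

Variables (alpha beta : R) (b : V -> R).
Hypotheses (beta0 : (0 < beta)%R) (alpha0 : (0 < alpha)%R) (abQ : (alpha + beta < Q%:R)%R)
  (hb : locally_integrable_rV b).

Let Qgt0 : (0 < Q%:R :> R)%R. Proof. by apply: lt_trans abQ; exact: addr_gt0. Qed.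

Let Q0 : (0 < Q)%N. Proof. by rewrite -(ltr0n R). Qed.

Let a0 : (0 < alpha / Q%:R)%R. Proof. exact: divr_gt0. Qed.
Let e0 : (0 < beta / Q%:R)%R. Proof. exact: divr_gt0. Qed.
Let ae1 : (alpha / Q%:R + beta / Q%:R < 1)%R.
Proof. by rewrite -mulrDl ltr_pdivrMr// mul1r. Qed.

Let mb : measurable_fun setT (b : T -> R). Proof. by case: hb. Qed.

Let b_loc c : (0 < c.2)%R -> \int[mu]_(x in B c) `|b x|%:E < +oo.
Proof. exact: (locally_integrable_ball hrho hb). Qed.

Definition Lipschitz_nonneg := Lipschitz_space G rho beta b /\ {ae mu, forall x, (0 <= b x)%R}.

Let Lipschitz_on_balls : Lipschitz_nonneg -> exists2 b' : V -> R,
  {ae mu, forall x, b x = b' x} & exists2 C : R, (0 < C)%R &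
  forall c x y, (0 < c.2)%R -> B c x -> B c y -> (`|b' x - b' y| <= C * vol c `^ (beta / Q%:R))%R.
Proof.
move=> [[b' bb' [L L0 lip]] _]; exists b' => //.
have [K K1 tri] := dist_triangle hrho.
have [c1 [c2 [c10 _ hv]]] := vol_bounds hrho.
apply: (@lipschitz_on_balls _ _ _ mu B dist K c1 Q (vol_gt0 hrho) _ K1 (dist_ge0 hrho)
  (distC hrho) tri c10 Q0 _ beta L b' beta0 L0).
- by [].
- by move=> c c0; exact: (hv c c0).1.
- by move=> x y; rewrite (distC hrho); exact: lip.
Qed.

Let exponent_sE (p q : V -> R) : fractional_exponents G rho (alpha + beta) p q ->
  (forall x, ((q x)^-1 = (p x)^-1 - (alpha / Q%:R + beta / Q%:R))%R) /\
  (forall x, (q x * (Q%:R - (alpha + beta)) / Q%:R =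
     q x * (1 - (alpha / Q%:R + beta / Q%:R)))%R).
Proof.
move=> [_ _ qE _]; split => x; first by rewrite -mulrDl qE.
by rewrite -mulrDl -mulrA mulrBl mulfV// gt_eqF.
Qed.

Lemma bounded_commutator_of_Lipschitz : Lipschitz_nonneg -> forall p q,
  fractional_exponents G rho (alpha + beta) p q ->
  bounded_operator p q (maximal_commutator G rho b alpha).
Proof.
move=> hL p q hpq; have [b' bb' [C C0 hC]] := Lipschitz_on_balls hL.
have [qE sE] := exponent_sE hpq.
have [[mp p1 _ _] _ _ [[ms s1 _ _] /(bounded_maximalP hrho) bs]] := hpq.
have hfin := hlmax_fin_ae (measurable_hlmax hrho) (hlmax_weak_type hrho).
have [D D0 hD] := commutator_bounded (T := T) (mu := mu) (B := B) (measurable_ball_of hrho) (hball_of_volE hrho)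
  (vol_gt0 hrho) (ball_of_center hrho) mb C0 e0 a0 ae1 bb' hL.2 hC hfin p1 s1 mp ms qE sE bs.
exists D => // f [mf _]; rewrite (maximal_commutatorE hrho); exact: hD.
Qed.

Lemma Lipschitz_of_deficit : (exists2 C : R, (0 < C)%R & forall c, (0 < c.2)%R ->
    \int[mu]_(x in B c) (deficit mu B b c x)%:E <= (C * vol c `^ (beta / Q%:R) * vol c)%:E) ->
  Lipschitz_nonneg.
Proof.
move=> [C C0 hC]; have [K K1 tri] := dist_triangle hrho.
have [c1 [c2 [c10 c20 hv]]] := vol_bounds hrho.
have [[b' bb' [L L0 lip]] b0] := @campanato _ _ _ mu B dist K c1 c2 Q
  (measurable_ball_of hrho) (hball_of_volE hrho) (vol_gt0 hrho) (fun _ _ => erefl) K1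
  (dist_ge0 hrho) (distC hrho) tri (dist_eq0 hrho) c10 c20 Q0
  (fun c c0 => (hv c c0).1) (fun c c0 => (hv c c0).2) beta beta0 (vitali_finite hrho)
  (dist_cover hrho) (fun f D => @measurable_Holder _ _ _ _ hrho beta D f beta0)
  b mb b_loc C C0 hC.
split => //; exists b' => //; exists L => // x y.
by have := lip x y; rewrite (distC hrho).
Qed.

Lemma Lipschitz_of_bounded_commutator p q : fractional_exponents G rho (alpha + beta) p q ->
  bounded_operator p q (maximal_commutator G rho b alpha) -> Lipschitz_nonneg.
Proof.
move=> hpq [C C0 hC]; apply: Lipschitz_of_deficit.
have [qE sE] := exponent_sE hpq.
have [[mp p1 _ _] _ _ [[ms s1 _ _] /(bounded_maximalP hrho) bs]] := hpq.
have a01 : (0 < alpha / Q%:R < 1)%R by rewrite a0/=; move: ae1 e0; lra.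
apply: (deficit_avg_commutator (T := T) (mu := mu) (B := B) (measurable_ball_of hrho) (hball_of_volE hrho) (vol_gt0 hrho)
  mb b_loc s1 bs C0 a01 e0 ae1 p1 mp ms qE sE).
move=> f mf hf; rewrite -(maximal_commutatorE hrho); exact: (hC f (conj mf hf)).
Qed.

(** The norm of the indicator is a positive real, so the extended-real quotient in [oscillation] is
    a multiplication by a positive constant. *)
Let oscillationE (s : V -> R) c : (forall x, (1 < s x)%R) -> (0 < c.2)%R ->
  exists2 N : R, (0 < N)%R & vnorm mu s (EFin \o \1_(B c)) = N%:E /\
  oscillation G rho alpha beta s b (B c) = (vol c `^ (beta / Q%:R) * N)^-1%:E *
  vnorm mu s (fun x => ((b x)%:E - (vol c `^ (alpha / Q%:R))^-1%:E *
     local_fmax mu B (alpha / Q%:R) c (fun y => `|b y|%:E) x) * (\1_(B c) x)%:E).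
Proof.
move=> s1 c0; have [N N0 NE] := vnorm_indic (T := T) (mu := mu) (measurable_ball_of hrho c) s1
  (hball_of_volE hrho c0) (vol_gt0 hrho c0).
exists N => //; split => //; rewrite /oscillation (poweR_volV hrho _ c0).
rewrite (poweR_volV hrho _ c0) (local_fractional_maximalE hrho).
rewrite [variable_norm s (EFin \o \1_(B c))]NE inver gt_eqF//.
by rewrite muleCA muleC -EFinM -invfM [(vol c `^ _ * N)%R]mulrC.
Qed.

Lemma bounded_oscillation_of_Lipschitz : Lipschitz_nonneg -> forall s, maximal_exponent G rho s ->
  bounded_oscillation G rho alpha beta s b.
Proof.
move=> hL s [[ms s1 _ _] _]; have [b' bb' [C C0 hC]] := Lipschitz_on_balls hL.
apply: (@le_lt_trans _ _ C%:E); last exact: ltry.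
apply: ge_ereal_sup => _ [A /hball_of_ballP[c c0 ->] <-].
have [N N0 [NE ->]] := oscillationE s1 c0.
have v0 : (0 < vol c `^ (beta / Q%:R))%R by apply: powR_gt0; exact: (vol_gt0 hrho).
rewrite lee_pdivrMl; last by rewrite mulr_gt0.
have := vnorm_oscillation_le (T := T) (mu := mu) (B := B) (measurable_ball_of hrho) (hball_of_volE hrho) (vol_gt0 hrho)
  mb C0 e0 a0 bb' hL.2 hC s1 c0.
by rewrite NE => /le_trans; apply; rewrite -!EFinM lee_fin [leRHS]mulrC mulrA.
Qed.

Lemma Lipschitz_of_bounded_oscillation s : maximal_exponent G rho s ->
  bounded_oscillation G rho alpha beta s b -> Lipschitz_nonneg.
Proof.
move=> [[ms s1 _ _] /(bounded_maximalP hrho) bs] hosc; apply: Lipschitz_of_deficit.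
have [C C0 hC] : exists2 C : R, (0 < C)%R & forall c, (0 < c.2)%R ->
    oscillation G rho alpha beta s b (B c) <= C%:E.
  have h c : (0 < c.2)%R -> oscillation G rho alpha beta s b (B c) <=
      ereal_sup [set oscillation G rho alpha beta s b A | A in is_hball G rho].
    by move=> c0; apply: ereal_sup_ubound; exists (B c) => //; apply/hball_of_ballP; exists c.
  move: hosc h; rewrite /bounded_oscillation; case: (ereal_sup _) => [r| |]// _ h.
    exists (`|r| + 1)%R; first by rewrite ltr_wpDl.
    by move=> c c0; apply: (le_trans (h c c0)); rewrite lee_fin; have := ler_norm r; lra.
  by exists 1%R => // c c0; apply: (le_trans (h c c0)); rewrite leNye.
apply: (deficit_avg_oscillation (T := T) (mu := mu) (B := B) (measurable_ball_of hrho) (hball_of_volE hrho) (vol_gt0 hrho)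
  mb b_loc s1 bs (a := alpha / Q%:R) C0) => c c0.
have [N N0 [NE oE]] := oscillationE s1 c0.
have v0 : (0 < vol c `^ (beta / Q%:R))%R by apply: powR_gt0; exact: (vol_gt0 hrho).
have := hC c c0; rewrite oE lee_pdivrMl; last by rewrite mulr_gt0.
by rewrite NE => /le_trans; apply; rewrite -!EFinM lee_fin [leLHS]mulrC mulrA.
Qed.

End assertions.

Theorem theorem1p1 (R : realType) (n : nat) (G : stratified_group R n)
    (rho : 'rV[R]_n.+1 -> R) (hrho : homogeneous_norm G rho)
    (alpha beta : R) (hbeta0 : 0 < beta) (hbeta1 : beta < 1)
    (halpha : 0 < alpha) (hQ : alpha + beta < (homogeneous_dim G)%:R)
    (b : 'rV[R]_n.+1 -> R) (hb : locally_integrable_rV b) :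
  [<->
       Lipschitz_space G rho beta b /\
         {ae lebesgue_rV R n, forall x, 0 <= b x};
       forall p q, fractional_exponents G rho (alpha + beta) p q ->
         bounded_operator p q (maximal_commutator G rho b alpha);
       exists p q, fractional_exponents G rho (alpha + beta) p q /\
         bounded_operator p q (maximal_commutator G rho b alpha);
       exists s, maximal_exponent G rho s /\
         bounded_oscillation G rho alpha beta s b;
       forall s, maximal_exponent G rho s ->
         bounded_oscillation G rho alpha beta s b].
Proof.
have osc := bounded_oscillation_of_Lipschitz hrho hbeta0 halpha hQ hb.
tfae.
- exact: bounded_commutator_of_Lipschitz.
- move=> h; have [|p [q hpq]] := @fractional_exponents_exist _ _ _ _ hrho (alpha + beta).
    by rewrite hQ addr_gt0.
  by exists p, q; split => //; exact: h.
(* The remaining implications pass through the first assertion; the exponent 2 is the witness here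
   and the test exponent in the last one. *)
- move=> [p [q [hpq /(Lipschitz_of_bounded_commutator hrho hbeta0 halpha hQ hb hpq) hL]]].
  by exists (fun=> 2); split; [exact: maximal_exponent_two|exact: osc hL _ (maximal_exponent_two hrho)].
- by move=> [s [hs /(Lipschitz_of_bounded_oscillation hrho hbeta0 halpha hQ hb hs)]].
- move=> h; apply: (Lipschitz_of_bounded_oscillation hrho hbeta0 halpha hQ hb (maximal_exponent_two hrho)).
  exact: h _ (maximal_exponent_two hrho).
Qed.
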